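(* Let $g_\alpha\ge0$ and $\lambda\in\mathcal{P}^+$, and let $p_\lambda=m_\lambda+\sum_{\mu\in\mathcal{P}^+,\mu\prec\lambda}c_{\lambda\mu}m_\mu$ be the monic Heckman–Opdam polynomial. For $\mu,\nu\in\mathcal{P}^+$ set $\epsilon_\mu=\langle\mu+\rho_g,\mu+\rho_g\rangle-\langle\rho_g,\rho_g\rangle$ and $d_{\mu\nu}=\frac{|W_\nu|}{|W_\mu|}\sum_{\alpha\in[\mu,\nu]}g_\alpha\langle\mu,\alpha\rangle n_{\mu\nu}(\alpha)$. Let $\lambda^{(1)},\dots,\lambda^{(n)}=\lambda$ be any enumeration of $\{\mu\in\mathcal{P}^+\mid\mu\preceq\lambda\}$ with $\lambda^{(i)}\prec\lambda^{(j)}\Rightarrow i<j$, and $\mathcal{E}_\lambda=\prod_{\mu\in\mathcal{P}^+,\mu\prec\lambda}(\epsilon_\lambda-\epsilon_\mu)$. Then: (i) $p_\lambda=\mathcal{E}_\lambda^{-1}\det M$, where $M$ is the $n\times n$ matrix with first column $(m_{\lambda^{(1)}},\dots,m_{\lambda^{(n)}})^T$ and whose $(k+1)$-st column ($1\le k\le n-1$) has row-$j$ entry $0$ if $j<k$, $\epsilon_{\lambda^{(k)}}-\epsilon_\lambda$ if $j=k$, and $d_{\lambda^{(j)}\lambda^{(k)}}$ if $j>k$; (ii) $c_{\lambda\lambda}=1$ and for $1<\ell\le n$: $c_{\lambda\lambda^{(\ell-1)}}=\frac{1}{\epsilon_\lambda-\epsilon_{\lambda^{(\ell-1)}}}\sum_{k=\ell}^n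 c_{\lambda\lambda^{(k)}}d_{\lambda^{(k)}\lambda^{(\ell-1)}}$; (iii) $c_{\lambda\lambda^{(\ell)}}=\sum_{\ell=j_r<\cdots<j_1<j_0=n,\ r=1,\dots,n-\ell}\frac{d_{\lambda^{(j_0)}\lambda^{(j_1)}}\cdots d_{\lambda^{(j_{r-1})}\lambda^{(j_r)}}}{(\epsilon_\lambda-\epsilon_{\lambda^{(j_1)}})\cdots(\epsilon_\lambda-\epsilon_{\lambda^{(j_r)}})}$, the empty sum ($\ell=n$) being $1$.
   Context: $E$ real Euclidean space spanned by an irreducible, not necessarily reduced, root system $R$, Weyl group $W$, positive roots $R^+$, $\alpha^\vee=2\alpha/\langle\alpha,\alpha\rangle$, $r_\alpha(x)=x-\langle x,\alpha^\vee\rangle\alpha$, $P_\alpha=(\mathrm{Id}+r_\alpha)/2$. $\mathcal{Q}^+=\mathrm{Span}_{\mathbb{N}}(R^+)$, $\mathcal{Q}^\vee=\mathrm{Span}_{\mathbb{Z}}\{\alpha^\vee\}$, weight lattice $\mathcal{P}$, dominant weights $\mathcal{P}^+$, order $\lambda\succeq\mu$ iff $\lambda-\mu\in\mathcal{Q}^+$. Exponentials $e^\lambda=e^{i\langle\lambda,x\rangle}$ on the torus $\mathbb{T}=E/(2\pi\mathcal{Q}^\vee)$; $\mathcal{A}^W$ the $W$-invariant Fourier polynomials with basis $m_\lambda=\sum_{\mu\in W(\lambda)}e^\mu$, $\lambda\in\mathcal{P}^+$. Parameters $g_\alpha\ge0$ with $g_{w(\alpha)}=g_\alpha$; $\rho_g=\frac12\sum_{\alpha\in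 R^+}g_\alpha\alpha$. With weight $\Delta^{HO}=\prod_{\alpha\in R}(1-e^\alpha)^{g_\alpha}$ and inner product $\langle f,g\rangle_\Delta=\frac1{|W|}\int_{\mathbb{T}}f\bar g\,\Delta^{HO}\,dx$, the Heckman–Opdam polynomial $p_\lambda$ is the unique element $m_\lambda+\sum_{\mu\in\mathcal{P}^+,\mu\prec\lambda}c_{\lambda\mu}m_\mu$ with $\langle p_\lambda,m_\mu\rangle_\Delta=0$ for all $\mu\in\mathcal{P}^+$, $\mu\prec\lambda$. $W_\mu$ is the stabilizer of $\mu$ in $W$; $[p]$ the integer part of $p\ge0$; $[\mu,\nu]$ is the set of $\alpha\in R^+$ such that $\mu-\ell\alpha\in W(\nu)$ for some $\ell\in\{1,\dots,[\langle\mu,\alpha^\vee\rangle/2]\}$; $n_{\mu\nu}(\alpha)=1$ if $\|\nu\|=\|P_\alpha(\mu)\|$, else $2$. *)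

(* Defs.v *)
From mathcomp Require Import all_boot all_order all_algebra.
From mathcomp Require Import all_classical all_reals all_analysis.
From mathcomp Require Import finmap.
From mathcomp.real_closed Require Export complex.
Import Order.TTheory GRing.Theory Num.Theory.

Set Implicit Arguments.
Unset Strict Implicit.
Unset Printing Implicit Defensive.

Local Open Scope classical_set_scope.
Local Open Scope ring_scope.

Section HO.
Variables (R : realType) (r : nat).
Local Notation E := 'rV[R]_r.

Definition dotp (u v : E) : R := (u *m v^T) 0 0.
Definition enorm (u : E) : R := Num.sqrt (dotp u u).

Definition coroot (a : E) : E := (2 / dotp a a) *: a.

(* reflection r_alpha, acting on the right on row vectors:
   x *m refl a = x - <x, a^vee> a *)
Definition refl (a : E) : 'M[R]_r := 1%:M - (coroot a)^T *m a.

Definition Palpha (a x : E) : E := 2^-1 *: (x + x *m refl a).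

(* Bourbaki root system (not necessarily reduced), irreducible *)
Definition root_system (rs : seq E) : Prop :=
  [/\ uniq rs, 0 \notin rs, <<rs>>%VS = fullv,
      (forall a b, a \in rs -> b \in rs -> b *m refl a \in rs) &
      (forall a b, a \in rs -> b \in rs -> dotp b (coroot a) \is a Num.int)].

Definition irreducible_rs (rs : seq E) : Prop :=
  forall P : pred E,
    (forall a b, a \in rs -> b \in rs -> P a -> ~~ P b -> dotp a b = 0) ->
    (forall a, a \in rs -> P a) \/ (forall a, a \in rs -> ~~ P a).

Definition regular (rs : seq E) (h : E) : Prop :=
  forall a, a \in rs -> dotp a h != 0.
Definition posroots (rs : seq E) (h : E) : seq E :=
  [seq a <- rs | 0 < dotp a h].

Definition weyl (rs : seq E) : set 'M[R]_r :=
  [set w | exists s : seq E, all (mem rs) s /\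
             w = foldr (fun a m => refl a *m m) 1%:M s].

Definition orbit (rs : seq E) (lam : E) : set E :=
  [set lam *m w | w in weyl rs].

Definition stab (rs : seq E) (mu : E) : set 'M[R]_r :=
  [set w | weyl rs w /\ mu *m w = mu].

Definition card_stab (rs : seq E) (mu : E) : nat := (#|` fset_set (stab rs mu)|)%fset.

Definition weight (rs : seq E) (lam : E) : Prop :=
  forall a, a \in rs -> dotp lam (coroot a) \is a Num.int.
Definition dominant (rs : seq E) (h : E) (lam : E) : Prop :=
  weight rs lam /\ forall a, a \in posroots rs h -> 0 <= dotp lam (coroot a).

Definition Qplus (rs : seq E) (h : E) (v : E) : Prop :=
  exists k : E -> nat, v = \sum_(a <- posroots rs h) (k a)%:R *: a.
Definition wle (rs : seq E) (h : E) (mu lam : E) : Prop := Qplus rs h (lam - mu).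
Definition wlt (rs : seq E) (h : E) (mu lam : E) : Prop :=
  wle rs h mu lam /\ mu <> lam.

Definition Qvee (rs : seq E) (v : E) : Prop :=
  exists z : E -> int, v = \sum_(a <- rs) (z a)%:~R *: coroot a.

Definition rho (rs : seq E) (h : E) (g : E -> R) : E :=
  2^-1 *: \sum_(a <- posroots rs h) g a *: a.

Definition expi (t : R) : R[i] := Complex (cos t) (sin t).
Definition ex (mu x : E) : R[i] := expi (dotp mu x).

Definition msym (rs : seq E) (lam : E) (x : E) : R[i] :=
  \sum_(mu <- fset_set (orbit rs lam)) ex mu x.

(* weight Delta^{HO}(x) = prod_{alpha in R} |1 - e^alpha(x)|^{g_alpha}
   (equal to prod_{alpha in R} (1 - e^alpha)^{g_alpha}) *)
Definition DeltaHO (rs : seq E) (g : E -> R) (x : E) : R :=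
  \prod_(a <- rs) powR (Normc.normc (1 - ex a x)) (g a).

Fixpoint cube_int (k : nat) (F : (nat -> R) -> R) : R :=
  if k is k'.+1 then
    \int[lebesgue_measure]_(s in `[0%R, 1%R]%classic)
       cube_int k' (fun t => F (fun i => if i == k' then s else t i))
  else F (fun _ => 0).

(* integral over the torus E / (2 pi Q^vee), parametrised by a Z-basis b of
   Q^vee : x = 2 pi sum_i t_i b_i, t in [0,1]^r  (up to a positive constant) *)
Definition torus_int (b : 'I_r -> E) (f : E -> R[i]) : R[i] :=
  let phi := fun t : nat -> R => (2 * pi) *: \sum_(i < r) t i *: b i in
  Complex (cube_int r (fun t => complex.Re (f (phi t))))
          (cube_int r (fun t => complex.Im (f (phi t)))).

Definition zbasis_Qvee (rs : seq E) (b : 'I_r -> E) : Prop :=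
  forall v, Qvee rs v <-> exists z : 'I_r -> int, v = \sum_(i < r) (z i)%:~R *: b i.

Definition HOinner (rs : seq E) (g : E -> R) (b : 'I_r -> E) (f1 f2 : E -> R[i])
  : R[i] :=
  ((#|` fset_set (weyl rs)|)%fset%:R)^-1%:C%C *
  torus_int b (fun x => f1 x * conjc (f2 x) * ((DeltaHO rs g x)%:C)%C).

Definition below (rs : seq E) (h : E) (lam : E) : set E :=
  [set mu | dominant rs h mu /\ wlt rs h mu lam].
Definition belowe (rs : seq E) (h : E) (lam : E) : set E :=
  [set mu | dominant rs h mu /\ wle rs h mu lam].

Definition eps (rs : seq E) (h : E) (g : E -> R) (mu : E) : R :=
  dotp (mu + rho rs h g) (mu + rho rs h g) - dotp (rho rs h g) (rho rs h g).

Definition bracket (rs : seq E) (h : E) (mu nu a : E) : Prop :=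
  a \in posroots rs h /\
  exists l : nat, (1 <= l)%N /\ (l%:R <= dotp mu (coroot a) / 2) /\
                  orbit rs nu (mu - l%:R *: a).

Definition nmunu (mu nu a : E) : R :=
  if enorm nu == enorm (Palpha a mu) then 1 else 2.

Definition dmunu (rs : seq E) (h : E) (g : E -> R) (mu nu : E) : R :=
  ((card_stab rs nu)%:R / (card_stab rs mu)%:R) *
  \sum_(a <- posroots rs h | `[< bracket rs h mu nu a >]) g a * dotp mu a * nmunu mu nu a.

Definition Elam (rs : seq E) (h : E) (g : E -> R) (lam : E) : R :=
  \prod_(mu <- fset_set (below rs h lam)) (eps rs h g lam - eps rs h g mu).

End HO.

(* Main.v *)
(** The determinant and path-sum formulas follow formally from the triangular
    linear system for the coefficients of [p_lambda] that expresses
    [L p_lambda = eps_lambda p_lambda], where [L] is the Heckman-Opdam Laplacian.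
    [L] is triangular on the [m_mu]: expanding [(1 + e^-a) / (1 - e^-a)] along root
    strings, its matrix is given by [eps_mu] and [d_{mu nu}].  [L] is symmetric for the
    weighted inner product, by integration by parts.  As the weight need not be
    differentiable on the walls, this is done for the weight with
    [|1 - e^a|^2] replaced by [|1 - e^a|^2 + t], and [t] then tends to [0] uniformly.
    Hence [L p - eps_lambda p] is a combination of the [m_mu] with [mu] below [lambda]
    that is orthogonal to itself, so it vanishes. *)
Require Import Defs.
From mathcomp Require Import all_boot all_order all_algebra.
From mathcomp Require Import all_classical all_reals all_analysis.
From mathcomp Require Import finmap.
From mathcomp.real_closed Require Import complex.
From mathcomp Require Import ring lra zify.
Import Order.TTheory GRing.Theory Num.Theory.
Import numFieldNormedType.Exports.
Local Open Scope ring_scope.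
Set Implicit Arguments.
Unset Strict Implicit.
Unset Printing Implicit Defensive.

(** * Uniformly continuous functions *)

(** Three obstacles shape the argument. The integral is an iterated one-variable integral, so
    linearity, translation invariance and definiteness are proved by induction on the dimension,
    inside a class of bounded uniformly continuous functions that is closed under the operations
    used. At the walls, the logarithmic derivative of the regularised weight leads to factors
    [chord2 / (chord2 + t)], which do not tend to 1 uniformly; each is paired with its own factor of
    the weight, which vanishes on the same wall when [g a > 0], while for [g a = 0] the term is
    absent. Finally, a vanishing integral only shows that a function vanishes off the walls, and
    continuity removes this exception. The numbers in [dmunu] are counts: in the string from [mu] to
    its reflection the two ends give the [rho] part of [eps], each interior point is met twice, and
    [nmunu] is the number of interior points in the orbit of [nu], when there are any. The ratio of
    stabilizers comes from replacing orbit sums by sums over the Weyl group. *)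

Section UniformContinuity.
Context {R : realType}.
Local Open Scope classical_set_scope.
Local Open Scope ring_scope.

(** Only [x] is confined to the segment; [y] may leave it. This is what [ulim_powR] needs, where
    adding [t] can push the argument past the bound [4]. *)
Lemma continuous_unif_segment (f : R -> R) (M : R) : continuous f ->
  forall e : R, 0 < e -> exists2 d : R, 0 < d &
    forall x y : R, `|x| <= M -> `|x - y| < d -> `|f x - f y| < e.
Proof.
move=> cf e e0.
have /compact_near_coveringP := @segment_compact R (- M) M.
move=> /(_ R (0^'+)%classic (fun d x => forall y, `|x - y| < d -> `|f x - f y| < e)).
case=> [x _|d /= d0 H].
- have /cvgrPdist_lt /(_ (e / 2)) := cf x.
  rewrite divr_gt0// => /(_ isT) /nbhs_ballP [d /= d0 Hd].
  exists (ball x (d / 2), [set d' | d' < d / 2]%classic) => /=.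
    split; first by apply: nbhsx_ballx; rewrite divr_gt0.
    by apply: nbhs_right_lt; rewrite divr_gt0.
  move=> [x' d'] /= [xx' dd'] y x'y.
  have H1 : `|f x - f x'| < e / 2.
    by apply: Hd; apply: le_ball xx'; lra.
  have H2 : `|f x - f y| < e / 2.
    apply: Hd; rewrite /ball/=.
    have -> : x - y = (x - x') + (x' - y) by ring.
    apply: le_lt_trans (ler_normD _ _) _.
    rewrite /ball/= in xx'; lra.
  have -> : f x' - f y = (f x - f y) - (f x - f x') by ring.
  apply: le_lt_trans (ler_normB _ _) _; lra.
- exists (d / 2); first by rewrite divr_gt0.
  move=> x y xM; apply: H => /=; rewrite ?divr_gt0//.
    rewrite sub0r normrN gtr0_norm ?divr_gt0//; lra.
  by rewrite in_itv/= -ler_norml.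
Qed.

Section Class.
Variables (T : Type) (nr : R -> T -> T -> Prop).
Hypothesis nrS : forall d d' x y, d <= d' -> nr d x y -> nr d' x y.

(** The proximity relation [nr] is a parameter because the class is used both for functions of the
    first coordinates of a sequence and for functions on [E]. Boundedness is included because
    uniform continuity alone is not stable under products. *)
Definition ucb (F : T -> R) : Prop :=
  (exists M, forall t, `|F t| <= M) /\
  forall e, 0 < e -> exists2 d, 0 < d &
    forall x y, nr d x y -> `|F x - F y| < e.

Lemma ucb_cst c : ucb (fun=> c).
Proof.
split; first by exists `|c|.
by move=> e e0; exists 1 => // x y _; rewrite subrr normr0.
Qed.

Lemma ucbD F G : ucb F -> ucb G -> ucb (fun x => F x + G x).
Proof.
move=> [[M HM] uF] [[N HN] uG]; split.
  exists (M + N) => t; apply: le_trans (ler_normD _ _) _; exact: lerD.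
move=> e e0; have e20 : 0 < e / 2 by rewrite divr_gt0.
have [d1 d10 H1] := uF _ e20; have [d2 d20 H2] := uG _ e20.
exists (Num.min d1 d2); first by rewrite lt_min d10.
move=> x y xy.
have h1 : `|F x - F y| < e / 2 by apply: H1; apply: nrS xy; rewrite ge_min lexx.
have h2 : `|G x - G y| < e / 2 by apply: H2; apply: nrS xy; rewrite ge_min lexx orbT.
have -> : F x + G x - (F y + G y) = (F x - F y) + (G x - G y) by ring.
apply: le_lt_trans (ler_normD _ _) _; lra.
Qed.

Lemma ucb_comp (f : R -> R) F : continuous f -> ucb F -> ucb (fun x => f (F x)).
Proof.
move=> cf [[M HM] uF]; split.
  have [d d0 Hd] := continuous_unif_segment M cf ltr01.
  have cf' : {within `[- M, M]%classic, continuous f} by apply: continuous_subspaceT.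
  have [M0|M0] := leP (- M) M; last first.
    exists 0 => t; exfalso; move: (HM t) (normr_ge0 (F t)); lra.
  have [c1 _ H1] := EVT_max M0 cf'; have [c2 _ H2] := EVT_min M0 cf'.
  exists (`|f c1| + `|f c2|) => t.
  have Ft : F t \in `[(- M), M] by rewrite in_itv/= -ler_norml.
  have := H1 _ Ft; have := H2 _ Ft.
  have := ler_norm (f c1); have := ler_norm (- f c2); rewrite normrN.
  have := normr_ge0 (f c1); have := normr_ge0 (f c2).
  move=> *; rewrite ler_norml; apply/andP; split; lra.
move=> e e0; have [d d0 Hd] := continuous_unif_segment M cf e0.
have [d' d'0 Hd'] := uF _ d0; exists d' => // x y xy.
by apply: Hd => //; apply: Hd'.
Qed.

Lemma ucbZ c F : ucb F -> ucb (fun x => c * F x).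
Proof. by apply: (@ucb_comp (fun u => c * u)) => x; apply: cvgMr; exact: cvg_id. Qed.

Lemma ucbN F : ucb F -> ucb (fun x => - F x).
Proof. by apply: (@ucb_comp (fun u => - u)) => x; exact: cvgN. Qed.

Lemma ucbB F G : ucb F -> ucb G -> ucb (fun x => F x - G x).
Proof. by move=> uF uG; apply: ucbD => //; exact: ucbN. Qed.

Lemma ucb_ext F G : F =1 G -> ucb F -> ucb G.
Proof. by move=> /funext ->. Qed.

(** Polarisation reduces products to squares, which are compositions with a continuous function. *)
Lemma ucbM F G : ucb F -> ucb G -> ucb (fun x => F x * G x).
Proof.
move=> uF uG.
have sq H : ucb H -> ucb (fun x => H x ^+ 2).
  apply: (@ucb_comp (fun u => u ^+ 2)) => x; exact: exprn_continuous.
apply: (@ucb_ext (fun x => 4^-1 * ((F x + G x) ^+ 2 - (F x - G x) ^+ 2))).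
  by move=> x; field.
by apply: ucbZ; apply: ucbB; apply: sq; [exact: ucbD|exact: ucbB].
Qed.

Lemma ucb_sum (I : Type) (s : seq I) (P : pred I) (F : I -> T -> R) :
  (forall i, P i -> ucb (F i)) -> ucb (fun x => \sum_(i <- s | P i) F i x).
Proof.
move=> uF; elim: s => [|i s IH].
  by apply: ucb_ext (ucb_cst 0) => x; rewrite big_nil.
case Pi : (P i); last by apply: ucb_ext IH => x; rewrite big_cons Pi.
by apply: ucb_ext (ucbD (uF i Pi) IH) => x; rewrite big_cons Pi.
Qed.

Lemma ucb_prod (I : Type) (s : seq I) (P : pred I) (F : I -> T -> R) :
  (forall i, P i -> ucb (F i)) -> ucb (fun x => \prod_(i <- s | P i) F i x).
Proof.
move=> uF; elim: s => [|i s IH].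
  by apply: ucb_ext (ucb_cst 1) => x; rewrite big_nil.
case Pi : (P i); last by apply: ucb_ext IH => x; rewrite big_cons Pi.
by apply: ucb_ext (ucbM (uF i Pi) IH) => x; rewrite big_cons Pi.
Qed.

End Class.
End UniformContinuity.

(** * Integrals of continuous functions over the unit interval *)

Section UnitInterval.
Context {R : realType}.
Local Open Scope classical_set_scope.
Local Open Scope ring_scope.
Local Notation mu := (@lebesgue_measure R).
Local Notation int01 f := (\int[mu]_(s in `[0%R, 1%R]%classic) f s).

Lemma continuous_integrable01 (f : R -> R) : continuous f ->
  mu.-integrable `[0%R, 1%R]%classic (EFin \o f).
Proof.
move=> cf; apply: continuous_compact_integrable; first exact: segment_compact.
exact: continuous_subspaceT.
Qed.

(** With one primitive for all subintervals, translation invariance and definiteness below reduce to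
    the mean value theorem, and no change of variables is needed. *)
Lemma antiderivative (f : R -> R) (N : R) : continuous f ->
  exists P : R -> R, (forall x : R, - N < x < N -> is_derive x 1 P (f x)) /\
    forall a b : R, - N < a -> a < b -> b < N ->
      \int[mu]_(s in `[a, b]%classic) f s = P b - P a.
Proof.
move=> cf.
pose P x := \int[mu]_(t in `[- N, x]%classic) f t.
have dP x : - N < x < N -> is_derive x 1 P (f x).
  move=> /andP[x1 x2].
  have fi : mu.-integrable `[- N, N]%classic (EFin \o f).
    apply: continuous_compact_integrable; first exact: segment_compact.
    exact: continuous_subspaceT.
  have [d1 d2] := continuous_FTC1_closed x2 fi x1 (cf x).
  by split => //; rewrite -derive1E.
exists P; split => // a b aN ab bN.
have inN x : a <= x <= b -> - N < x < N by move=> /andP[? ?]; apply/andP; split; lra.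
have cP x : a <= x <= b -> {for x, continuous P}.
  move=> /inN/dP [dx _]; apply: differentiable_continuous; exact/derivable1_diffP.
rewrite /Rintegral (@continuous_FTC2 _ f P)//.
- exact: continuous_subspaceT.
- split.
  + move=> x; rewrite in_itv/= => /andP[? ?].
    suff [dx _] : is_derive x 1 P (f x) by [].
    by apply: dP; apply: inN; rewrite !ltW.
  + by apply: cvg_at_right_filter; apply: cP; rewrite lexx ltW.
  + by apply: cvg_at_left_filter; apply: cP; rewrite lexx ltW.
- move=> x; rewrite in_itv/= => /andP[? ?].
  suff [_ <-] : is_derive x 1 P (f x) by rewrite derive1E.
  by apply: dP; apply: inN; rewrite !ltW.
Qed.

Lemma is_derive_comp_shift (f : R -> R) (x u df : R) :
  is_derive (x + u) 1 f df -> is_derive x 1 (fun y => f (y + u)) df.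
Proof.
move=> dfx; have := @is_derive1_comp R f (shift u) x df 1 dfx (is_derive_shift x 1 u).
by rewrite mulr1.
Qed.

(** With [P] and [Q] primitives of [f] and of its translate, [Q x - P (x + u)] is constant, and so
    is [P (y + 1) - P y] by periodicity. Comparing values at [0], [1] and at [0], [u] gives the
    claim. *)
Lemma int01_translation (f : R -> R) (u : R) : continuous f ->
  (forall x, f (x + 1) = f x) -> int01 (fun s => f (s + u)) = int01 f.
Proof.
(* Every point at which [P] is used has absolute value at most that of [u] plus [2], so it lies
   strictly inside the domain. *)
move=> cf pf; pose N := `|u| + 3.
have u1 := ler_norm u; have u2 := ler_norm (- u); rewrite normrN in u2.
have [P [dP iP]] := antiderivative N cf.
have u0 := normr_ge0 u.
have cu : continuous (fun s => f (s + u)).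
  move=> x; apply: (@continuous_comp _ _ _ (fun s => s + u)); last exact: cf.
  by apply: cvgD; [exact: cvg_id|exact: cvg_cst].
have [Q [dQ iQ]] := antiderivative 2 cu.
rewrite iP ?iQ /N; try lra.
have cst (h : R -> R) (a b : R) : a <= b ->
    (forall x, a <= x <= b -> is_derive x 1 h 0) -> h a = h b.
  move=> ab dh; have [||c _] := @MVT_segment _ h (fun=> 0) a b ab.
  - by move=> x; rewrite in_itv/= => /andP[? ?]; apply: dh; rewrite !ltW.
  - apply: derivable_within_continuous => x; rewrite in_itv/= => xab.
    by have [] := dh _ xab.
  by rewrite mul0r => /subr0_eq.
have E1 : Q 0 - P (0 + u) = Q 1 - P (1 + u).
  apply: (cst (fun x => Q x - P (x + u))) => // x /andP[x0 x1].
  have d1 : is_derive x 1 Q (f (x + u)) by apply: dQ; apply/andP; split; lra.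
  have d2 : is_derive (x + u) 1 P (f (x + u)).
    by apply: dP; apply/andP; rewrite /N; split; lra.
  have d3 : is_derive x 1 (fun y => P (y + u)) (f (x + u)).
    exact: is_derive_comp_shift.
  by apply: is_derive_eq (is_deriveB d1 d3) _; rewrite subrr.
have dPP x : - (`|u| + 1) <= x <= `|u| + 1 ->
    is_derive x 1 (fun y => P (y + 1) - P y) 0.
  move=> /andP[x0 x1].
  have d1 : is_derive x 1 P (f x) by apply: dP; rewrite /N; apply/andP; split; lra.
  have d2 : is_derive (x + 1) 1 P (f (x + 1)).
    by apply: dP; apply/andP; rewrite /N; split; lra.
  have d3 : is_derive x 1 (fun y => P (y + 1)) (f x).
    by rewrite -pf; exact: is_derive_comp_shift.
  by apply: is_derive_eq (is_deriveB d3 d1) _; rewrite subrr.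
have E2 : P (0 + 1) - P 0 = P (u + 1) - P u.
  have [u_ge|u_lt] := leP 0 u.
    apply: (cst (fun y => P (y + 1) - P y)) => // x /andP[? ?].
    by apply: dPP; apply/andP; split; lra.
  apply/esym; apply: (cst (fun y => P (y + 1) - P y)); first exact: ltW.
  by move=> x /andP[? ?]; apply: dPP; apply/andP; split; lra.
rewrite !add0r addrC in E1 E2; rewrite [u + 1]addrC in E2.
lra.
Qed.

(** The value at [0] is enough: [tint_eq0] reaches every other point by translation. A positive
    [f 0] would make the integral over a short initial segment positive. *)
Lemma int01_eq0 (f : R -> R) : continuous f -> (forall x, 0 <= f x) ->
  int01 f = 0 -> f 0 = 0.
Proof.
move=> cf f0 If; apply/eqP; rewrite eq_le f0 andbT leNgt; apply/negP => f0_gt.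
have [P [dP iP]] := antiderivative 2 cf.
have := If; rewrite iP; try lra; move=> {}If.
have /cvgrPdist_lt /(_ _ f0_gt) /nbhs_ballP [d /= d0 Hd] := cf 0.
pose e := Num.min (d / 2) 1.
have e0 : 0 < e by rewrite lt_min divr_gt0 //= ltr01.
have e1 : e <= 1 by rewrite ge_min lexx orbT.
have ed : e < d.
  by apply: (@le_lt_trans _ _ (d / 2)); rewrite ?ge_min ?lexx//; lra.
have D (x : R) : 0 <= x <= 1 -> is_derive x 1 P (f x).
  by move=> /andP[? ?]; apply: dP; apply/andP; split; lra.
have W (a b : R) : 0 <= a -> b <= 1 -> {within `[a, b]%classic, continuous P}.
  move=> a0 b1; apply: derivable_within_continuous => x; rewrite in_itv/= => /andP[? ?].
  suff [dx _] : is_derive x 1 P (f x) by [].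
  by apply: D; apply/andP; split; lra.
have [||c] := @MVT_segment _ P f 0 e (ltW e0).
- move=> x; rewrite in_itv/= => /andP[? ?]; apply: D; apply/andP; split; lra.
- exact: W.
rewrite in_itv/= => /andP[c0 ce] Ec.
have [||c' _ Ec'] := @MVT_segment _ P f e 1 e1.
- move=> x; rewrite in_itv/= => /andP[? ?]; apply: D; apply/andP; split; lra.
- by apply: W => //; exact: ltW.
have fc : 0 < f c.
  have : `|f 0 - f c| < f 0.
    apply: Hd; rewrite /ball/= sub0r normrN ger0_norm//; lra.
  by have := ler_norm (f 0 - f c); lra.
have : 0 < f c * (e - 0) by rewrite subr0 mulr_gt0.
have : 0 <= f c' * (1 - e) by rewrite mulr_ge0// subr_ge0.
lra.
Qed.

End UnitInterval.

(** * Iterated integrals over the cube *)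

Section CubeIntegral.
Context {R : realType}.
Local Open Scope classical_set_scope.
Local Open Scope ring_scope.
Implicit Types (F G : (nat -> R) -> R) (k : nat).

(** Since the coordinates from [k] on are not compared, a function in the class for [k] cannot
    depend on them. *)
Definition near_coord k (d : R) (t t' : nat -> R) : Prop :=
  forall i, (i < k)%N -> `|t i - t' i| < d.

Lemma near_coordS k d d' t t' : d <= d' -> near_coord k d t t' -> near_coord k d' t t'.
Proof. by move=> dd' H i ik; apply: lt_le_trans dd'; exact: H. Qed.

Local Notation upd k s t := (fun i : nat => if i == k then s else t i).

Lemma ucb_slice k F s : ucb (near_coord k.+1) F ->
  ucb (near_coord k) (fun t => F (upd k s t)).
Proof.
move=> [[M HM] uF]; split; first by exists M => t; exact: HM.
move=> e e0; have [d d0 Hd] := uF e e0; exists d => // t t' tt'.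
apply: Hd => i ik; case: eqP => [_|/eqP ik']; first by rewrite subrr normr0.
by apply: tt'; rewrite ltn_neqAle ik' -ltnS.
Qed.

Lemma cube_int_cst k (c : R) : cube_int k (fun=> c) = c.
Proof.
elim: k => // k IH /=; under eq_Rintegral do rewrite IH.
by rewrite Rintegral_cst//= lebesgue_measure_itv /= lte_fin ltr01 oppr0 adde0 mulr1.
Qed.

Lemma cube_int_ge0 k F : (forall t, 0 <= F t) -> 0 <= cube_int k F.
Proof.
by elim: k F => [|k IH] F F0 //=; apply: Rintegral_ge0 => s _; apply: IH.
Qed.

(** Linearity in dimension [k.+1] requires slice integrals to be continuous, hence integrable, and
    this continuity requires linearity in dimension [k]. So the bound and the continuity are stated
    relative to [linear_at k] and feed the induction in [cube_int_linear]. *)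
Let linear_at k := (forall F G, ucb (near_coord k) F -> ucb (near_coord k) G ->
    cube_int k (fun t => F t + G t) = cube_int k F + cube_int k G) /\
  (forall c F, ucb (near_coord k) F -> cube_int k (fun t => c * F t) = c * cube_int k F).

Let bound_at k (e : R) F : linear_at k -> ucb (near_coord k) F ->
  (forall t, `|F t| <= e) -> `|cube_int k F| <= e.
Proof.
move=> [addk scalek] uF Fe; rewrite ler_norml; apply/andP; split.
  rewrite -subr_ge0 opprK -[X in 0 <= _ + X](cube_int_cst k) -addk//; last exact: ucb_cst.
  by apply: cube_int_ge0 => t; move: (Fe t); rewrite ler_norml => /andP[? _]; lra.
have := scalek (-1) _ uF; rewrite mulN1r => E.
rewrite -subr_ge0 -[X in 0 <= X - _](cube_int_cst k) -E -addk; last 2 first.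
- exact: ucb_cst.
- exact: ucbZ.
by apply: cube_int_ge0 => t; move: (Fe t); rewrite ler_norml => /andP[_ ?]; lra.
Qed.

Let continuous_at k F : linear_at k -> ucb (near_coord k.+1) F ->
  continuous (fun s => cube_int k (fun t => F (upd k s t))).
Proof.
move=> lk uF s; apply/cvgrPdist_lt => e e0.
have [_ /(_ (e / 2))] := uF; rewrite divr_gt0// => /(_ isT) [d d0 Hd].
near=> s'.
have [addk scalek] := lk.
have := scalek (-1) _ (ucb_slice s' uF); rewrite !mulN1r => E.
rewrite -E -addk; [|exact: ucb_slice|by apply: ucbZ; exact: ucb_slice].
apply: (@le_lt_trans _ _ (e / 2)); last lra.
apply: bound_at => //.
  apply: ucbD; [exact: near_coordS|exact: ucb_slice|].
  by apply: ucbZ; exact: ucb_slice.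
move=> t; rewrite mulN1r; apply: ltW; apply: Hd => i ik; case: eqP => _.
  by near: s'; apply/nbhs_ballP; exists d.
by rewrite subrr normr0.
Unshelve. all: by end_near. Qed.

Let cube_int_linear k : linear_at k.
Proof.
elim: k => [|k [addk scalek]]; first by split.
have lk : linear_at k by [].
split=> [F G uF uG|c F uF] /=.
  under eq_Rintegral => s _ do rewrite (addk _ _ (ucb_slice s uF) (ucb_slice s uG)).
  by rewrite RintegralD//; apply: continuous_integrable01; exact: continuous_at.
under eq_Rintegral => s _ do rewrite (scalek _ _ (ucb_slice s uF)).
by rewrite RintegralZl//; apply: continuous_integrable01; exact: continuous_at.
Qed.

Lemma cube_intD k F G : ucb (near_coord k) F -> ucb (near_coord k) G ->
  cube_int k (fun t => F t + G t) = cube_int k F + cube_int k G.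
Proof. exact: (cube_int_linear k).1. Qed.

Lemma cube_intZ k c F : ucb (near_coord k) F ->
  cube_int k (fun t => c * F t) = c * cube_int k F.
Proof. exact: (cube_int_linear k).2. Qed.

Lemma cube_int_bound k (e : R) F : ucb (near_coord k) F ->
  (forall t, `|F t| <= e) -> `|cube_int k F| <= e.
Proof. exact: bound_at (cube_int_linear k). Qed.

Lemma cube_int_slice_continuous k F : ucb (near_coord k.+1) F ->
  continuous (fun s => cube_int k (fun t => F (upd k s t))).
Proof. exact: continuous_at (cube_int_linear k). Qed.

Lemma cube_int_translation k F (u : nat -> R) : ucb (near_coord k) F ->
  (forall t j, (j < k)%N -> F (fun i => t i + (i == j)%:R) = F t) ->
  cube_int k (fun t => F (fun i => t i + u i)) = cube_int k F.
Proof.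
elim: k F => [|k IH] F uF pF /=.
  (* In dimension [0] any two points are near at every scale, so [F] is constant. *)
  have [_ H] := uF; have F2 t t' : F t = F t'.
    apply/eqP; rewrite -subr_eq0 -normr_le0 leNgt; apply/negP => /H [d d0 Hd].
    have /Hd : near_coord 0 d t t' by [].
    by rewrite ltxx.
  exact: F2.
pose H s := cube_int k (fun t => F (upd k s t)).
have -> : (fun s => cube_int k (fun t => F (fun i => upd k s t i + u i))) =
          (fun s => H (s + u k)).
  apply/funext => s; rewrite /H -[RHS]IH; last 2 first.
  - exact: ucb_slice.
  - move=> t j jk; rewrite -[RHS](pF _ j); last exact: ltnW.
    congr F; apply/funext => i; case: eqP => // ->.
    by rewrite gtn_eqF// addr0.
  congr cube_int; apply/funext => t; congr F; apply/funext => i.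
  by case: eqP => [->|].
rewrite (@int01_translation _ H (u k)) //; first exact: cube_int_slice_continuous.
move=> x; rewrite /H; congr cube_int; apply/funext => t.
rewrite -[RHS](pF _ k)//; congr F; apply/funext => i.
by case: (i == k); rewrite /= ?mulr0n ?addr0.
Qed.

Lemma cube_int_eq0 k F : ucb (near_coord k) F -> (forall t, 0 <= F t) ->
  cube_int k F = 0 -> F (fun=> 0) = 0.
Proof.
elim: k F => [|k IH] F uF F0 //= IF0.
have := int01_eq0 (cube_int_slice_continuous uF) _ IF0.
move=> /(_ (fun s => cube_int_ge0 k (fun t => F0 _))) /(IH _ (ucb_slice 0 uF)) H.
by rewrite -[RHS]H//; congr F; apply/funext => i; case: eqP.
Qed.

End CubeIntegral.

(** * The torus integral *)

Section Trigonometry.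
Context {R : realType}.

Let lipschitz1 (f df : R -> R) : (forall x : R, is_derive x 1 f (df x)) ->
  (forall x, `|df x| <= 1) -> forall x y, `|f x - f y| <= `|x - y|.
Proof.
move=> dfE df1; have H (x y : R) : x <= y -> `|f x - f y| <= `|x - y|.
  move=> xy; rewrite distrC [X in _ <= X]distrC.
  have [|c _ ->] := @MVT_segment _ f df x y xy (fun z _ => dfE z).
    by apply: derivable_within_continuous => z _; have [] := dfE z.
  by rewrite normrM -[X in _ <= X]mul1r ler_wpM2r.
move=> x y; have [xy|/ltW yx] := leP x y; first exact: H.
by rewrite distrC [X in _ <= X]distrC; exact: H.
Qed.

Lemma sin_lipschitz (x y : R) : `|sin x - sin y| <= `|x - y|.
Proof. by apply: (@lipschitz1 _ cos) => z; exact: cos_max. Qed.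

Lemma cos_lipschitz (x y : R) : `|cos x - cos y| <= `|x - y|.
Proof.
by apply: (@lipschitz1 _ (fun z => - sin z)) => z; rewrite normrN; exact: sin_max.
Qed.

Let periodicz (f : R -> R) : periodic f (pi *+ 2) ->
  forall x (z : int), f (x + 2 * pi * z%:~R) = f x.
Proof.
move=> pf x [n|n].
  have -> : 2 * pi * (Posz n)%:~R = pi *+ 2 *+ n :> R.
    by rewrite -[n%:~R]pmulrn -(mulr_natl pi 2) -(mulr_natr (2 * pi) n).
  exact: periodicn.
rewrite -(periodicn pf n.+1); congr f.
have -> : pi *+ 2 *+ n.+1 = 2 * pi * n.+1%:R :> R.
  by rewrite -(mulr_natl pi 2) -(mulr_natr (2 * pi) n.+1).
by rewrite NegzE mulrNz -pmulrn mulrN addrNK.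
Qed.

Lemma sin_periodicz (x : R) (z : int) : sin (x + 2 * pi * z%:~R) = sin x.
Proof. exact: periodicz (@sinD2pi R) x z. Qed.

Lemma cos_periodicz (x : R) (z : int) : cos (x + 2 * pi * z%:~R) = cos x.
Proof. exact: periodicz (@cosD2pi R) x z. Qed.

End Trigonometry.

Section DotProduct.
Context {R : realType} {r : nat}.
Local Notation E := 'rV[R]_r.
Implicit Types u v w : E.

Lemma dotpE u v : dotp u v = \sum_j u 0 j * v 0 j.
Proof. by rewrite /dotp mxE; apply: eq_bigr => j _; rewrite mxE. Qed.

Lemma dotpC u v : dotp u v = dotp v u.
Proof. by rewrite !dotpE; apply: eq_bigr => j _; rewrite mulrC. Qed.

Lemma dotpDl u v w : dotp (u + v) w = dotp u w + dotp v w.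
Proof. by rewrite /dotp mulmxDl mxE. Qed.

Lemma dotpDr u v w : dotp u (v + w) = dotp u v + dotp u w.
Proof. by rewrite !(dotpC u) dotpDl. Qed.

Lemma dotpZl c u v : dotp (c *: u) v = c * dotp u v.
Proof. by rewrite /dotp -scalemxAl mxE. Qed.

Lemma dotpZr c u v : dotp u (c *: v) = c * dotp u v.
Proof. by rewrite !(dotpC u) dotpZl. Qed.

Lemma dotpNl u v : dotp (- u) v = - dotp u v.
Proof. by rewrite -scaleN1r dotpZl mulN1r. Qed.

Lemma dotpNr u v : dotp u (- v) = - dotp u v.
Proof. by rewrite !(dotpC u) dotpNl. Qed.

Lemma dotpBl u v w : dotp (u - v) w = dotp u w - dotp v w.
Proof. by rewrite dotpDl dotpNl. Qed.

Lemma dotpBr u v w : dotp u (v - w) = dotp u v - dotp u w.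
Proof. by rewrite dotpDr dotpNr. Qed.

Lemma dotp0l v : dotp 0 v = 0.
Proof. by rewrite -(scale0r 0) dotpZl mul0r. Qed.

Lemma dotp_suml (I : Type) (s : seq I) (P : pred I) (F : I -> E) v :
  dotp (\sum_(i <- s | P i) F i) v = \sum_(i <- s | P i) dotp (F i) v.
Proof. by elim/big_ind2: _ => [|? ? ? ? <- <-|//]; rewrite ?dotp0l ?dotpDl. Qed.

Lemma dotp_sumr (I : Type) (s : seq I) (P : pred I) (F : I -> E) v :
  dotp v (\sum_(i <- s | P i) F i) = \sum_(i <- s | P i) dotp v (F i).
Proof. by rewrite dotpC dotp_suml; apply: eq_bigr => i _; rewrite dotpC. Qed.

Lemma dotp_ge0 v : 0 <= dotp v v.
Proof. by rewrite dotpE sumr_ge0// => j _; rewrite -expr2 sqr_ge0. Qed.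

Lemma dotp_eq0 v : (dotp v v == 0) = (v == 0).
Proof.
apply/idP/eqP => [|->]; last by rewrite dotp0l.
rewrite dotpE psumr_eq0 => [/allP H|j _]; last by rewrite -expr2 sqr_ge0.
apply/rowP => j; rewrite mxE; apply/eqP.
by have := H j (mem_index_enum _); rewrite mulf_eq0 orbb.
Qed.

Lemma dotp_gt0 v : (0 < dotp v v) = (v != 0).
Proof. by rewrite lt_def dotp_ge0 andbT dotp_eq0. Qed.

Definition near_rv (d : R) u v : Prop := forall j, `|u 0 j - v 0 j| < d.

Lemma near_rvS d d' u v : d <= d' -> near_rv d u v -> near_rv d' u v.
Proof. by move=> dd' H j; apply: lt_le_trans dd'. Qed.

Let norm1 u : R := \sum_j `|u 0 j|.

Let norm1_ge0 u : 0 <= norm1 u.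
Proof. by apply: sumr_ge0. Qed.

Lemma ucb_comp_dotp (f : R -> R) a : (exists M, forall x, `|f x| <= M) ->
  (forall x y, `|f x - f y| <= `|x - y|) -> ucb near_rv (fun x => f (dotp a x)).
Proof.
move=> [M HM] Lf; split; first by exists M.
move=> e e0; have n1 : 0 < norm1 a + 1 by apply: ltr_wpDl.
exists (e / (norm1 a + 1)) => [|x y xy]; first exact: divr_gt0.
apply: le_lt_trans (Lf _ _) _; rewrite -dotpBr dotpE.
apply: le_lt_trans (ler_norm_sum _ _ _) _.
apply: (@le_lt_trans _ _ (norm1 a * (e / (norm1 a + 1)))).
  rewrite mulr_suml; apply: ler_sum => j _; rewrite normrM ler_wpM2l//.
  by apply: ltW; rewrite !mxE; exact: xy.
by rewrite mulrA mulrAC -[X in _ < X]mul1r ltr_pM2r// ltr_pdivrMr// mul1r ltrDl.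
Qed.

Lemma ucb_sin a : ucb near_rv (fun x => sin (dotp a x)).
Proof.
apply: ucb_comp_dotp; first by exists 1 => x; exact: sin_max.
exact: sin_lipschitz.
Qed.

Lemma ucb_cos a : ucb near_rv (fun x => cos (dotp a x)).
Proof.
apply: ucb_comp_dotp; first by exists 1 => x; exact: cos_max.
exact: cos_lipschitz.
Qed.

End DotProduct.

Section TorusIntegral.
Context {R : realType} {r : nat} (b : 'I_r -> 'rV[R]_r).
Local Notation E := 'rV[R]_r.
Hypothesis b_spans : forall v : E, exists u : nat -> R,
  v = (2 * pi) *: \sum_(i < r) u i *: b i.
Implicit Types F G : E -> R.

Let phi (t : nat -> R) : E := (2 * pi) *: \sum_(i < r) t i *: b i.

Let phiD s t : phi (fun i => s i + t i) = phi s + phi t.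
Proof.
rewrite /phi -scalerDr -big_split; congr (_ *: _).
by apply: eq_bigr => i _; rewrite scalerDl.
Qed.

Definition torus_class F : Prop :=
  ucb near_rv F /\ forall x i, F (x + (2 * pi) *: b i) = F x.

Definition tint F : R := cube_int r (fun t => F (phi t)).

Let ucb_phi F : torus_class F -> ucb (near_coord r) (fun t => F (phi t)).
Proof.
move=> [[[M HM] uF] _]; split; first by exists M.
move=> e e0; have [d d0 Hd] := uF e e0.
pose K := 2 * pi * \sum_i \sum_j `|b i 0 j| : R.
have K0 : 0 <= K.
  rewrite mulr_ge0 ?mulr_ge0 ?pi_ge0//; do 2 (apply: sumr_ge0 => ? _).
  exact: normr_ge0.
have K1 : 0 < K + 1 by lra.
exists (d / (K + 1)); first exact: divr_gt0.
move=> t t' tt'; apply: Hd => j.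
have -> : phi t 0 j - phi t' 0 j = 2 * pi * \sum_(i < r) (t i - t' i) * b i 0 j.
  rewrite /phi !mxE -mulrBr; congr (_ * _); rewrite !summxE -sumrB.
  by apply: eq_bigr => i _; rewrite !mxE mulrBl.
rewrite normrM ger0_norm ?mulr_ge0 ?pi_ge0//.
apply: (@le_lt_trans _ _ (K * (d / (K + 1)))); last first.
  by rewrite mulrA mulrAC -[X in _ < X]mul1r ltr_pM2r// ltr_pdivrMr// mul1r ltrDl.
rewrite {1}/K -!mulrA; do 2 (apply: ler_wpM2l; rewrite ?pi_ge0//).
apply: le_trans (ler_norm_sum _ _ _) _; rewrite mulr_suml; apply: ler_sum => i _.
rewrite normrM mulrC; apply: ler_pM => //; last by apply: ltW; exact: tt'.
by rewrite (bigD1 j)//= lerDl sumr_ge0.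
Qed.

Lemma torus_cst c : torus_class (fun=> c).
Proof. by split => //; exact: ucb_cst. Qed.

Lemma torusD F G : torus_class F -> torus_class G -> torus_class (fun x => F x + G x).
Proof.
move=> [uF pF] [uG pG]; split; last by move=> x i; rewrite pF pG.
by apply: ucbD => //; exact: near_rvS.
Qed.

Lemma torusM F G : torus_class F -> torus_class G -> torus_class (fun x => F x * G x).
Proof.
move=> [uF pF] [uG pG]; split; last by move=> x i; rewrite pF pG.
by apply: ucbM => //; exact: near_rvS.
Qed.

Lemma torusZ c F : torus_class F -> torus_class (fun x => c * F x).
Proof. exact: torusM (torus_cst c). Qed.

Lemma torusN F : torus_class F -> torus_class (fun x => - F x).
Proof. by move=> /(torusZ (-1)); under eq_fun do rewrite mulN1r. Qed.

Lemma torusB F G : torus_class F -> torus_class G -> torus_class (fun x => F x - G x).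
Proof. by move=> tF tG; apply: torusD => //; exact: torusN. Qed.

Lemma torus_comp (f : R -> R) F : continuous f -> torus_class F ->
  torus_class (fun x => f (F x)).
Proof.
by move=> cf [uF pF]; split; [exact: ucb_comp|move=> x i; rewrite pF].
Qed.

Lemma torus_sum (I : Type) (s : seq I) (P : pred I) (F : I -> E -> R) :
  (forall i, P i -> torus_class (F i)) ->
  torus_class (fun x => \sum_(i <- s | P i) F i x).
Proof.
move=> tF; split.
  by apply: ucb_sum => [? ? ? ?|i /tF[]//]; exact: near_rvS.
by move=> x i; apply: eq_bigr => j /tF[_ ->].
Qed.

Lemma torus_prod (I : Type) (s : seq I) (P : pred I) (F : I -> E -> R) :
  (forall i, P i -> torus_class (F i)) ->
  torus_class (fun x => \prod_(i <- s | P i) F i x).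
Proof.
move=> tF; split.
  by apply: ucb_prod => [? ? ? ?|i /tF[]//]; exact: near_rvS.
by move=> x i; apply: eq_bigr => j /tF[_ ->].
Qed.

Lemma torus_shift F v : torus_class F -> torus_class (fun x => F (x + v)).
Proof.
move=> [[[M HM] uF] pF]; split; last by move=> x i; rewrite addrAC pF.
split; first by exists M.
move=> e /uF [d d0 Hd]; exists d => // x y xy; apply: Hd => j.
have -> : (x + v) 0 j - (y + v) 0 j = x 0 j - y 0 j by rewrite !mxE; ring.
exact: xy.
Qed.

Lemma tintD F G : torus_class F -> torus_class G ->
  tint (fun x => F x + G x) = tint F + tint G.
Proof. by move=> tF tG; rewrite /tint cube_intD//; exact: ucb_phi. Qed.

Lemma tintZ c F : torus_class F -> tint (fun x => c * F x) = c * tint F.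
Proof. by move=> tF; rewrite /tint cube_intZ//; exact: ucb_phi. Qed.

Lemma tintN F : torus_class F -> tint (fun x => - F x) = - tint F.
Proof.
by move=> tF; rewrite -mulN1r -tintZ//; congr tint; apply/funext => x; rewrite mulN1r.
Qed.

Lemma tintB F G : torus_class F -> torus_class G ->
  tint (fun x => F x - G x) = tint F - tint G.
Proof. by move=> tF tG; rewrite tintD ?tintN//; exact: torusN. Qed.

Lemma tint_bound (e : R) F : torus_class F -> (forall x, `|F x| <= e) -> `|tint F| <= e.
Proof. by move=> tF Fe; apply: cube_int_bound; first exact: ucb_phi. Qed.

(** In the coordinates of the basis, a translation of [E] is a translation of the cube variables,
    and periodicity under [2 pi b_j] becomes period [1] in each variable. *)
Lemma tint_shift F v : torus_class F -> tint (fun x => F (x + v)) = tint F.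
Proof.
move=> tF; have [u ->] := b_spans v; rewrite -/(phi u).
rewrite /tint -[RHS](@cube_int_translation _ _ _ u); last 2 first.
- exact: ucb_phi.
- move=> t j jr; rewrite phiD; have [_ pF] := tF.
  rewrite -[RHS](pF _ (Ordinal jr)); congr (F (_ + _)); rewrite /phi; congr (_ *: _).
  rewrite (bigD1 (Ordinal jr))//= eqxx scale1r big1 ?addr0// => i ij.
  by rewrite (_ : (i == j :> nat) = false) ?scale0r//; apply: negbTE.
by congr cube_int; apply/funext => t; rewrite phiD.
Qed.

Lemma tint_eq0 F : torus_class F -> (forall x, 0 <= F x) -> tint F = 0 ->
  forall x, F x = 0.
Proof.
move=> tF F0 IF x; have tFx := torus_shift x tF.
have : F (phi (fun=> 0) + x) = 0.
  apply: (@cube_int_eq0 _ r (fun t => F (phi t + x))) => //.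
    exact: (ucb_phi tFx).
  by rewrite -IF -[RHS](tint_shift x).
by rewrite /phi big1 ?scaler0 ?add0r// => i _; rewrite scale0r.
Qed.

(* Difference quotients have integral [0] by translation invariance and converge
   uniformly; the order of the iterated integrals never has to be exchanged. *)
Lemma tint_derivative (xi : E) G G' : torus_class G -> torus_class G' ->
  (forall x, is_derive (0 : R) 1 (fun s : R => G (x + s *: xi)) (G' x)) -> tint G' = 0.
Proof.
move=> tG tG' dG; apply/eqP; rewrite -normr_le0; apply/ler_addgt0Pr => e e0.
rewrite add0r; have [[_ /(_ e e0) [d d0 Hd]] _] := tG'.
have dGs x (s : R) : is_derive s 1 (fun s : R => G (x + s *: xi)) (G' (x + s *: xi)).
  have := dG (x + s *: xi).
  rewrite -{1}(subrr s) => /is_derive_comp_shift.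
  congr is_derive; apply/funext => u; congr G.
  by rewrite scalerBl -addrA [s *: xi + _]addrC subrK.
pose K := \sum_j `|xi 0 j|.
have K0 : 0 <= K by apply: sumr_ge0.
have K1 : 0 < K + 1 by lra.
pose s := d / (K + 1).
have s0 : 0 < s by exact: divr_gt0.
have -> : tint G' = tint (fun x => G' x - s^-1 * (G (x + s *: xi) - G x)).
  rewrite tintB ?tintZ ?tintB ?tint_shift ?subrr ?mulr0 ?subr0//.
  - exact: torus_shift.
  - by apply: torusB => //; exact: torus_shift.
  - by apply: torusZ; apply: torusB => //; exact: torus_shift.
apply: tint_bound.
  by apply: torusB => //; apply: torusZ; apply: torusB => //; exact: torus_shift.
move=> x; have [|c cs] := @MVT_segment _ (fun s : R => G (x + s *: xi))
    (fun s => G' (x + s *: xi)) 0 s (ltW s0) (fun z _ => dGs x z).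
  by apply: derivable_within_continuous => z _; have [] := dGs x z.
rewrite scale0r addr0 subr0 => ->.
rewrite mulrCA mulVf ?mulr1 ?gt_eqF//; apply: ltW; apply: Hd => j.
move: cs; rewrite in_itv/= => /andP[c0 cs].
rewrite !mxE opprD addrA subrr add0r normrN normrM ger0_norm//.
apply: (@le_lt_trans _ _ (s * K)).
  by rewrite ler_pM// /K (bigD1 j)//= lerDl sumr_ge0.
by rewrite mulrC mulrA mulrAC -[X in _ < X]mul1r ltr_pM2r// ltr_pdivrMr// mul1r ltrDl.
Qed.

End TorusIntegral.

(** * Reflections and Weyl group *)

Section Reflections.
Context {R : realType} {r : nat}.
Local Notation E := 'rV[R]_r.
Implicit Types a u v x y : E.

Lemma mulmx_refl a x : x *m refl a = x - dotp x (coroot a) *: a.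
Proof.
rewrite /refl mulmxBr mulmx1 mulmxA; congr (_ - _).
by rewrite [x *m _]mx11_scalar mul_scalar_mx.
Qed.

Lemma dotp_coroot x a : dotp x (coroot a) = 2 / dotp a a * dotp x a.
Proof. by rewrite /coroot dotpZr. Qed.

Lemma dotp_corootK x a : a != 0 -> dotp x a = dotp x (coroot a) * dotp a a / 2.
Proof. by rewrite -dotp_eq0 => a0; rewrite dotp_coroot; field. Qed.

Lemma dotp_coroot_id a : a != 0 -> dotp a (coroot a) = 2.
Proof. by rewrite -dotp_eq0 => a0; rewrite dotp_coroot; field. Qed.

Lemma dotp_coroot_ge0 x a : (0 <= dotp x a) -> 0 <= dotp x (coroot a).
Proof. by move=> xa; rewrite dotp_coroot mulr_ge0// divr_ge0// dotp_ge0. Qed.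

Lemma dotp_coroot_sg x a : a != 0 -> (dotp x (coroot a) < 0) = (dotp x a < 0).
Proof.
by rewrite -dotp_gt0 => a0; rewrite dotp_coroot pmulr_rlt0// divr_gt0.
Qed.

Lemma dotp_coroot_gt0 x a : a != 0 -> (0 < dotp x (coroot a)) = (0 < dotp x a).
Proof.
by rewrite -dotp_gt0 => a0; rewrite dotp_coroot pmulr_rgt0// divr_gt0.
Qed.

Lemma corootN a : coroot (- a) = - coroot a.
Proof. by rewrite /coroot dotpNl dotpNr opprK scalerN. Qed.

Lemma refl_tr a : (refl a)^T = refl a.
Proof.
rewrite /refl linearB /= trmx1 trmx_mul trmxK /coroot; congr (_ - _).
by rewrite [(_ *: a)^T]linearZ /= -scalemxAl -scalemxAr.
Qed.

Lemma reflN a : a != 0 -> a *m refl a = - a.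
Proof.
move=> a0; rewrite mulmx_refl dotp_coroot_id//.
by rewrite -[X in X - _]scale1r -scalerBl -[RHS]scaleN1r; congr (_ *: _); ring.
Qed.

Lemma reflK a : a != 0 -> refl a *m refl a = 1%:M.
Proof.
move=> a0; apply/row_matrixP => i; rewrite !rowE mulmxA mulmx1.
rewrite mulmx_refl [X in X - _]mulmx_refl mulmx_refl dotpBl dotpZl dotp_coroot_id//.
set c := dotp _ _; rewrite -addrA -opprD -scalerDl.
by rewrite (_ : c + (c - c * 2) = 0) ?scale0r ?subr0//; ring.
Qed.

(** As the root system may be non-reduced, this is what identifies the reflections of proportional
    roots, opposite ones included. *)
Lemma refl_scale c a : c != 0 -> refl (c *: a) = refl a.
Proof.
move=> c0; rewrite /refl; congr (_ - _).
have T k (v : E) : (k *: v)^T = k *: v^T by apply/matrixP => i j; rewrite !mxE.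
rewrite /coroot dotpZl dotpZr scalerA !T.
rewrite -!scalemxAl -scalemxAr !scalerA; congr (_ *: _).
have [->|a0] := eqVneq (dotp a a) 0; first by rewrite !mulr0 invr0 !mulr0 ?mul0r.
by field; rewrite a0 c0.
Qed.

Lemma dotp_mx (w : 'M[R]_r) x y : dotp (x *m w) y = dotp x (y *m w^T).
Proof. by rewrite /dotp trmx_mul trmxK mulmxA. Qed.

End Reflections.

Section RootSystem.
Context {R : realType} {r : nat} (rs : seq 'rV[R]_r) (h : 'rV[R]_r).
Local Notation E := 'rV[R]_r.
Implicit Types a x y : E.
Hypothesis rsP : root_system rs.
Hypothesis regh : regular rs h.
Local Notation pos := (posroots rs h).
Local Notation W := (weyl rs).
Local Notation orbit := Defs.orbit.

Lemma root_neq0 a : a \in rs -> a != 0.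
Proof. by case: rsP => _ /negP H _ _ _ ars; apply/negP => /eqP a0; apply: H; rewrite -a0. Qed.

Lemma root_refl a x : a \in rs -> x \in rs -> x *m refl a \in rs.
Proof. by case: rsP => _ _ _ H _; exact: H. Qed.

Lemma rootN a : a \in rs -> - a \in rs.
Proof. by move=> ars; rewrite -reflN ?root_neq0// root_refl. Qed.

Lemma mem_pos a : (a \in pos) = (0 < dotp a h) && (a \in rs).
Proof. by rewrite mem_filter. Qed.

Lemma pos_root a : a \in pos -> a \in rs.
Proof. by rewrite mem_pos => /andP[]. Qed.

Lemma pos_gt0 a : a \in pos -> 0 < dotp a h.
Proof. by rewrite mem_pos => /andP[]. Qed.

Lemma pos_uniq : uniq pos.
Proof. by case: rsP => H _ _ _ _; rewrite filter_uniq. Qed.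

Lemma pos_or_neg a : a \in rs -> (a \in pos) || (- a \in pos).
Proof.
move=> ars; rewrite !mem_pos ars rootN// !andbT dotpNl oppr_gt0 orbC.
by rewrite -neq_lt regh.
Qed.

Definition reflprod (s : seq E) : 'M[R]_r := foldr (fun a m => refl a *m m) 1%:M s.

Lemma reflprod_cat s t : reflprod (s ++ t) = reflprod s *m reflprod t.
Proof. by elim: s => [|a s IH] /=; rewrite ?mul1mx// IH mulmxA. Qed.

Lemma reflprod1 a : reflprod [:: a] = refl a.
Proof. by rewrite /= mulmx1. Qed.

Lemma reflprod_tr s : (reflprod s)^T = reflprod (rev s).
Proof.
elim: s => [|a s IH]; first by rewrite trmx1.
by rewrite rev_cons -cats1 reflprod_cat reflprod1 /= trmx_mul IH refl_tr.
Qed.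

Lemma weyl_reflprod s : all (mem rs) s -> W (reflprod s).
Proof. by move=> srs; exists s. Qed.

Lemma weyl1 : W 1%:M.
Proof. by exists [::]. Qed.

Lemma weyl_refl a : a \in rs -> W (refl a).
Proof. by move=> ars; exists [:: a]; rewrite /= ars mulmx1. Qed.

Lemma weylM u v : W u -> W v -> W (u *m v).
Proof.
move=> [s [srs ->]] [t [trs ->]]; exists (s ++ t); split; first by rewrite all_cat srs.
exact/esym/reflprod_cat.
Qed.

Lemma weylT w : W w -> W w^T.
Proof.
move=> [s [srs ->]]; exists (rev s); split; first by rewrite all_rev.
exact: reflprod_tr.
Qed.

Lemma reflprodK s : all (mem rs) s -> reflprod s *m reflprod (rev s) = 1%:M.
Proof.
elim: s => [_|a s IH /= /andP[ars /IH sK]]; first by rewrite mul1mx.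
rewrite rev_cons -cats1 reflprod_cat reflprod1 -mulmxA (mulmxA _ _ (refl a)) sK.
by rewrite mul1mx reflK// root_neq0.
Qed.

Lemma weylK w : W w -> w *m w^T = 1%:M.
Proof. by move=> [s [srs ->]]; rewrite -/(reflprod s) reflprod_tr reflprodK. Qed.

Lemma weylVK w : W w -> w^T *m w = 1%:M.
Proof. by move=> /weylT/weylK; rewrite trmxK. Qed.

Lemma dotp_weyl w x y : W w -> dotp (x *m w) (y *m w) = dotp x y.
Proof. by move=> Ww; rewrite dotp_mx -mulmxA weylK// mulmx1. Qed.

Lemma coroot_weyl w a : W w -> coroot (a *m w) = coroot a *m w.
Proof. by move=> Ww; rewrite /coroot dotp_weyl// scalemxAl. Qed.

Lemma root_weyl w a : W w -> a \in rs -> a *m w \in rs.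
Proof.
move=> [s [srs ->]]; rewrite -/(reflprod s); elim: s a srs => [|b s IH] a /=.
  by rewrite mulmx1.
by move=> /andP[brs srs] ars; rewrite mulmxA IH// root_refl.
Qed.

Lemma refl_weyl w a : W w -> refl (a *m w) = w^T *m refl a *m w.
Proof.
move=> Ww; rewrite /refl coroot_weyl// mulmxBr mulmxBl mulmx1 weylVK//.
by rewrite trmx_mul !mulmxA.
Qed.

Lemma weyl_inj (w w' : 'M[R]_r) : (forall a, a \in rs -> a *m w = a *m w') -> w = w'.
Proof.
move=> H; apply/row_matrixP => i; rewrite !rowE.
have : delta_mx 0 i \in <<rs>>%VS by case: rsP => _ _ -> _ _; rewrite memvf.
move=> /(@coord_span _ _ _ (in_tuple rs)) ->.
rewrite !mulmx_suml; apply: eq_bigr => j _; rewrite -!scalemxAl; congr (_ *: _).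
by apply: H; rewrite mem_nth.
Qed.

(** The roots span, so an element is determined by the self-map of root indices that it induces. [G]
    chooses one group element for each self-map, hence covers the group. *)
Lemma weyl_finite : finite_set W.
Proof.
pose n := size rs.
pose good (f : {ffun 'I_n -> 'I_n}) (w : 'M[R]_r) :=
  W w /\ forall i : 'I_n, nth 0 rs i *m w = nth 0 rs (f i).
pose G (f : {ffun 'I_n -> 'I_n}) : 'M[R]_r := xget 1%:M [set w | good f w]%classic.
apply: (@sub_finite_set _ _ (G @` setT)%classic); last exact: finite_image.
move=> w Ww.
have ilt (i : 'I_n) : (seq.index (rs`_i *m w)%R rs < n)%N.
  by rewrite index_mem root_weyl// mem_nth.
exists [ffun i => Ordinal (ilt i)] => //; rewrite /G.
have gw : good [ffun i => Ordinal (ilt i)] w.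
  by split=> // i; rewrite ffunE /= nth_index// root_weyl// mem_nth.
case: xgetP => [w' _ [Ww' gw']|/(_ w)//].
apply: weyl_inj => a ars; have ai : (seq.index a rs < n)%N by rewrite index_mem.
by have := gw' (Ordinal ai); have := gw.2 (Ordinal ai); rewrite /= nth_index// => -> ->.
Qed.

Definition wseq : seq 'M[R]_r := fset_set W.

Lemma mem_wseq w : w \in wseq <-> W w.
Proof.
by rewrite /wseq in_fset_set; [split; [exact: set_mem|exact: mem_set]|exact: weyl_finite].
Qed.

Lemma wseq_uniq : uniq wseq.
Proof. exact: fset_uniq. Qed.

Lemma perm_wseq_mull u : W u -> perm_eq wseq [seq u *m w | w <- wseq].
Proof.
move=> Wu; apply: uniq_perm; first exact: wseq_uniq.
  rewrite map_inj_uniq ?wseq_uniq// => v w /(congr1 (mulmx u^T)).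
  by rewrite !mulmxA weylVK// !mul1mx.
move=> w; apply/idP/mapP => [/mem_wseq Ww|[v /mem_wseq Wv ->]].
  exists (u^T *m w); last by rewrite mulmxA weylK// mul1mx.
  by apply/mem_wseq/weylM => //; exact: weylT.
exact/mem_wseq/weylM.
Qed.

Lemma perm_root_weyl w : W w -> perm_eq rs [seq a *m w | a <- rs].
Proof.
have [rsu _ _ _ _] := rsP.
move=> Ww; apply: uniq_perm => //.
  rewrite map_inj_uniq// => v u /(congr1 (fun m => m *m w^T)).
  by rewrite -!mulmxA weylK// !mulmx1.
move=> a; apply/idP/mapP => [ars|[b brs ->]]; last exact: root_weyl.
exists (a *m w^T); last by rewrite -mulmxA weylVK// mulmx1.
by apply: root_weyl => //; exact: weylT.
Qed.

Section OrbitStabilizer.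
Variable mu : E.

Lemma orbit_finite : finite_set (orbit rs mu).
Proof. exact/finite_image/weyl_finite. Qed.

Definition oseq : seq E := fset_set (orbit rs mu).

Lemma mem_oseq x : x \in oseq <-> orbit rs mu x.
Proof.
by rewrite /oseq in_fset_set; [split; [exact: set_mem|exact: mem_set]|exact: orbit_finite].
Qed.

Lemma mem_oseqP x : reflect (exists2 w, W w & x = mu *m w) (x \in oseq).
Proof.
apply: (iffP idP) => [/mem_oseq[w Ww <-]|[w Ww ->]]; first by exists w.
by apply/mem_oseq; exists w.
Qed.

Lemma oseq_uniq : uniq oseq.
Proof. exact: fset_uniq. Qed.

Let sseq : seq 'M[R]_r := fset_set (stab rs mu).

Let mem_sseq w : w \in sseq <-> W w /\ mu *m w = mu.
Proof.
rewrite /sseq in_fset_set; first by split; [exact: set_mem|exact: mem_set].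
by apply: (sub_finite_set _ weyl_finite) => v [].
Qed.

(** The elements sending [mu] to [mu *m w0] form the coset of the stabilizer through [w0],
    parametrised by right multiplication with [w0]. *)
Let size_fiber x : x \in oseq ->
  count (fun w => mu *m w == x) wseq = card_stab rs mu.
Proof.
move=> /mem_oseqP[w0 W0 ->]; rewrite -size_filter /card_stab.
have -> : #|` fset_set (stab rs mu)|%fset = size sseq by [].
rewrite -(size_map (fun w => w *m w0) sseq); apply: perm_size; apply: uniq_perm.
- by rewrite filter_uniq ?wseq_uniq.
- rewrite map_inj_uniq ?fset_uniq// => v w /(congr1 (fun m => m *m w0^T)).
  by rewrite -!mulmxA weylK// !mulmx1.
move=> w; rewrite mem_filter; apply/andP/mapP => [[/eqP muw /mem_wseq Ww]|[v]].
  exists (w *m w0^T); last by rewrite -mulmxA weylVK// mulmx1.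
  apply/mem_sseq; split; first by apply: weylM => //; exact: weylT.
  by rewrite mulmxA muw -mulmxA weylK// mulmx1.
move=> /mem_sseq[Wv muv] ->; split; first by rewrite mulmxA muv.
exact/mem_wseq/weylM.
Qed.

Lemma sum_orbit (V : zmodType) (F : E -> V) :
  \sum_(w <- wseq) F (mu *m w) = (\sum_(x <- oseq) F x) *+ card_stab rs mu.
Proof.
have H w : w \in wseq -> F (mu *m w) = \sum_(x <- oseq | mu *m w == x) F x.
  move=> /mem_wseq Ww; rewrite (eq_bigl (pred1 (mu *m w))) => [|x]; last exact: eq_sym.
  rewrite (big_rem (mu *m w)) /=; last by apply/mem_oseqP; exists w.
  rewrite eqxx big_seq_cond big1 ?addr0// => x /andP[].
  by rewrite mem_rem_uniq ?oseq_uniq// inE => /andP[/negbTE /= ->].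
rewrite big_seq (eq_bigr _ H) -big_seq.
rewrite (exchange_big_dep predT)//= -sumrMnl big_seq [RHS]big_seq.
apply: eq_bigr => x xo; rewrite -(size_fiber xo) big_const_seq.
by elim: (count _ _) => //= n ->; rewrite mulrS.
Qed.

Lemma card_stab_gt0 : (0 < card_stab rs mu)%N.
Proof.
rewrite /card_stab cardfs_gt0; apply/fset0Pn; exists 1%:M.
by apply/mem_sseq; split; [exact: weyl1|rewrite mulmx1].
Qed.

End OrbitStabilizer.

End RootSystem.

(** * Simple roots and dominance *)

Section Cone.
Context {R : realType} {r : nat}.
Local Notation E := 'rV[R]_r.
Implicit Types (S : seq E) (v : E).

Definition cone S v : Prop :=
  exists2 k : E -> R, (forall a, 0 <= k a) & v = \sum_(a <- S) k a *: a.

Lemma cone0 S : cone S 0.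
Proof. by exists (fun=> 0) => //; rewrite big1// => a _; rewrite scale0r. Qed.

Lemma coneD S u v : cone S u -> cone S v -> cone S (u + v).
Proof.
move=> [k k0 ->] [l l0 ->]; exists (fun a => k a + l a) => [a|]; first exact: addr_ge0.
by rewrite -big_split; apply: eq_bigr => a _; rewrite scalerDl.
Qed.

Lemma coneZ S c v : 0 <= c -> cone S v -> cone S (c *: v).
Proof.
move=> c0 [k k0 ->]; exists (fun a => c * k a) => [a|]; first exact: mulr_ge0.
by rewrite scaler_sumr; apply: eq_bigr => a _; rewrite scalerA.
Qed.

Lemma cone_mem S a : uniq S -> a \in S -> cone S a.
Proof.
move=> Su aS; exists (fun b => (b == a)%:R) => [b|]; first by rewrite ler0n.
rewrite (bigD1_seq a)//= eqxx scale1r big1 ?addr0// => b /negbTE ->.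
by rewrite scale0r.
Qed.

Lemma cone_trans S S' v : (forall a, a \in S -> cone S' a) -> cone S v -> cone S' v.
Proof.
move=> SS' [k k0 ->]; rewrite big_seq; elim/big_ind: _ => [|u w|a aS].
- exact: cone0.
- exact: coneD.
- by apply: coneZ => //; exact: SS'.
Qed.

End Cone.

(** * Simple reflections, the exchange condition and dominant representatives *)

Section SimpleRoots.
Context {R : realType} {r : nat} (rs : seq 'rV[R]_r) (h : 'rV[R]_r).
Local Notation E := 'rV[R]_r.
Implicit Types a x y mu nu lam : E.
Hypothesis rsP : root_system rs.
Hypothesis regh : regular rs h.
Local Notation pos := (posroots rs h).
Local Notation W := (weyl rs).
Local Notation orbit := Defs.orbit.

(* A minimal generating set of the cone of positive roots; for [s] in it, the
   reflection [refl s] permutes the positive roots not proportional to [s]. *)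
Definition simple_system (S : seq E) : Prop :=
  [/\ uniq S, {subset S <= pos}, (forall a, a \in pos -> cone S a) &
   forall s a, s \in S -> a \in pos -> (forall c, a <> c *: s) -> a *m refl s \in pos].

(** Each element of [S] has positive height [dotp _ h], so a combination with nonnegative
    coefficients cannot cancel. *)
Lemma cone_height (S : seq E) (k : E -> R) : {subset S <= pos} -> (forall a, 0 <= k a) ->
  dotp (\sum_(a <- S) k a *: a) h <= 0 -> forall a, a \in S -> k a = 0.
Proof.
move=> Spos k0; rewrite dotp_suml big_seq => le0.
have ge0 a : a \in S -> 0 <= dotp (k a *: a) h.
  by move=> aS; rewrite dotpZl mulr_ge0// ltW// (pos_gt0 (Spos a aS)).
have := psumr_eq0 S ge0; rewrite eq_le le0 sumr_ge0// => /esym/allP H a aS.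
have := H a aS; rewrite aS dotpZl mulf_eq0 => /orP[/eqP//|].
by rewrite gt_eqF// (pos_gt0 (Spos a aS)).
Qed.

(** Take a generating set of least size. If [a] and [- (a *m refl s)] are both positive, expanding
    both and adding expresses [m *: s] as a nonnegative combination of [S]. Moving the [s] terms to
    the left leaves [c *: s] in the cone of the other elements: [c > 0] contradicts minimality, and
    [c <= 0] forces the other coefficients to vanish by height, so [a] is proportional to [s]. *)
Lemma exists_simple_system : exists S, simple_system S.
Proof.
pose gen (S : seq E) := [/\ uniq S, {subset S <= pos} & forall a, a \in pos -> cone S a].
have exn : exists n, `[< exists2 S, gen S & size S = n >].
  exists (size pos); apply/asboolP; exists pos => //.
  have pu := pos_uniq h rsP.
  by split => // a; exact: cone_mem.
have [n /asboolP[S [Su Spos Sgen] Sn] nmin] := ex_minnP exn.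
exists S; split => // s a sS ap nprop.
have aS : a *m refl s \in rs by apply: root_refl => //; [exact: (pos_root (Spos _ sS))|exact: (pos_root ap)].
have := pos_or_neg rsP regh aS => /orP[//|nap]; exfalso.
have [k k0 ka] := Sgen _ ap; have [l l0 la] := Sgen _ nap.
pose m := dotp a (coroot s).
pose S' := rem s S.
have SE (f : E -> E) : \sum_(b <- S) f b = f s + \sum_(b <- S') f b by exact: big_rem.
have S'S : {subset S' <= S} by exact: mem_rem.
have S'pos : {subset S' <= pos} by move=> b /S'S/Spos.
pose c := m - k s - l s.
have cs : c *: s = \sum_(b <- S') (k b + l b) *: b.
  have -> : \sum_(b <- S') (k b + l b) *: b =
      \sum_(b <- S') k b *: b + \sum_(b <- S') l b *: b.
    by rewrite -big_split; apply: eq_bigr => b _; rewrite scalerDl.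
  have E1 : \sum_(b <- S') k b *: b = a - k s *: s by rewrite ka SE addrC addKr.
  have E2 : \sum_(b <- S') l b *: b = - (a *m refl s) - l s *: s.
    by rewrite la SE addrC addKr.
  rewrite E1 E2 mulmx_refl -/m /c !scalerBl opprB.
  by apply/rowP => i; rewrite !mxE; ring.
have kl0 b : 0 <= k b + l b by rewrite addr_ge0.
have [c_gt0|c_le0] := ltP 0 c.
  have S's : cone S' s.
    rewrite -[s]scale1r -(mulVf (lt0r_neq0 c_gt0)) -scalerA; apply: coneZ.
      by rewrite invr_ge0 ltW.
    by exists (fun b => k b + l b).
  suff : (n <= size S')%N.
    by rewrite size_rem// Sn; case: (n) (Sn) => [|n' _]; [case: (S) sS|rewrite ltnn].
  apply: nmin; apply/asboolP; exists S' => //; split => //; first exact: rem_uniq.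
  move=> b /Sgen; apply: cone_trans => d dS.
  have [->//|ds] := eqVneq d s; apply: cone_mem; first exact: rem_uniq.
  by rewrite mem_rem_uniq// inE ds.
have : dotp (\sum_(b <- S') (k b + l b) *: b) h <= 0.
  rewrite -cs dotpZl mulr_le0_ge0// ltW//; exact/pos_gt0/Spos.
move=> /(cone_height S'pos kl0) H; apply: (nprop (k s)); rewrite ka SE.
rewrite big_seq big1 ?addr0// => b bS'; have := H b bS' => /eqP.
by rewrite paddr_eq0// => /andP[/eqP -> _]; rewrite scale0r.
Qed.

Variable S : seq E.
Hypothesis simpleS : simple_system S.

Lemma simple_pos s : s \in S -> s \in pos.
Proof. by case: simpleS => _ H _ _ => /H. Qed.

Lemma simple_root s : s \in S -> s \in rs.
Proof. by move=> /simple_pos/pos_root. Qed.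

(** Some simple [s] has positive product with [a], because [dotp a a > 0]. Reflecting in [s] lowers
    the height and conjugates [refl a]. Heights are real, so the induction is on the number of
    positive roots of smaller height. *)
Lemma refl_simple a : a \in pos ->
  exists2 t, all (mem S) t & refl a = reflprod t.
Proof.
have [Su Spos Sgen Srefl] := simpleS.
have [n] := ubnP (count (fun b => dotp b h < dotp a h) pos).
elim: n a => // n IH a an ap.
have [[s sS [c ac]]|nprop] :=
    pselect (exists2 s, s \in S & exists c, a = c *: s).
  exists [:: s] => /=; first by rewrite sS.
  have a0 := root_neq0 rsP (pos_root ap).
  by rewrite mulmx1 ac refl_scale//; apply: contraNneq a0 => c0; rewrite ac c0 scale0r.
have [s sS sa] : exists2 s, s \in S & 0 < dotp a s.
  apply/not_exists2P => H.
  have a0 := root_neq0 rsP (pos_root ap).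
  have [k k0 ka] := Sgen _ ap; move: a0; rewrite -dotp_gt0 {2}ka dotp_sumr.
  apply/negP; rewrite -leNgt big_seq sumr_le0// => s sS; rewrite dotpZr.
  rewrite mulr_ge0_le0// leNgt; apply/negP => sa.
  by have [|] := H s.
have srs := simple_root sS; have s0 := root_neq0 rsP srs.
have rp : a *m refl s \in pos.
  by apply: Srefl => // c ac; apply: nprop; exists s => //; exists c.
have hlt : dotp (a *m refl s) h < dotp a h.
  rewrite mulmx_refl dotpBl dotpZl gtrBl mulr_gt0 ?dotp_coroot_gt0//.
  exact/pos_gt0/Spos.
have [|//|t tS tE] := IH (a *m refl s).
  rewrite -ltnS; apply: leq_ltn_trans an; rewrite -!size_filter.
  apply: (@leq_ltn_trans (size (rem (a *m refl s) [seq b <- pos | dotp b h < dotp a h]))).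
    apply: uniq_leq_size; first by rewrite filter_uniq// (pos_uniq h rsP).
    move=> b bF; have bp : b \in pos by move: bF; rewrite mem_filter => /andP[].
    have bh : dotp b h < dotp (a *m refl s) h by move: bF; rewrite mem_filter => /andP[].
    have fu : uniq [seq c <- pos | dotp c h < dotp a h].
      by rewrite filter_uniq// (pos_uniq h rsP).
    rewrite (rem_filter _ fu) mem_filter mem_filter (lt_trans bh hlt) bp !andbT /=.
    by apply: contraTneq bh => ->; rewrite ltxx.
  have mem : a *m refl s \in [seq b <- pos | dotp b h < dotp a h] by rewrite mem_filter hlt.
  rewrite size_rem// ltn_predL.
  by case: [seq b <- pos | dotp b h < dotp a h] mem.
exists (s :: t ++ [:: s]); first by rewrite /= all_cat tS /= sS.
rewrite -[s :: _]cat1s !reflprod_cat !reflprod1 -tE.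
rewrite (refl_weyl rsP)//; last exact: weyl_refl.
by rewrite refl_tr !mulmxA reflK// mul1mx -mulmxA reflK// mulmx1.
Qed.

Lemma weyl_simple w : W w -> exists2 t, all (mem S) t & w = reflprod t.
Proof.
move=> [s [srs ->]]; elim: s srs => [|a s IH] /= => [_|/andP[ars /IH[t tS ->]]].
  by exists [::].
have [u uS ->] : exists2 t, all (mem S) t & refl a = reflprod t.
  have := pos_or_neg rsP regh ars => /orP[/refl_simple//|].
  by rewrite -[refl a](refl_scale _ (_ : -1 != 0)) ?scaleN1r ?oppr_eq0 ?oner_eq0// => /refl_simple.
by exists (u ++ t); [rewrite all_cat uS|rewrite reflprod_cat].
Qed.

Lemma simple_sign_change (t : seq E) s : all (mem S) t -> s \in S ->
  s *m reflprod (rev t) \notin pos ->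
  exists t1 a t2, [/\ t = t1 ++ a :: t2, a \in S, s *m reflprod (rev t2) \in pos &
     s *m reflprod (rev t2) *m refl a \notin pos].
Proof.
move=> + sS; elim: t => [_|a t IH /= /andP[aS tS]].
  by rewrite mulmx1 simple_pos.
rewrite rev_cons -cats1 reflprod_cat reflprod1 mulmxA.
have [sp sn|/IH H _] := boolP (s *m reflprod (rev t) \in pos).
  by exists [::], a, t.
have [t1 [b [t2 [-> bS sp sn]]]] := H tS.
by exists (a :: t1), b, t2.
Qed.

Let all_rs t : all (mem S) t -> all (mem rs) t.
Proof. by move=> /allP H; apply/allP => a /H/simple_root. Qed.

(** When the letters of [rev t] are applied to [s] in turn, a positive root is made non-positive by
    some letter [a]. By [simple_system] that root is proportional to [a], so [refl a] is the
    conjugate of [refl s] by the part of the word after [a]; substituting it cancels both [a] and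
    [s]. *)
Lemma exchange (t : seq E) s : all (mem S) t -> s \in S ->
  s *m reflprod (rev t) \notin pos ->
  exists t', [/\ all (mem S) t', (size t' < size t)%N &
    reflprod t *m refl s = reflprod t'].
Proof.
move=> tS sS /(simple_sign_change tS sS)[t1 [a [t2 [tE aS sp sn]]]].
move: tS; rewrite tE all_cat /= => /and3P[t1S _ t2S].
exists (t1 ++ t2); rewrite all_cat t1S t2S !size_cat /= addnS ltnS; split => //.
have [_ _ _ Srefl] := simpleS.
have [[c sc]|nprop] := pselect (exists c, s *m reflprod (rev t2) = c *: a); last first.
  by move: sn; rewrite Srefl// => c sc; apply: nprop; exists c.
have W2 : W (reflprod (rev t2)) by apply: weyl_reflprod; rewrite all_rev all_rs.
have ra : refl a = reflprod t2 *m refl s *m reflprod (rev t2).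
  rewrite -(@refl_scale _ _ c a) -?sc; last first.
    apply: contraTneq sp => c0; rewrite sc c0 scale0r mem_pos dotp0l ltxx.
    by [].
  by rewrite (refl_weyl rsP)// reflprod_tr revK.
rewrite reflprod_cat /= ra reflprod_cat.
have K2 : reflprod (rev t2) *m reflprod t2 = 1%:M.
  by rewrite -[in X in _ *m X](revK t2) (reflprodK rsP)// all_rev all_rs.
rewrite !mulmxA -(mulmxA _ (reflprod (rev t2))) K2 mulmx1.
by rewrite -(mulmxA _ (refl s)) reflK ?mulmx1// (root_neq0 rsP)// simple_root.
Qed.

Lemma Qplus0 : Qplus rs h 0.
Proof. by exists (fun=> 0%N); rewrite big1// => a _; rewrite scale0r. Qed.

Lemma QplusD u v : Qplus rs h u -> Qplus rs h v -> Qplus rs h (u + v).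
Proof.
move=> [k ->] [l ->]; exists (fun a => (k a + l a)%N).
by rewrite -big_split; apply: eq_bigr => a _; rewrite natrD scalerDl.
Qed.

Lemma Qplus_pos a n : a \in pos -> Qplus rs h (n%:R *: a).
Proof.
move=> ap; exists (fun b => if b == a then n else 0%N).
rewrite (bigD1_seq a)//= ?eqxx ?(pos_uniq h rsP)//.
rewrite big1 ?addr0// => b /negbTE ->.
by rewrite scale0r.
Qed.

Lemma Qplus_posZ a c : a \in pos -> 0 <= c -> c \is a Num.int -> Qplus rs h (c *: a).
Proof.
move=> ap c0 /intrP[z cz]; move: c0; rewrite cz ler0z => /gez0_abs <-.
exact: Qplus_pos.
Qed.

Lemma Qplus_height v : Qplus rs h v -> 0 <= dotp v h.
Proof.
move=> [k ->]; rewrite dotp_suml big_seq sumr_ge0// => a ap.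
by rewrite dotpZl mulr_ge0 ?ler0n// ltW// (pos_gt0 ap).
Qed.

Lemma Qplus_eq0 v : Qplus rs h v -> dotp v h <= 0 -> v = 0.
Proof.
move=> [k ->] /(@cone_height pos (fun a => (k a)%:R)) H.
rewrite big_seq big1// => a ap; rewrite H ?scale0r// => b; exact: ler0n.
Qed.

Lemma wle_refl x : wle rs h x x.
Proof. by rewrite /wle subrr; exact: Qplus0. Qed.

Lemma wle_trans y x z : wle rs h x y -> wle rs h y z -> wle rs h x z.
Proof.
by move=> xy yz; rewrite /wle -(subrKA y) [z - y + _]addrC addrC; apply: QplusD.
Qed.

Lemma wle_anti x y : wle rs h x y -> wle rs h y x -> x = y.
Proof.
move=> xy yx; apply/eqP; rewrite eq_sym -subr_eq0; apply/eqP; apply: Qplus_eq0 => //.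
by rewrite -(opprB x y) dotpNl oppr_le0; exact: Qplus_height yx.
Qed.

Lemma weightD x y : weight rs x -> weight rs y -> weight rs (x + y).
Proof. by move=> wx wy a ars; rewrite dotpDl rpredD// ?wx ?wy. Qed.

Lemma weightN x : weight rs x -> weight rs (- x).
Proof. by move=> wx a ars; rewrite dotpNl rpredN wx. Qed.

Lemma weight_root a : a \in rs -> weight rs a.
Proof. by case: rsP => _ _ _ _ H ars b brs; exact: H. Qed.

Lemma weightZn x n : weight rs x -> weight rs (n%:R *: x).
Proof. by move=> wx a ars; rewrite dotpZl rpredM ?rpred_nat ?wx. Qed.

Lemma weight_weyl w x : W w -> weight rs x -> weight rs (x *m w).
Proof.
move=> Ww wx a ars; rewrite dotp_mx -(coroot_weyl rsP); last exact: weylT.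
by apply: wx; apply: (root_weyl rsP) => //; exact: weylT.
Qed.

(** Induction on the length of a word in simple reflections. If the last letter pairs nonnegatively
    with the vector reached so far, reflecting subtracts a nonnegative integer multiple of a
    positive root. Otherwise dominance of [mu] shows that the exchange condition applies and gives a
    shorter word. *)
Lemma wle_weyl mu w : dominant rs h mu -> W w -> wle rs h (mu *m w) mu.
Proof.
move=> [wmu dmu] /weyl_simple[t tS ->].
have [n] := ubnP (size t); elim: n t tS => // n IH t.
case/lastP: t => [|t s] tS tn; first by rewrite mulmx1; exact: wle_refl.
move: tS tn; rewrite all_rcons size_rcons ltnS => /andP[sS tS] tn.
rewrite -cats1 reflprod_cat reflprod1.
have srs := simple_root sS; have sp := simple_pos sS.
have Wt : W (reflprod t) by apply/weyl_reflprod/all_rs.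
have [sn|sn] := leP 0 (dotp (mu *m reflprod t) (coroot s)).
  apply: (@wle_trans (mu *m reflprod t)); last exact: IH.
  rewrite mulmxA mulmx_refl /wle opprB addrCA subrr addr0.
  by apply: Qplus_posZ => //; apply: weight_weyl.
have [|t' [t'S t't ->]] := exchange tS sS; last by apply: IH => //; exact: ltn_trans tn.
apply/negP => /dmu; rewrite leNgt => /negP; apply.
have WT : W (reflprod (rev t)) by rewrite -reflprod_tr; exact: weylT.
by rewrite (coroot_weyl rsP)// -reflprod_tr -dotp_mx.
Qed.

Lemma dominant_uniq mu nu w : dominant rs h mu -> dominant rs h nu -> W w ->
  nu = mu *m w -> nu = mu.
Proof.
move=> dmu dnu Ww E; apply: wle_anti; first by rewrite E; exact: wle_weyl.
have -> : mu = nu *m w^T by rewrite E -mulmxA (weylK rsP)// mulmx1.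
by apply: wle_weyl => //; exact: weylT.
Qed.

(** Choose the orbit element of maximal height: a negative pairing with a positive root would let
    its reflection raise the height. *)
Lemma exists_dominant x : weight rs x -> exists2 w, W w & dominant rs h (x *m w).
Proof.
move=> wx.
have maxs (s : seq 'M[R]_r) (f : 'M[R]_r -> R) : s != [::] ->
    exists2 w, w \in s & forall v, v \in s -> f v <= f w.
  elim: s => // a [_ _|b s /(_ isT)[w ws wmax] _].
    by exists a => [|v]; rewrite inE ?eqxx// => /eqP ->.
  have [wa|/ltW aw] := leP (f w) (f a).
    exists a; rewrite ?mem_head// => v; rewrite in_cons => /orP[/eqP -> //|/wmax].
    by move=> /le_trans; apply.
  exists w; first by rewrite in_cons ws orbT.
  by move=> v; rewrite in_cons => /orP[/eqP -> //|/wmax].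
have [|w /(mem_wseq rsP) Ww wmax] := maxs (wseq rs) (fun w => dotp (x *m w) h).
  have /(mem_wseq rsP) := weyl1 rs; by case: wseq.
exists w => //; split; first exact: weight_weyl.
move=> a ap; rewrite leNgt; apply/negP => an.
have := wmax (w *m refl a); rewrite mulmxA mulmx_refl dotpBl dotpZl gerBl => H.
have : 0 <= dotp (x *m w) (coroot a) * dotp a h.
  by apply: H; apply/(mem_wseq rsP)/weylM => //; exact/weyl_refl/pos_root/ap.
by rewrite pmulr_lge0 ?(pos_gt0 ap)// leNgt an.
Qed.

End SimpleRoots.

(** * The dominance order and root strings *)

Section Dominance.
Context {R : realType} {r : nat} (rs : seq 'rV[R]_r) (h : 'rV[R]_r) (g : 'rV[R]_r -> R).
Local Notation E := 'rV[R]_r.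
Implicit Types a x y mu nu lam : E.
Hypothesis rsP : root_system rs.
Hypothesis regh : regular rs h.
Hypothesis g_ge0 : forall a, a \in rs -> 0 <= g a.
Hypothesis g_weyl : forall w a, weyl rs w -> a \in rs -> g (a *m w) = g a.
Local Notation pos := (posroots rs h).
Local Notation W := (weyl rs).
Local Notation orbit := Defs.orbit.

Lemma wle_orbit mu w : dominant rs h mu -> W w -> wle rs h (mu *m w) mu.
Proof.
by have [S HS] := exists_simple_system rsP regh; exact: (wle_weyl rsP regh HS).
Qed.

Lemma dominant_orbit_uniq mu nu w : dominant rs h mu -> dominant rs h nu -> W w ->
  nu = mu *m w -> nu = mu.
Proof.
by have [S HS] := exists_simple_system rsP regh; exact: (dominant_uniq rsP regh HS).
Qed.

Lemma dominant_ge0 mu a : dominant rs h mu -> a \in pos -> 0 <= dotp mu a.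
Proof.
move=> [_ dmu] ap; have a0 := root_neq0 rsP (pos_root ap).
by have := dmu a ap; rewrite !leNgt dotp_coroot_sg.
Qed.

Lemma Qplus_dominant_ge0 v x : Qplus rs h v -> (forall a, a \in pos -> 0 <= dotp x a) ->
  0 <= dotp v x.
Proof.
move=> [k ->] xpos; rewrite dotp_suml big_seq sumr_ge0// => a ap.
by rewrite dotpZl mulr_ge0 ?ler0n// dotpC xpos.
Qed.

(* The terms of [rho] with [b] and [b *m refl a] both positive cancel in pairs;
   in the others [dotp b a >= 0]. *)
Lemma rho_dominant a : a \in pos -> 0 <= dotp (rho rs h g) a.
Proof.
move=> ap; have ars := pos_root ap; have a0 := root_neq0 rsP ars.
rewrite /rho dotpZl mulr_ge0 ?invr_ge0// dotp_suml.
pose f b := dotp (g b *: b) a.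
rewrite (bigID (fun b => b *m refl a \in pos)) /= addr_ge0//; last first.
  rewrite big_seq_cond sumr_ge0// => b /andP[bp nb]; rewrite dotpZl.
  rewrite mulr_ge0 ?g_ge0 ?(pos_root bp)// leNgt; apply: contra nb => ba.
  rewrite mem_pos root_refl ?(pos_root bp)// andbT mulmx_refl dotpBl dotpZl subr_gt0.
  apply: (@lt_trans _ _ 0); last exact: pos_gt0 bp.
  by rewrite nmulr_rlt0 ?(pos_gt0 ap)// dotp_coroot_sg.
have ra2 b : b *m refl a *m refl a = b by rewrite -mulmxA reflK// mulmx1.
have E : \sum_(b <- pos | b *m refl a \in pos) f b =
    \sum_(b <- pos | b *m refl a \in pos) - f b.
  rewrite -big_filter (perm_big [seq b *m refl a | b <- pos & b *m refl a \in pos])/=.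
    rewrite big_map big_filter big_seq_cond [RHS]big_seq_cond.
    apply: eq_bigr => b /andP[bp _]; rewrite /f !dotpZl g_weyl ?(pos_root bp)//.
      by rewrite dotp_mx refl_tr reflN// dotpNr mulrN.
    exact: weyl_refl.
  apply: uniq_perm; first by rewrite filter_uniq// (pos_uniq h rsP).
    rewrite map_inj_uniq; first by rewrite filter_uniq// (pos_uniq h rsP).
    move=> b c /(congr1 (mulmx^~ (refl a))).
    by rewrite !ra2.
  move=> b; apply/idP/mapP => [|[c]].
    by rewrite mem_filter => /andP[bap bp]; exists (b *m refl a); rewrite ?ra2// mem_filter ra2 bp.
  by rewrite mem_filter => /andP[cap cp] ->; rewrite mem_filter ra2 cp.
have : \sum_(b <- pos | b *m refl a \in pos) f b = 0.
  by move: E; rewrite sumrN => E; lra.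
by rewrite /f => ->.
Qed.

(** With [lam = mu + q], the difference is the squared norm of [q] plus twice its products with [mu]
    and [rho]. Those products are nonnegative by dominance, and the norm is positive. This makes all
    denominators of the theorem nonzero. *)
Lemma eps_lt mu lam : dominant rs h mu -> dominant rs h lam -> wlt rs h mu lam ->
  eps rs h g mu < eps rs h g lam.
Proof.
move=> dmu dlam [mulam nmulam]; rewrite -subr_gt0.
pose q := lam - mu; have lamE : lam = mu + q by rewrite /q addrC subrK.
have mq : Qplus rs h q := mulam.
have q0 : q != 0 by rewrite subr_eq0 eq_sym; apply/eqP.
clearbody q; have -> : eps rs h g lam - eps rs h g mu =
    dotp q q + 2 * dotp q mu + 2 * dotp q (rho rs h g).
  rewrite /eps lamE !(dotpDl, dotpDr) (dotpC mu q) (dotpC (rho rs h g) q); ring.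
have := Qplus_dominant_ge0 mq (fun a => dominant_ge0 dmu (a:=a)).
have := Qplus_dominant_ge0 mq rho_dominant.
have : 0 < dotp q q by rewrite dotp_gt0.
lra.
Qed.

Lemma pairing_nat mu a : dominant rs h mu -> a \in pos ->
  exists k : nat, dotp mu (coroot a) = k%:R.
Proof.
move=> [wmu dmu] ap; have /intrP[z zE] := wmu a (pos_root ap).
have := dmu a ap; rewrite zE ler0z => z0; exists `|z|%N.
by rewrite pmulrn (gez0_abs z0).
Qed.

(** Along a string the squared norm is a quadratic function of [l] symmetric about [c / 2], so the
    norm determines [l] up to the reflection [c - l]. *)
Lemma string_norm x a c l : a != 0 -> dotp x (coroot a) = c ->
  dotp (x - l *: a) (x - l *: a) = dotp x x - l * (c - l) * dotp a a.
Proof.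
move=> a0 xc; have xa := dotp_corootK x a0; rewrite xc in xa.
by rewrite !(dotpBl, dotpBr, dotpZl, dotpZr) (dotpC a x) xa; field.
Qed.

Lemma string_refl x a (l : R) : a != 0 ->
  (x - l *: a) *m refl a = x - (dotp x (coroot a) - l) *: a.
Proof.
move=> a0; rewrite mulmx_refl dotpBl dotpZl dotp_coroot_id//.
by apply/rowP => i; rewrite !mxE; ring.
Qed.

(** An interior point has smaller norm than the ends, so it is not conjugate to [mu]. For the order,
    compare with the image under [w] of one end of the string: [mu] itself if [a *m w] is positive,
    its reflection otherwise. *)
Lemma string_wlt mu nu a w (k l : nat) : dominant rs h mu -> dominant rs h nu ->
  a \in pos -> dotp mu (coroot a) = k%:R -> (0 < l < k)%N -> W w ->
  nu = (mu - l%:R *: a) *m w -> wlt rs h nu mu.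
Proof.
move=> dmu dnu ap muk /andP[l0 lk] Ww nuE.
have ars := pos_root ap; have a0 := root_neq0 rsP ars.
split; last first.
  move=> numu; have := congr1 (fun x => dotp x x) nuE; rewrite /= (dotp_weyl rsP)//.
  rewrite (string_norm _ a0 muk) numu => /eqP.
  rewrite -subr_eq0 opprB addrC subrK mulf_eq0 dotp_eq0 (negbTE a0) orbF mulf_eq0.
  by rewrite pnatr_eq0 -natrB 1?ltnW// pnatr_eq0 subn_eq0 leqNgt lk orbF gtn_eqF.
have := pos_or_neg rsP regh (root_weyl rsP Ww ars) => /orP[wap|wan].
  apply: (@wle_trans _ _ _ _ (mu *m w)); last exact: wle_orbit.
  rewrite nuE /wle mulmxBl opprB addrCA subrr addr0 -scalemxAl.
  exact: Qplus_pos.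
apply: (@wle_trans _ _ _ _ (mu *m (refl a *m w))); last first.
  by apply: wle_orbit => //; apply: weylM => //; exact: weyl_refl.
rewrite nuE /wle mulmxA mulmx_refl muk.
have -> : (mu - k%:R *: a) *m w - (mu - l%:R *: a) *m w = (k - l)%:R *: - (a *m w).
  rewrite natrB 1?ltnW// !mulmxBl -!scalemxAl.
  by apply/rowP => i; rewrite !mxE; ring.
exact: Qplus_pos.
Qed.

Lemma bracket_wlt mu nu a : dominant rs h mu -> dominant rs h nu ->
  bracket rs h mu nu a -> wlt rs h nu mu.
Proof.
move=> dmu dnu [ap [l [l1 [lk [w Ww wE]]]]].
have [k muk] := pairing_nat dmu ap.
move: lk; rewrite muk ler_pdivlMr// -natrM ler_nat => lk.
apply: (string_wlt dmu dnu ap muk (l:=l) (w:=w^T)); first lia.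
  exact: weylT.
by rewrite -wE -mulmxA (weylK rsP)// mulmx1.
Qed.

Lemma dmunu_eq0 mu nu : dominant rs h mu -> dominant rs h nu -> ~ wlt rs h nu mu ->
  dmunu rs h g mu nu = 0.
Proof.
move=> dmu dnu nlt; rewrite /dmunu big1 ?mulr0// => a /asboolP br.
by case: nlt; exact: bracket_wlt br.
Qed.

(** The indices counted are stable under [l -> k - l], and the norm leaves no others than [l0] and
    [k - l0]. So there are two of them, or only one when [l0] is the midpoint, which is the
    distinction made by [nmunu]. By the symmetry, [bracket] may look at half of the string only. *)
Lemma count_string mu nu a (k : nat) : dominant rs h mu -> a \in pos ->
  dotp mu (coroot a) = k%:R ->
  (count (fun l : nat => `[< orbit rs nu (mu - l%:R *: a) >]) (index_iota 1 k))%:R =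
  (if `[< bracket rs h mu nu a >] then nmunu mu nu a else 0) :> R.
Proof.
move=> dmu ap muk; have ars := pos_root ap; have a0 := root_neq0 rsP ars.
pose P (l : nat) := orbit rs nu (mu - l%:R *: a).
have symP (l : nat) : (l <= k)%N -> P l -> P (k - l)%N.
  move=> lk [w Ww wE]; exists (w *m refl a); first exact: weylM (weyl_refl ars).
  by rewrite mulmxA wE string_refl// muk natrB.
have normP (l : nat) : P l -> dotp nu nu = dotp mu mu - l%:R * (k%:R - l%:R) * dotp a a.
  by move=> [w Ww wE]; rewrite -(string_norm _ a0 muk) -wE (dotp_weyl rsP).
have aa : 0 < dotp a a by rewrite dotp_gt0.
have brP (l : nat) : (0 < l)%N -> (l.*2 <= k)%N -> P l -> bracket rs h mu nu a.
  move=> l0 lk Pl; split => //; exists l; split => //; split => //.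
  by rewrite muk ler_pdivlMr// -natrM ler_nat muln2.
case: asboolP => [[_ [l0 [l1 [l0k Pl0]]]]|nbr]; last first.
  rewrite (@eq_in_count _ _ pred0) ?count_pred0// => l.
  rewrite mem_index_iota => /andP[l1 lk]; apply/negbTE/asboolPn => Pl; apply: nbr.
  have [lk2|lk2] := leqP l.*2 k; first exact: brP Pl.
  by apply: (brP (k - l)%N); [lia|lia|apply: symP => //; exact: ltnW].
move: l0k; rewrite muk ler_pdivlMr// -natrM ler_nat => l0k.
have PE (l : nat) : (0 < l < k)%N -> `[< P l >] = (l == l0) || (l == k - l0)%N.
  move=> /andP[l_gt0 lk]; apply/asboolP/orP => [Pl|[/eqP -> //|/eqP ->]]; last first.
    by apply: symP => //; lia.
  have := normP _ Pl; rewrite (normP _ Pl0) => /eqP.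
  rewrite -subr_eq0.
  have -> : dotp mu mu - l0%:R * (k%:R - l0%:R) * dotp a a -
     (dotp mu mu - l%:R * (k%:R - l%:R) * dotp a a) =
     (l%:R - l0%:R) * (k%:R - l%:R - l0%:R) * dotp a a by ring.
  rewrite !mulf_eq0 (gt_eqF aa) orbF !subr_eq0 => /orP[|/eqP H].
    by rewrite eqr_nat; left.
  have /eqP : k%:R = (l + l0)%:R :> R by rewrite natrD; lra.
  by rewrite eqr_nat => /eqP ->; right; rewrite addnK.
(* [Palpha a mu] is the midpoint of the string, so equality of norms means [l0 = k / 2]. *)
have nmE : (enorm nu == enorm (Palpha a mu)) = (l0.*2 == k).
  have Pmu : Palpha a mu = mu - (k%:R / 2) *: a.
    by rewrite /Palpha mulmx_refl muk; apply/rowP => i; rewrite !mxE; field.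
  rewrite /enorm eqr_sqrt ?dotp_ge0// Pmu (string_norm _ a0 muk) (normP _ Pl0).
  rewrite -subr_eq0.
  have -> : dotp mu mu - l0%:R * (k%:R - l0%:R) * dotp a a -
     (dotp mu mu - k%:R / 2 * (k%:R - k%:R / 2) * dotp a a) =
     (k%:R - l0%:R * 2) ^+ 2 * (dotp a a / 4) by field.
  rewrite mulf_eq0 sqrf_eq0 mulf_eq0 (gt_eqF aa) invr_eq0 pnatr_eq0 !orbF.
  by rewrite -natrM subr_eq0 eqr_nat eq_sym muln2.
rewrite (@eq_in_count _ _ (fun l => (l == l0) || (l == k - l0)%N)); last first.
  by move=> l; rewrite mem_index_iota => lk; exact: PE.
rewrite /nmunu nmE -size_filter.
have fu : uniq [seq l <- index_iota 1 k | (l == l0) || (l == k - l0)%N].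
  by rewrite filter_uniq// iota_uniq.
have [l02|l02] := eqVneq l0.*2 k.
  rewrite (perm_size (uniq_perm fu (_ : uniq [:: l0]) _))// => l.
  rewrite mem_filter mem_index_iota inE; lia.
rewrite (perm_size (uniq_perm fu (_ : uniq [:: l0; (k - l0)%N]) _))//.
  by rewrite /= inE andbT; lia.
by move=> l; rewrite mem_filter mem_index_iota !inE; lia.
Qed.

End Dominance.

(** * The Heckman-Opdam Laplacian *)

Section Laplacian.
Context {R : realType} {r : nat} (rs : seq 'rV[R]_r) (h : 'rV[R]_r) (g : 'rV[R]_r -> R).
Local Notation E := 'rV[R]_r.
Local Notation C := R[i].
Local Notation "x %:C" := (real_complex R x).
Implicit Types (a x y mu nu lam : E) (f : E -> C).
Hypothesis rsP : root_system rs.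
Hypothesis regh : regular rs h.
Hypothesis g_weyl : forall w a, weyl rs w -> a \in rs -> g (a *m w) = g a.
Local Notation pos := (posroots rs h).
Local Notation W := (weyl rs).
Local Notation orbit := Defs.orbit.

(* [Num.truncn] is [0] on negative numbers, so that only the orbit elements [x]
   with [0 < dotp x a] contribute to [root_term] below. *)
Definition strlen x a : nat := Num.truncn (dotp x (coroot a)).

(** For exponentials this is the quotient of [(1 + e^-a)(e^x - e^(r_a x))] by [1 - e^-a]: both ends
    of the string count once and interior points twice. *)
Definition string_sum f x a : C :=
  \sum_(l < strlen x a) (f (x - l%:R *: a) + f (x - l.+1%:R *: a)).

Definition root_term f mu a : C :=
  \sum_(x <- oseq rs mu) (dotp x a)%:C * string_sum f x a.

(* The Heckman-Opdam Laplacian applied to [m_mu], each exponential [e^x] being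
   replaced by [f x]: the quotient [(1 + e^-a) / (1 - e^-a)] has been expanded
   along the root strings. *)
Definition laplacian f mu : C :=
  (dotp mu mu)%:C * (\sum_(x <- oseq rs mu) f x) +
  2^-1 * \sum_(a <- rs) (g a)%:C * root_term f mu a.

Lemma strlen_weyl x a w : W w -> strlen (x *m w) (a *m w) = strlen x a.
Proof. by move=> Ww; rewrite /strlen (coroot_weyl rsP)// (dotp_weyl rsP). Qed.

Lemma strlen_nat x a (k : nat) : dotp x (coroot a) = k%:R -> strlen x a = k.
Proof. by rewrite /strlen => ->; rewrite natrK. Qed.

Lemma strlen_le0 x a : dotp x (coroot a) <= 0 -> strlen x a = 0%N.
Proof.
move=> x0; apply/eqP; rewrite /strlen -leqn0 truncn_le_nat.
exact: le_lt_trans x0 ltr01.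
Qed.

(** Summing over the group instead of the orbit gives a function of [x] that is invariant for every
    [x], whatever its stabilizer. Converting back with [M_dominant] produces the ratio of stabilizer
    orders in [dmunu]. *)
Let M f x : C := \sum_(w <- wseq rs) f (x *m w).

Let M_weyl f x u : W u -> M f (x *m u) = M f x.
Proof.
move=> Wu; rewrite /M [RHS](perm_big _ (perm_wseq_mull rsP Wu)) /= big_map.
by apply: eq_bigr => w _; rewrite mulmxA.
Qed.

Let M_string f x a (k : nat) : a \in rs -> dotp x (coroot a) = k%:R ->
  M f (x - k%:R *: a) = M f x.
Proof. by move=> ars <-; rewrite -mulmx_refl M_weyl//; exact: weyl_refl. Qed.

(** Write each orbit element as [mu *m w] and reindex the roots by [w]: invariance of [g] and of the
    inner product brings every string to one starting at [mu]. *)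
Let root_terms_weyl f mu :
  (\sum_(a <- rs) (g a)%:C * root_term f mu a) *+ card_stab rs mu =
  \sum_(a <- rs) (g a * dotp mu a)%:C *
    \sum_(l < strlen mu a) (M f (mu - l%:R *: a) + M f (mu - l.+1%:R *: a)).
Proof.
pose F x := \sum_(a <- rs) (g a)%:C * ((dotp x a)%:C * string_sum f x a).
have -> : \sum_(a <- rs) (g a)%:C * root_term f mu a = \sum_(x <- oseq rs mu) F x.
  by rewrite exchange_big /=; apply: eq_bigr => a _; rewrite mulr_sumr.
rewrite -(sum_orbit rsP).
have FE w : w \in wseq rs -> F (mu *m w) = \sum_(a <- rs) (g a * dotp mu a)%:C *
    \sum_(l < strlen mu a) (f ((mu - l%:R *: a) *m w) + f ((mu - l.+1%:R *: a) *m w)).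
  move=> /(mem_wseq rsP) Ww; rewrite /F (perm_big _ (perm_root_weyl rsP Ww)) /= big_map.
  rewrite big_seq [RHS]big_seq; apply: eq_bigr => a ars.
  rewrite g_weyl// (dotp_weyl rsP)// rmorphM -mulrA; congr (_ * (_ * _)).
  rewrite /string_sum strlen_weyl//; apply: eq_bigr => l _.
  by rewrite !mulmxBl -!scalemxAl.
rewrite big_seq (eq_bigr _ FE) -big_seq exchange_big; apply: eq_bigr => a _ /=.
rewrite -mulr_sumr exchange_big; congr (_ * _); apply: eq_bigr => l _.
by rewrite big_split.
Qed.

Let M_dominant f mu : M f mu = (\sum_(x <- oseq rs mu) f x) *+ card_stab rs mu.
Proof. exact: sum_orbit. Qed.

(** The sum on the right has a single term: the dominant representative of the interior point, which
    is unique and lies below [mu]. *)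
Let M_sum_dominant f mu a (k l : nat) (bs : seq E) : dominant rs h mu -> a \in pos ->
  dotp mu (coroot a) = k%:R -> (0 < l < k)%N ->
  uniq bs -> (forall nu, nu \in bs -> dominant rs h nu) ->
  (forall nu, dominant rs h nu -> wlt rs h nu mu -> nu \in bs) ->
  M f (mu - l%:R *: a) =
  \sum_(nu <- bs | `[< orbit rs nu (mu - l%:R *: a) >]) M f nu.
Proof.
move=> dmu ap muk lk bsu bsd bsmu; have ars := pos_root ap.
have wl : weight rs (mu - l%:R *: a).
  apply: weightD; first exact: dmu.1.
  by apply: weightN; apply: weightZn; exact: (weight_root rsP).
have [w Ww dw] := exists_dominant h rsP wl.
pose nu := (mu - l%:R *: a) *m w.
have nubs : nu \in bs.
  by apply: bsmu => //; exact: (string_wlt rsP regh dmu dw ap muk lk Ww).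
rewrite (big_rem nu)//= ifT; last first.
  by apply/asboolP; exists w^T; [exact: weylT|rewrite /nu -mulmxA (weylK rsP)// mulmx1].
rewrite M_weyl// big_seq_cond big1 ?addr0// => nu' /andP[].
rewrite mem_rem_uniq// inE => /andP[/= nn nbs] /asboolP[v Wv vE]; exfalso.
move/eqP: nn; apply; apply/esym.
apply: (dominant_orbit_uniq rsP regh (bsd _ nbs) dw (weylM Wv Ww)).
by rewrite mulmxA vE.
Qed.

(** The two ends are conjugate and give [M f mu] each; every interior point occurs in two
    consecutive summands. Hence the common factor [2], which later cancels the [2^-1] of
    [laplacian]. *)
Let string_terms f mu a (bs : seq E) : dominant rs h mu -> a \in pos ->
  uniq bs -> (forall nu, nu \in bs -> dominant rs h nu) ->
  (forall nu, dominant rs h nu -> wlt rs h nu mu -> nu \in bs) ->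
  (dotp mu a)%:C *
    \sum_(l < strlen mu a) (M f (mu - l%:R *: a) + M f (mu - l.+1%:R *: a)) =
  (dotp mu a)%:C * (2 * (M f mu + \sum_(nu <- bs)
     (if `[< bracket rs h mu nu a >] then nmunu mu nu a else 0)%:C * M f nu)).
Proof.
move=> dmu ap bsu bsd bsmu; have [k muk] := pairing_nat dmu ap.
have ars := pos_root ap; have a0 := root_neq0 rsP ars.
rewrite (strlen_nat muk); case: k muk => [|k] muk.
  have -> : dotp mu a = 0 by rewrite (dotp_corootK _ a0) muk mulr0n !mul0r.
  by rewrite rmorph0 !mul0r.
congr (_ * _); rewrite big_split /=.
pose T l := M f (mu - l%:R *: a).
rewrite -/(\sum_(l < k.+1) T l) -/(\sum_(l < k.+1) T l.+1).
have E1 : \sum_(l < k.+1) T l = T 0%N + \sum_(1 <= l < k.+1) T l.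
  by rewrite -(big_mkord xpredT) big_ltn.
have E2 : \sum_(l < k.+1) T l.+1 = \sum_(1 <= l < k.+1) T l + T k.+1.
  rewrite -(big_mkord xpredT (fun l => T l.+1)) -(big_add1 _ _ 0 k.+2 xpredT T).
  by rewrite big_nat_recr.
have T0 : T 0%N = M f mu by rewrite /T scale0r subr0.
have Tk : T k.+1 = M f mu by rewrite /T M_string.
rewrite E1 E2 T0 Tk.
have -> : \sum_(1 <= l < k.+1) T l = \sum_(nu <- bs)
     (if `[< bracket rs h mu nu a >] then nmunu mu nu a else 0)%:C * M f nu.
  rewrite big_seq (eq_bigr (fun l : nat =>
    \sum_(nu <- bs | `[< orbit rs nu (mu - l%:R *: a) >]) M f nu)); last first.
    by move=> l; rewrite mem_index_iota => lk; exact: M_sum_dominant muk _ _ _ _.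
  rewrite -big_seq (exchange_big_dep predT)//=; apply: eq_bigr => nu _.
  rewrite -(count_string rsP nu dmu ap muk) rmorph_nat mulr_natl.
  by rewrite big_const_seq; elim: (count _ _) => //= n ->; rewrite mulrS.
by rewrite mulr2n mulrDl mul1r; ring.
Qed.

(** Any list of dominant weights containing those below [mu] is allowed, since the other
    coefficients [dmunu] vanish; so one list serves all weights below [lam]. *)
Theorem laplacian_triangular f mu (bs : seq E) : dominant rs h mu ->
  uniq bs -> (forall nu, nu \in bs -> dominant rs h nu) ->
  (forall nu, dominant rs h nu -> wlt rs h nu mu -> nu \in bs) ->
  laplacian f mu = (eps rs h g mu)%:C * (\sum_(x <- oseq rs mu) f x) +
    \sum_(nu <- bs) (dmunu rs h g mu nu)%:C * \sum_(x <- oseq rs nu) f x.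
Proof.
move=> dmu bsu bsd bsmu.
have N0 nu : (card_stab rs nu)%:R != 0 :> C.
  by rewrite pnatr_eq0 -lt0n; exact: card_stab_gt0.
have RT : 2^-1 * \sum_(a <- rs) (g a)%:C * root_term f mu a =
   (card_stab rs mu)%:R^-1 * \sum_(a <- pos) (g a * dotp mu a)%:C *
     (M f mu + \sum_(nu <- bs)
     (if `[< bracket rs h mu nu a >] then nmunu mu nu a else 0)%:C * M f nu).
  apply: (mulfI (N0 mu)); rewrite mulrCA mulr_natl root_terms_weyl.
  (* Negative roots pair nonpositively with the dominant [mu], so their strings are empty and only
     [pos] remains. *)
  rewrite mulVKf// (bigID (fun a => 0 < dotp a h)) /= addrC big_seq_cond big1 => [|a].
    rewrite add0r -big_filter -/pos mulr_sumr big_seq [RHS]big_seq.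
    apply: eq_bigr => a ap; rewrite rmorphM -2!mulrA (string_terms _ dmu ap bsu bsd bsmu).
    rewrite mulrCA; congr (_ * _); rewrite [LHS]mulrCA; congr (_ * _).
    by rewrite mulKf// pnatr_eq0.
  move=> /andP[ars na]; rewrite strlen_le0 ?big_ord0 ?mulr0//.
  have nap : - a \in pos.
    by have := pos_or_neg rsP regh ars; rewrite {1}mem_pos (negbTE na).
  have := dmu.2 _ nap; rewrite corootN dotpNr oppr_ge0; exact.
rewrite /laplacian RT.
have -> : \sum_(a <- pos) (g a * dotp mu a)%:C * (M f mu + \sum_(nu <- bs)
     (if `[< bracket rs h mu nu a >] then nmunu mu nu a else 0)%:C * M f nu) =
  (2 * dotp mu (rho rs h g))%:C * M f mu + \sum_(nu <- bs)
   (\sum_(a <- pos | `[< bracket rs h mu nu a >]) g a * dotp mu a * nmunu mu nu a)%:C * M f nu.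
  under eq_bigr do rewrite mulrDr mulr_sumr.
  rewrite big_split /= -mulr_suml exchange_big /=; congr (_ * _ + _).
    rewrite -rmorph_sum /rho dotpZr mulrA divff ?pnatr_eq0// mul1r dotp_sumr.
    by congr (_%:C); apply: eq_bigr => a _; rewrite dotpZr.
  apply: eq_bigr => nu _; rewrite rmorph_sum mulr_suml [RHS]big_mkcond /=.
  apply: eq_bigr => a _; case: asboolP => _; first by rewrite mulrA -rmorphM.
  by rewrite rmorph0 mul0r mulr0.
have MN nu c : c * M f nu = (card_stab rs nu)%:R * (c * \sum_(x <- oseq rs nu) f x).
  by rewrite M_dominant -(mulr_natl (\sum_(x <- oseq rs nu) f x)) mulrCA.
rewrite mulrDr addrA MN mulKf//; congr (_ + _).
  rewrite -mulrDl -rmorphD; congr (_%:C * _).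
  by rewrite /eps !(dotpDl, dotpDr) (dotpC (rho _ _ _) mu); ring.
rewrite mulr_sumr; apply: eq_bigr => nu _.
rewrite MN /dmunu !mulrA -(rmorph_nat (real_complex R) (card_stab rs nu)).
rewrite -(rmorph_nat (real_complex R) (card_stab rs mu)) -fmorphV -!rmorphM.
by congr (_%:C * _); ring.
Qed.

End Laplacian.

(** * Exponentials and root terms in closed form *)

Section Exponentials.
Context {R : realType} {r : nat}.
Local Notation E := 'rV[R]_r.
Local Notation C := R[i].
Local Notation "x %:C" := (real_complex R x).
Local Notation "'i" := (Complex 0 1 : C).
Implicit Types (u v x a : E).

Lemma ex0 x : ex 0 x = 1.
Proof. by rewrite /ex /expi dotp0l cos0 sin0. Qed.

Lemma exD u v x : ex (u + v) x = ex u x * ex v x.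
Proof.
rewrite /ex /expi dotpDl cosD sinD; apply/eqP; rewrite eq_complex /=.
by apply/andP; split; apply/eqP; ring.
Qed.

Lemma exDr u x y : ex u (x + y) = ex u x * ex u y.
Proof.
rewrite /ex /expi dotpDr cosD sinD; apply/eqP; rewrite eq_complex /=.
by apply/andP; split; apply/eqP; ring.
Qed.

Lemma exN u x : ex (- u) x = conjc (ex u x).
Proof. by rewrite /ex /expi dotpNl cosN sinN. Qed.

Lemma ex_mul_conj u x : ex u x * conjc (ex u x) = 1.
Proof. by rewrite -exN -exD subrr ex0. Qed.

Lemma exZn n a x : ex (n%:R *: a) x = ex a x ^+ n.
Proof.
elim: n => [|n IH]; first by rewrite scale0r ex0 expr0.
by rewrite -natr1 scalerDl scale1r exD IH exprSr.
Qed.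

Definition chord2 a x : R := 2 - 2 * cos (dotp a x).

Lemma chord2_ge0 a x : 0 <= chord2 a x.
Proof. by have := cos_le1 (dotp a x); rewrite /chord2; lra. Qed.

Lemma chord2_le4 a x : chord2 a x <= 4.
Proof. by have := cos_geN1 (dotp a x); rewrite /chord2; lra. Qed.

Lemma normc_chord a x : Normc.normc (1 - ex a x) ^+ 2 = chord2 a x.
Proof.
rewrite /= sub0r sqr_sqrtr ?addr_ge0 ?sqr_ge0// sqrrN sin2cos2 /chord2; ring.
Qed.

Lemma normc_powR a x (y : R) :
  powR (Normc.normc (1 - ex a x)) y = powR (chord2 a x) (y / 2).
Proof.
rewrite -normc_chord -powR_mulrn; last exact: sqrtr_ge0.
by rewrite -powRrM mulrCA divff ?pnatr_eq0// mulr1.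
Qed.

End Exponentials.

Section RootTermExp.
Context {R : realType} {r : nat} (rs : seq 'rV[R]_r).
Local Notation E := 'rV[R]_r.
Local Notation C := R[i].
Local Notation "x %:C" := (real_complex R x).
Implicit Types (a x y mu : E).
Hypothesis rsP : root_system rs.

Lemma perm_oseq_weyl mu w : weyl rs w ->
  perm_eq (oseq rs mu) [seq y *m w | y <- oseq rs mu].
Proof.
move=> Ww; apply: uniq_perm; first exact: oseq_uniq.
  rewrite map_inj_uniq ?oseq_uniq// => u v /(congr1 (fun m => m *m w^T)).
  by rewrite -!mulmxA (weylK rsP)// !mulmx1.
move=> y; apply/idP/mapP => [/(mem_oseqP rsP)[v Wv ->]|[z /(mem_oseqP rsP)[v Wv ->] ->]].
  exists (mu *m v *m w^T); last by rewrite -mulmxA (weylVK rsP)// mulmx1.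
  apply/(mem_oseqP rsP); exists (v *m w^T); last by rewrite mulmxA.
  by apply: weylM => //; exact: weylT.
by apply/(mem_oseqP rsP); exists (v *m w); [exact: weylM|rewrite mulmxA].
Qed.

Lemma weight_oseq mu y : weight rs mu -> y \in oseq rs mu -> weight rs y.
Proof. by move=> wmu /(mem_oseqP rsP)[w Ww ->]; exact: weight_weyl. Qed.

(** With [u = e^-a] and string length [k], this is the telescoping of [(1 - u)] against the sum of
    [u^l + u^(l+1)], giving [(1 + u)(1 - u^k)]. *)
Lemma string_sum_ex a x y : weight rs y -> a \in rs -> 0 < dotp y a ->
  (1 + ex (- a) x) * (ex y x - ex (y *m refl a) x) =
  (1 - ex (- a) x) * string_sum (fun v => ex v x) y a.
Proof.
move=> wy ars ya; have a0 := root_neq0 rsP ars.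
have [k yk] : exists k : nat, dotp y (coroot a) = k%:R.
  have /intrP[z zE] := wy a ars; exists `|z|%N.
  rewrite pmulrn gez0_abs// -(ler0z R) -zE; apply: dotp_coroot_ge0; exact: ltW.
rewrite /string_sum (strlen_nat yk) mulmx_refl yk.
set u := ex (- a) x.
have exl (l : nat) : ex (y - l%:R *: a) x = ex y x * u ^+ l.
  by rewrite exD -scalerN exZn.
under eq_bigr do rewrite !exl.
rewrite exl; elim: k {yk} => [|k IH]; first by rewrite big_ord0 expr0; ring.
by rewrite big_ord_recr /= [in RHS]mulrDr -IH !exprS; ring.
Qed.

(** The identity [(1 + e^-a) / (1 - e^-a) = -i cot(theta / 2)], with [theta = dotp a x] and the
    cotangent equal to [sin / (1 - cos)]. Denominators are cleared so that it also holds on the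
    walls. The sine is the one created by differentiating the weight. *)
Lemma root_term_ex mu a x : weight rs mu -> a \in rs ->
  (sin (dotp a x))%:C * \sum_(y <- oseq rs mu) (dotp y a)%:C * ex y x =
  Complex 0 1 * ((1 - cos (dotp a x))%:C * root_term rs (fun v => ex v x) mu a).
Proof.
move=> wmu ars; have a0 := root_neq0 rsP ars.
(* The positive part of [dotp y a]: the full product is [cp y] minus [cp] of the reflected vector,
   which groups [y] with its reflection. *)
pose cp y : R := if 0 < dotp y a then dotp y a else 0.
have caN y : dotp (y *m refl a) a = - dotp y a by rewrite dotp_mx refl_tr reflN// dotpNr.
have cE y : dotp y a = cp y - cp (y *m refl a).
  by rewrite /cp caN oppr_gt0; case: ltgtP => [_|_|<-]; ring.
have -> : \sum_(y <- oseq rs mu) (dotp y a)%:C * ex y x =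
    \sum_(y <- oseq rs mu) (cp y)%:C * (ex y x - ex (y *m refl a) x).
  under eq_bigr do rewrite cE rmorphB mulrBl.
  rewrite sumrB [X in _ - X](perm_big _ (perm_oseq_weyl mu (weyl_refl ars))) big_map.
  rewrite -sumrB; apply: eq_bigr => y _.
  by rewrite -mulmxA reflK// mulmx1 mulrBr.
set S := (X in _ * X = _); set T := root_term _ _ _ _; set u := ex a x.
have ST : (1 + conjc u) * S = (1 - conjc u) * T.
  rewrite /S /T /root_term !mulr_sumr big_seq [RHS]big_seq.
  apply: eq_bigr => y yo; rewrite mulrCA [RHS]mulrCA /cp.
  case: ltP => [ya|ya].
    by rewrite -exN string_sum_ex//; exact: weight_oseq wmu yo.
  rewrite /string_sum strlen_le0 ?big_ord0 ?mulr0 ?mul0r//.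
  by rewrite dotp_coroot mulr_ge0_le0// divr_ge0// dotp_ge0.
have uu : u * conjc u = 1 := ex_mul_conj a x.
have two : (2 : C) != 0 by rewrite pnatr_eq0.
have i2 : (Complex 0 1 : C) * Complex 0 1 = -1 by rewrite -sqr_i expr2.
have sE : 2 * (Complex 0 1 * (sin (dotp a x))%:C) = u - conjc u.
  by rewrite mulr_natl; apply/eqP; rewrite eq_complex /u /ex /expi /=; apply/andP; split; apply/eqP; ring.
have cE' : 2 * (1 - cos (dotp a x))%:C = 2 - u - conjc u.
  by rewrite mulr_natl; apply/eqP; rewrite eq_complex /u /ex /expi /=; apply/andP; split; apply/eqP; ring.
apply: (mulfI two); apply: (mulfI (_ : (Complex 0 1 : C) != 0)).
  by rewrite eq_complex /= oner_eq0 andbF.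
have -> : Complex 0 1 * (2 * ((sin (dotp a x))%:C * S)) = (u - conjc u) * S.
  by rewrite -sE; ring.
have -> : Complex 0 1 * (2 * (Complex 0 1 * ((1 - cos (dotp a x))%:C * T))) =
    - (2 - u - conjc u) * T.
  by rewrite -cE' -[-_]mul1r -[1 in RHS]opprK -i2; ring.
have -> : u - conjc u = u * (1 - conjc u) * (1 + conjc u).
  have -> : u * (1 - conjc u) * (1 + conjc u) = u - u * conjc u * conjc u by ring.
  by rewrite uu mul1r.
rewrite -mulrA ST.
have -> : - (2 - u - conjc u) = u * (1 - conjc u) * (1 - conjc u); last by ring.
have -> : u * (1 - conjc u) * (1 - conjc u) = u - 2 * (u * conjc u) + (u * conjc u) * conjc u.
  by ring.
by rewrite uu; ring.
Qed.

End RootTermExp.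

(** * Regularised weight and self-adjointness *)

Section Lattice.
Context {R : realType} {r : nat} (rs : seq 'rV[R]_r) (b : 'I_r -> 'rV[R]_r).
Local Notation E := 'rV[R]_r.
Hypothesis rsP : root_system rs.
Hypothesis bP : zbasis_Qvee rs b.

Lemma coroot_basis_spans (v : E) :
  exists u : nat -> R, v = (2 * pi) *: \sum_(i < r) u i *: b i.
Proof.
pose sp (v : E) := exists u : 'I_r -> R, v = \sum_i u i *: b i.
have spD x y : sp x -> sp y -> sp (x + y).
  move=> [s ->] [t ->]; exists (fun i => s i + t i).
  by rewrite -big_split; apply: eq_bigr => i _; rewrite scalerDl.
have spZ c x : sp x -> sp (c *: x).
  move=> [s ->]; exists (fun i => c * s i).
  by rewrite scaler_sumr; apply: eq_bigr => i _; rewrite scalerA.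
have sp0 : sp 0 by exists (fun=> 0); rewrite big1// => i _; rewrite scale0r.
have sp_root a : a \in rs -> sp a.
  move=> ars; have : Qvee rs (coroot a).
    exists (fun c => (c == a)%:Z); have [rsu _ _ _ _] := rsP.
    rewrite (bigD1_seq a)//= eqxx scale1r big1 ?addr0// => c /negbTE ->.
    by rewrite scale0r.
  move=> /bP[z zE]; have a0 := root_neq0 rsP ars.
  have -> : a = (dotp a a / 2) *: coroot a.
    have aa : dotp a a != 0 by rewrite dotp_eq0.
    rewrite /coroot scalerA (_ : _ * _ = 1) ?scale1r//; by field.
  by apply: spZ; exists (fun i => (z i)%:~R).
have [u uE] : sp v.
  have : v \in <<rs>>%VS by case: rsP => _ _ -> _ _; rewrite memvf.
  move=> /(@coord_span _ _ _ (in_tuple rs)) ->.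
  elim/big_ind: _ => // i _; apply: spZ; apply: sp_root; exact: mem_nth.
have pi2 : 2 * pi != 0 :> R by rewrite mulf_neq0 ?pnatr_eq0// gt_eqF// pi_gt0.
exists (fun n => (2 * pi)^-1 * oapp u 0 (insub n)); rewrite uE scaler_sumr.
apply: eq_bigr => i _; rewrite valK /= scalerA mulrA divff// mul1r.
by [].
Qed.

Lemma weight_coroot_basis mu i : weight rs mu -> dotp mu (b i) \is a Num.int.
Proof.
move=> wmu; have : Qvee rs (b i).
  apply/bP; exists (fun j => (j == i)%:Z).
  rewrite (bigD1 i)//= eqxx scale1r big1 ?addr0// => j /negbTE ->.
  by rewrite scale0r.
move=> [z ->]; rewrite dotp_sumr big_seq rpred_sum// => a ars.
by rewrite dotpZr rpredM ?rpred_int// wmu.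
Qed.

Let torus_trig (f : R -> R) mu : weight rs mu -> ucb near_rv (fun x => f (dotp mu x)) ->
  (forall t (z : int), f (t + 2 * pi * z%:~R) = f t) ->
  torus_class b (fun x => f (dotp mu x)).
Proof.
move=> wmu uf pf; split=> // x i; have /intrP[z zE] := weight_coroot_basis i wmu.
by rewrite dotpDr dotpZr zE pf.
Qed.

Lemma torus_cos mu : weight rs mu -> torus_class b (fun x => cos (dotp mu x)).
Proof. by move=> wmu; apply: (torus_trig wmu (ucb_cos mu)); exact: cos_periodicz. Qed.

Lemma torus_sin mu : weight rs mu -> torus_class b (fun x => sin (dotp mu x)).
Proof. by move=> wmu; apply: (torus_trig wmu (ucb_sin mu)); exact: sin_periodicz. Qed.

End Lattice.

(** * Complex-valued functions on the torus *)

Section ComplexTorus.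
Context {R : realType} {r : nat} (rs : seq 'rV[R]_r) (b : 'I_r -> 'rV[R]_r).
Local Notation E := 'rV[R]_r.
Local Notation C := R[i].
Local Notation "x %:C" := (real_complex R x).
Implicit Types (F G : E -> R) (f k : E -> C).
Hypothesis rsP : root_system rs.
Hypothesis bP : zbasis_Qvee rs b.

Definition ctorus f : Prop :=
  torus_class b (fun x => complex.Re (f x)) /\ torus_class b (fun x => complex.Im (f x)).

Lemma ctorus_ext f k : f =1 k -> ctorus f -> ctorus k.
Proof. by move=> /funext ->. Qed.

Lemma ctorus_real F : torus_class b F -> ctorus (fun x => (F x)%:C).
Proof. by move=> tF; split => //; exact: torus_cst. Qed.

Lemma ctorus_cst z : ctorus (fun=> z).
Proof. by split; exact: torus_cst. Qed.

Lemma ctorusD f k : ctorus f -> ctorus k -> ctorus (fun x => f x + k x).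
Proof.
move=> [f1 f2] [k1 k2]; split.
  rewrite (_ : (fun x => _) = fun x => complex.Re (f x) + complex.Re (k x)).
    exact: torusD.
  by apply/funext => x; case: (f x) => ? ?; case: (k x).
rewrite (_ : (fun x => _) = fun x => complex.Im (f x) + complex.Im (k x)).
  exact: torusD.
by apply/funext => x; case: (f x) => ? ?; case: (k x).
Qed.

Lemma ReM (z w : C) :
  complex.Re (z * w) = complex.Re z * complex.Re w - complex.Im z * complex.Im w.
Proof. by case: z; case: w. Qed.

Lemma ImM (z w : C) :
  complex.Im (z * w) = complex.Re z * complex.Im w + complex.Im z * complex.Re w.
Proof. by case: z; case: w. Qed.

Lemma ctorusM f k : ctorus f -> ctorus k -> ctorus (fun x => f x * k x).
Proof.
move=> [f1 f2] [k1 k2]; split.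
  under eq_fun do rewrite ReM; apply: torusB; exact: torusM.
under eq_fun do rewrite ImM; apply: torusD; exact: torusM.
Qed.

Lemma ctorusN f : ctorus f -> ctorus (fun x => - f x).
Proof.
by move=> /(ctorusM (ctorus_cst (-1))); apply: ctorus_ext => x; rewrite mulN1r.
Qed.

Lemma ctorusB f k : ctorus f -> ctorus k -> ctorus (fun x => f x - k x).
Proof. by move=> tf tk; apply: ctorusD => //; exact: ctorusN. Qed.

Lemma ctorus_conj f : ctorus f -> ctorus (fun x => conjc (f x)).
Proof.
move=> [f1 f2]; split.
  by rewrite (_ : (fun x => _) = fun x => complex.Re (f x))//; apply/funext => x; case: (f x).
rewrite (_ : (fun x => _) = fun x => - complex.Im (f x)); first exact: torusN.
by apply/funext => x; case: (f x).
Qed.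

Lemma ctorus_sum (I : Type) (s : seq I) (P : pred I) (k : I -> E -> C) :
  (forall i, P i -> ctorus (k i)) -> ctorus (fun x => \sum_(i <- s | P i) k i x).
Proof.
move=> tk; elim: s => [|i s IH].
  by apply: ctorus_ext (ctorus_cst 0) => x; rewrite big_nil.
case Pi : (P i); last by apply: ctorus_ext IH => x; rewrite big_cons Pi.
by apply: ctorus_ext (ctorusD (tk i Pi) IH) => x; rewrite big_cons Pi.
Qed.

Lemma ctorus_sum_seq (I : eqType) (s : seq I) (k : I -> E -> C) :
  (forall i, i \in s -> ctorus (k i)) -> ctorus (fun x => \sum_(i <- s) k i x).
Proof.
by move=> tk; under eq_fun do rewrite big_seq; exact: ctorus_sum.
Qed.

Lemma ctorus_ex mu : weight rs mu -> ctorus (fun x => ex mu x).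
Proof. by move=> wmu; split; [exact: (torus_cos bP)|exact: (torus_sin bP)]. Qed.

Lemma torus_intD f k : ctorus f -> ctorus k ->
  torus_int b (fun x => f x + k x) = torus_int b f + torus_int b k.
Proof.
move=> [f1 f2] [k1 k2]; have D1 := tintD f1 k1; have D2 := tintD f2 k2.
rewrite /torus_int; apply/eqP; rewrite eq_complex /=; apply/andP; split; apply/eqP.
  by rewrite -[RHS]D1; congr cube_int; apply/funext => t; case: (f _) => ? ?; case: (k _).
by rewrite -[RHS]D2; congr cube_int; apply/funext => t; case: (f _) => ? ?; case: (k _).
Qed.

Lemma torus_intZ z f : ctorus f -> torus_int b (fun x => z * f x) = z * torus_int b f.
Proof.
move=> [f1 f2]; case: z => u v.
have D1 := tintB (torusZ u f1) (torusZ v f2); rewrite !tintZ// in D1.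
have D2 := tintD (torusZ u f2) (torusZ v f1); rewrite !tintZ// in D2.
rewrite /torus_int; apply/eqP; rewrite eq_complex /=; apply/andP; split; apply/eqP.
  by rewrite -[RHS]D1; congr cube_int; apply/funext => t; rewrite ReM.
by rewrite -[RHS]D2; congr cube_int; apply/funext => t; rewrite ImM.
Qed.

Lemma torus_intB f k : ctorus f -> ctorus k ->
  torus_int b (fun x => f x - k x) = torus_int b f - torus_int b k.
Proof.
move=> tf tk; rewrite -[- torus_int b k]mulN1r -(torus_intZ (-1) tk) -torus_intD//.
  by congr torus_int; apply/funext => x; rewrite mulN1r.
by apply: ctorusM => //; exact: ctorus_cst.
Qed.

Lemma torus_int_conj f : ctorus f ->
  torus_int b (fun x => conjc (f x)) = conjc (torus_int b f).
Proof.
move=> [f1 f2]; have D := tintN f2.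
rewrite /torus_int; apply/eqP; rewrite eq_complex /=; apply/andP; split; apply/eqP.
  by congr cube_int; apply/funext => t; case: (f _).
by rewrite -[RHS]D; congr cube_int; apply/funext => t; case: (f _).
Qed.

Lemma torus_int_sum (I : eqType) (s : seq I) (k : I -> E -> C) :
  (forall i, i \in s -> ctorus (k i)) ->
  torus_int b (fun x => \sum_(i <- s) k i x) = \sum_(i <- s) torus_int b (k i).
Proof.
elim: s => [_|i s IH tk].
  under [in LHS]eq_fun do rewrite big_nil -(mul0r 0).
  by rewrite torus_intZ ?mul0r ?big_nil//; exact: ctorus_cst.
under [in LHS]eq_fun do rewrite big_cons.
rewrite torus_intD ?big_cons ?IH//.
- by move=> j js; apply: tk; rewrite in_cons js orbT.
- by apply: tk; rewrite mem_head.
- by apply: ctorus_sum_seq => j js; apply: tk; rewrite in_cons js orbT.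
Qed.

Lemma torus_int_cst (z : C) : torus_int b (fun=> z) = z.
Proof. by rewrite /torus_int !cube_int_cst; case: z. Qed.

(** Translation by [v], chosen so that [ex eta v = -1], shows that the integral equals its
    opposite. *)
Lemma torus_int_ex eta : weight rs eta -> eta != 0 -> torus_int b (fun x => ex eta x) = 0.
Proof.
move=> weta eta0; pose v := (pi / dotp eta eta) *: eta.
have shift : torus_int b (fun x => ex eta (x + v)) = torus_int b (fun x => ex eta x).
  have [t1 t2] := ctorus_ex weta; have spans := coroot_basis_spans rsP bP.
  rewrite /torus_int; congr Complex.
    exact: (tint_shift spans v t1).
  exact: (tint_shift spans v t2).
have exv : ex eta v = -1.
  rewrite /ex /v dotpZr divfK ?dotp_eq0// /expi cospi sinpi.
  by apply/eqP; rewrite eq_complex /= oppr0 !eqxx.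
move: shift; under [in LHS]eq_fun do rewrite exDr exv mulrC.
rewrite torus_intZ; last exact: ctorus_ex.
rewrite mulN1r => /eqP; rewrite eq_sym -subr_eq0 opprK -mulr2n -mulr_natl mulf_eq0.
by rewrite pnatr_eq0 => /eqP.
Qed.

Lemma is_derive_line (xi eta x : E) (f : R -> R) (df : R) :
  is_derive (dotp eta x) 1 f df ->
  is_derive (0 : R) 1 (fun s : R => f (dotp eta (x + s *: xi))) (df * dotp eta xi).
Proof.
move=> dfx; have -> : (fun s : R => f (dotp eta (x + s *: xi))) =
    f \o (fun s => s * dotp eta xi + dotp eta x).
  by apply/funext => s /=; rewrite dotpDr dotpZr addrC.
apply: is_derive1_comp; first by rewrite mul0r add0r.
have dl := is_deriveD (is_deriveM (is_derive_id (0 : R) 1) (is_derive_cst (dotp eta xi) (0 : R) 1))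
  (is_derive_cst (dotp eta x) (0 : R) 1).
by apply: is_derive_eq dl _; rewrite addr0 scaler0 add0r /GRing.scale /= mulr1.
Qed.

(** The integrand is the derivative of [ex eta * G] in the direction [xi], so this is integration by
    parts on the torus. *)
Lemma torus_int_derivative (eta xi : E) G G' : weight rs eta -> torus_class b G ->
  torus_class b G' ->
  (forall x, is_derive (0 : R) 1 (fun s : R => G (x + s *: xi)) (G' x)) ->
  torus_int b (fun x => Complex 0 (dotp eta xi) * ex eta x * (G x)%:C +
     ex eta x * (G' x)%:C) = 0.
Proof.
move=> weta tG tG' dG; have tc := torus_cos bP weta; have ts := torus_sin bP weta.
have spans := coroot_basis_spans rsP bP.
have D (f df : R -> R) (x : E) (fE : forall y : R, is_derive y 1 f (df y)) :
    is_derive (0 : R) 1 (fun s : R => f (dotp eta (x + s *: xi)) * G (x + s *: xi))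
      (df (dotp eta x) * dotp eta xi * G x + f (dotp eta x) * G' x).
  have d1 : is_derive (0 : R) 1 (fun s : R => f (dotp eta (x + s *: xi)))
      (df (dotp eta x) * dotp eta xi) by exact: is_derive_line.
  apply: is_derive_eq (is_deriveM d1 (dG x)) _.
  by rewrite scale0r addr0 /GRing.scale /= addrC mulrC; congr (_ + _); rewrite mulrC.
rewrite /torus_int; apply/eqP; rewrite eq_complex /=; apply/andP; split; apply/eqP.
  rewrite -[RHS](@tint_derivative _ _ _ spans xi (fun x => cos (dotp eta x) * G x)
     (fun x => - sin (dotp eta x) * dotp eta xi * G x + cos (dotp eta x) * G' x)).
  - congr cube_int; apply/funext => t; rewrite /ex /expi /=; ring.
  - exact: torusM.
  - apply: torusD; apply: torusM => //; apply: torusM; last exact: torus_cst.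
    exact: torusN.
  - by move=> x; apply: (D cos (fun y => - sin y)).
rewrite -[RHS](@tint_derivative _ _ _ spans xi (fun x => sin (dotp eta x) * G x)
     (fun x => cos (dotp eta x) * dotp eta xi * G x + sin (dotp eta x) * G' x)).
- congr cube_int; apply/funext => t; rewrite /ex /expi /=; ring.
- exact: torusM.
- by apply: torusD; apply: torusM => //; apply: torusM; last exact: torus_cst.
Qed.

End ComplexTorus.

(** * Uniform limits and the regularised weight *)

Section UniformLimit.
Context {R : realType} {T : Type}.
Implicit Types (F G : T -> R) (Fe Ge : R -> T -> R).

Definition ulim Fe F : Prop := forall e : R, 0 < e -> exists2 d : R, 0 < d &
  forall t, 0 < t < d -> forall x, `|Fe t x - F x| <= e.

Definition bounded_fun F : Prop := exists M : R, forall x, `|F x| <= M.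

Lemma ulim_ext Fe Ge F G : (forall t, Fe t =1 Ge t) -> F =1 G -> ulim Fe F -> ulim Ge G.
Proof.
move=> FG /funext <-; have -> // : Fe = Ge.
by apply/funext => t; apply/funext => x; exact: FG.
Qed.

Lemma ulim_cst F : ulim (fun=> F) F.
Proof.
move=> e e0; exists 1 => // t _ x; rewrite subrr normr0; exact: ltW.
Qed.

Lemma ulimD Fe Ge F G : ulim Fe F -> ulim Ge G ->
  ulim (fun t x => Fe t x + Ge t x) (fun x => F x + G x).
Proof.
move=> uF uG e e0; have e20 : 0 < e / 2 by rewrite divr_gt0.
have [d1 d10 H1] := uF _ e20; have [d2 d20 H2] := uG _ e20.
exists (Num.min d1 d2); first by rewrite lt_min d10.
move=> t /andP[t0]; rewrite lt_min => /andP[t1 t2] x.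
have h1 := H1 t _ x; have h2 := H2 t _ x.
rewrite t0 t1 in h1; rewrite t0 t2 in h2.
have -> : Fe t x + Ge t x - (F x + G x) = (Fe t x - F x) + (Ge t x - G x) by ring.
apply: le_trans (ler_normD _ _) _; have := h1 isT; have := h2 isT; lra.
Qed.

Lemma bounded_funM F G : bounded_fun F -> bounded_fun G -> bounded_fun (fun x => F x * G x).
Proof. by move=> [M HM] [N HN]; exists (M * N) => x; rewrite normrM ler_pM. Qed.

Lemma ulimM Fe Ge F G : bounded_fun F -> bounded_fun G -> ulim Fe F -> ulim Ge G ->
  ulim (fun t x => Fe t x * Ge t x) (fun x => F x * G x).
Proof.
move=> [M HM] [N HN] uF uG e e0.
(* The error is at most [e' * e'] plus [e'] times the two bounds, hence at most [e' * K] because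
   [e' <= 1]. *)
pose K := 1 + `|M| + `|N|; have K0 : 0 < K by rewrite /K; have := normr_ge0 M; have := normr_ge0 N; lra.
pose e' := Num.min 1 (e / K).
have e'0 : 0 < e' by rewrite lt_min ltr01 divr_gt0.
have e'1 : e' <= 1 by rewrite ge_min lexx.
have e'K : e' * K <= e by rewrite -ler_pdivlMr// ge_min lexx orbT.
have [d1 d10 H1] := uF _ e'0; have [d2 d20 H2] := uG _ e'0.
exists (Num.min d1 d2); first by rewrite lt_min d10.
move=> t /andP[t0]; rewrite lt_min => /andP[t1 t2] x.
have h1 : `|Fe t x - F x| <= e' by apply: H1; rewrite t0.
have h2 : `|Ge t x - G x| <= e' by apply: H2; rewrite t0.
have -> : Fe t x * Ge t x - F x * G x =
  (Fe t x - F x) * (Ge t x - G x) + (Fe t x - F x) * G x + F x * (Ge t x - G x) by ring.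
apply: le_trans e'K; have -> : e' * K = e' + e' * `|N| + e' * `|M| by rewrite /K; ring.
apply: le_trans (ler_normD _ _) _; apply: lerD.
  apply: le_trans (ler_normD _ _) _; apply: lerD.
    by rewrite normrM -[X in _ <= X]mulr1 ler_pM// (le_trans h2).
  by rewrite normrM ler_pM// (le_trans (HN x)) ?ler_norm.
by rewrite normrM mulrC ler_pM// (le_trans (HM x)) ?ler_norm.
Qed.

Lemma ulim_prod (I : Type) (s : seq I) (P : pred I) (Fe : I -> R -> T -> R) (F : I -> T -> R) :
  (forall i, bounded_fun (F i)) -> (forall i, P i -> ulim (Fe i) (F i)) ->
  bounded_fun (fun x => \prod_(i <- s | P i) F i x) /\
  ulim (fun t x => \prod_(i <- s | P i) Fe i t x) (fun x => \prod_(i <- s | P i) F i x).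
Proof.
move=> bF uF; elim: s => [|i s [IHb IH]].
  split; first by exists 1 => x; rewrite big_nil normr1.
  by apply: ulim_ext (ulim_cst (fun=> 1)) => [t x|x]; rewrite big_nil.
case Pi : (P i); last first.
  split; first by under eq_fun do rewrite big_cons Pi.
  by apply: ulim_ext IH => [t x|x]; rewrite big_cons Pi.
split; first by under eq_fun do rewrite big_cons Pi; exact: bounded_funM.
by apply: ulim_ext (ulimM (bF i) IHb (uF i Pi) IH) => [t x|x]; rewrite big_cons Pi.
Qed.

End UniformLimit.

Section WeightFunction.
Context {R : realType} {r : nat} (rs : seq 'rV[R]_r) (g : 'rV[R]_r -> R) (b : 'I_r -> 'rV[R]_r).
Local Notation E := 'rV[R]_r.
Implicit Types (a x xi : E) (c : R).
Hypothesis rsP : root_system rs.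
Hypothesis bP : zbasis_Qvee rs b.
Hypothesis g_ge0 : forall a, a \in rs -> 0 <= g a.

(** The absolute value extends the power to a function continuous on the whole line, as [torus_comp]
    requires. For [c = 0] it is constant, because [powR 0 0 = 1]. *)
Lemma powR_norm_continuous c : 0 <= c -> continuous (fun u : R => powR `|u| c).
Proof.
rewrite le_eqVlt => /orP[/eqP <- u|c0 u].
  by under eq_fun do rewrite powRr0; exact: cvg_cst.
have [->|u0] := eqVneq u 0.
  apply/cvgrPdist_lt => e e0; rewrite normr0 powR0 ?gt_eqF//.
  have /cvgrPdist_lt /(_ e e0) := powR_cvg0 c0.
  move=> [d /= d0 Hd]; apply/nbhs_ballP; exists d => //= v.
  rewrite /ball/= sub0r normrN => vd.
  have [->|v0] := eqVneq v 0; first by rewrite normr0 powR0 ?gt_eqF// subrr normr0.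
  by apply: Hd; rewrite /= ?sub0r ?normrN ?normr_id ?normr_gt0.
apply: (@continuous_comp _ _ _ (fun u : R => `|u|) (fun v => powR v c)).
  exact: norm_continuous.
have [d _] : is_derive `|u| 1 (fun v => powR v c) (c * powR `|u| (c - 1)).
  by apply: is_derive1_powR; rewrite normr_gt0.
apply: differentiable_continuous; exact/derivable1_diffP.
Qed.

Definition reg_weight (t : R) x : R := \prod_(a <- rs) powR (chord2 a x + t) (g a / 2).

Lemma DeltaHO_reg x : DeltaHO rs g x = reg_weight 0 x.
Proof. by apply: eq_bigr => a _; rewrite normc_powR addr0. Qed.

Lemma DeltaHO_ge0 x : 0 <= DeltaHO rs g x.
Proof. by apply: prodr_ge0 => a _; exact: powR_ge0. Qed.

Lemma DeltaHO_eq0 x : DeltaHO rs g x = 0 -> \prod_(a <- rs) (1 - ex a x) = 0.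
Proof.
move=> /eqP; rewrite /DeltaHO; elim: rs => [|a s IH]; first by rewrite big_nil oner_eq0.
rewrite !big_cons mulf_eq0 => /orP[|/IH ->]; last by rewrite mulr0.
rewrite powR_eq0 => /andP[/eqP H _].
by rewrite (Normc.eq0_normc H) mul0r.
Qed.

Lemma torus_chord2 a : a \in rs -> torus_class b (chord2 a).
Proof.
move=> ars; apply: torusB; first exact: torus_cst.
by apply: torusZ; apply: (torus_cos bP); exact: weight_root.
Qed.

Lemma torus_chord2D a t : a \in rs -> torus_class b (fun x => chord2 a x + t).
Proof. by move=> ars; apply: torusD; [exact: torus_chord2|exact: torus_cst]. Qed.

Lemma torus_powR a t : a \in rs -> 0 <= t ->
  torus_class b (fun x => powR (chord2 a x + t) (g a / 2)).
Proof.
move=> ars t0; have -> : (fun x => powR (chord2 a x + t) (g a / 2)) =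
    (fun x => (fun u => powR `|u| (g a / 2)) (chord2 a x + t)).
  by apply/funext => x; rewrite ger0_norm// addr_ge0// chord2_ge0.
apply: (@torus_comp _ _ _ (fun u => powR `|u| (g a / 2)) _ _ (torus_chord2D t ars)).
by apply: powR_norm_continuous; rewrite divr_ge0// g_ge0.
Qed.

Lemma torus_reg_weight t : 0 <= t -> torus_class b (reg_weight t).
Proof.
move=> t0; rewrite /reg_weight; under eq_fun do rewrite big_seq.
by apply: torus_prod => a ars; exact: torus_powR.
Qed.

Lemma torus_DeltaHO : torus_class b (DeltaHO rs g).
Proof. by rewrite (funext DeltaHO_reg); exact: torus_reg_weight. Qed.

Lemma torus_chord2V a t : a \in rs -> 0 < t -> torus_class b (fun x => (chord2 a x + t)^-1).
Proof.
move=> ars t0; have -> : (fun x => (chord2 a x + t)^-1) =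
    (fun x => (fun u => (`|u| + t)^-1) (chord2 a x)).
  by apply/funext => x; rewrite ger0_norm// chord2_ge0.
apply: (@torus_comp _ _ _ (fun u => (`|u| + t)^-1) _ _ (torus_chord2 ars)) => u.
apply: cvgV; first by rewrite gt_eqF// ltr_wpDl.
by apply: cvgD; [exact: norm_continuous|exact: cvg_cst].
Qed.

(** Derivatives are given as value times logarithmic derivative, so that logarithmic derivatives add
    without any division. *)
Lemma is_derive_prod (I : Type) (s : seq I) (F : I -> R -> R) (L : I -> R) :
  (forall i, is_derive (0 : R) 1 (F i) (F i 0 * L i)) ->
  is_derive (0 : R) 1 (fun u => \prod_(i <- s) F i u)
    ((\prod_(i <- s) F i 0) * \sum_(i <- s) L i).
Proof.
move=> dF; elim: s => [|i s IH].
  under eq_fun do rewrite big_nil; rewrite !big_nil mulr0.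
  exact: is_derive_cst.
under eq_fun do rewrite big_cons; rewrite !big_cons.
apply: is_derive_eq (is_deriveM (dF i) IH) _.
by rewrite /GRing.scale /=; ring.
Qed.

Lemma is_derive_reg_weight t xi x : 0 < t ->
  is_derive (0 : R) 1 (fun u : R => reg_weight t (x + u *: xi))
   (reg_weight t x * \sum_(a <- rs) g a * sin (dotp a x) * dotp a xi / (chord2 a x + t)).
Proof.
move=> t0; have -> : reg_weight t x = \prod_(a <- rs)
    (fun u : R => powR (chord2 a (x + u *: xi) + t) (g a / 2)) 0.
  by apply: eq_bigr => a _; rewrite scale0r addr0.
apply: (@is_derive_prod _ rs (fun a (u : R) => powR (chord2 a (x + u *: xi) + t) (g a / 2))
  (fun a => g a * sin (dotp a x) * dotp a xi / (chord2 a x + t))) => a.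
have Dt0 : 0 < chord2 a x + t by rewrite ltr_wpDl// chord2_ge0.
pose f (y : R) := powR (2 - 2 * cos y + t) (g a / 2).
have df : is_derive (dotp a x) 1 f
    (g a / 2 * powR (chord2 a x + t) (g a / 2 - 1) * (2 * sin (dotp a x))).
  have d1 := is_derive_cos (dotp a x).
  have d2 := is_deriveB (is_derive_cst (2 + t) (dotp a x) 1) (is_deriveZ 2 d1).
  have -> : f = (fun v => powR v (g a / 2)) \o (cst (2 + t) - 2 \*: (@cos R)).
    apply/funext => y; rewrite /f /=; congr powR.
    by rewrite !fctE /= /GRing.scale /=; ring.
  apply: is_derive1_comp; last first.
    by apply: is_derive_eq d2 _; rewrite sub0r /GRing.scale /=; ring.
  have -> : (cst (2 + t) - 2 \*: (@cos R)) (dotp a x) = chord2 a x + t.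
    by rewrite !fctE /= /chord2 /GRing.scale /=; ring.
  exact: is_derive1_powR.
have := is_derive_line xi df; rewrite /f /=.
rewrite scale0r addr0 => H; apply: is_derive_eq H _.
have Dt_neq0 : chord2 a x + t != 0 by rewrite gt_eqF.
rewrite powRB; last by rewrite Dt_neq0 implybT.
by rewrite powRr1 ?(ltW Dt0)//; field.
Qed.

Lemma ulim_powR a c : 0 <= c ->
  ulim (fun t x => powR (chord2 a x + t) c) (fun x => powR (chord2 a x) c).
Proof.
move=> c0 e e0; have [d d0 Hd] := continuous_unif_segment 4 (powR_norm_continuous c0) e0.
exists d => // t /andP[t0 td] x.
have D0 := chord2_ge0 a x; have D4 := chord2_le4 a x.
have := Hd (chord2 a x) (chord2 a x + t).
rewrite opprD addrA subrr add0r normrN (gtr0_norm t0) (ger0_norm D0).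
rewrite (ger0_norm (addr_ge0 D0 (ltW t0))) => /(_ D4 td).
by rewrite distrC => /ltW.
Qed.

Lemma bounded_powR a c : 0 <= c -> bounded_fun (fun x => powR (chord2 a x) c).
Proof.
move=> c0; exists (powR 4 c) => x; rewrite ger0_norm ?powR_ge0//.
by apply: ge0_ler_powR; rewrite ?nnegrE ?chord2_ge0 ?chord2_le4.
Qed.

(** The error is [(chord2 + t)^c] times [t / (chord2 + t)]. Where [chord2 + t] is small the power is
    small, which needs [c > 0]; elsewhere the ratio is at most [t / d] and the power is bounded. *)
Lemma ulim_powR_ratio a c : 0 < c ->
  ulim (fun t x => powR (chord2 a x + t) c * (chord2 a x / (chord2 a x + t)))
    (fun x => powR (chord2 a x) c).
Proof.
move=> c0; suff H : ulim (fun t x => powR (chord2 a x + t) c * (t / (chord2 a x + t)))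
    (fun=> 0).
  have Hn : ulim (fun t x => - 1 * (powR (chord2 a x + t) c * (t / (chord2 a x + t))))
      (fun=> - 1 * 0).
    apply: ulimM (ulim_cst _) H; first by exists 1 => x; rewrite normrN1.
    by exists 0 => x; rewrite normr0.
  move=> e e0; have [d d0 Hd] := ulimD (ulim_powR a (ltW c0)) Hn e0.
  exists d => // t td x; have := Hd t td x; rewrite mulr0 addr0.
  suff -> : powR (chord2 a x + t) c + -1 * (powR (chord2 a x + t) c * (t / (chord2 a x + t))) =
     powR (chord2 a x + t) c * (chord2 a x / (chord2 a x + t)) by [].
  have : chord2 a x + t != 0.
    by move: td => /andP[t0 _]; rewrite gt_eqF// ltr_wpDl// chord2_ge0.
  by move=> ?; field.
move=> e e0; have [d d0 Hd] := continuous_unif_segment 0 (powR_norm_continuous (ltW c0)) e0.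
(* Here [5] bounds [chord2 + t], as [chord2 <= 4] and [t < 1]. *)
pose M := powR 5 c; have M0 : 0 < M by rewrite powR_gt0.
exists (Num.min 1 (e * d / M)); first by rewrite lt_min ltr01 divr_gt0// mulr_gt0.
move=> t /andP[t0]; rewrite lt_min => /andP[t1]; rewrite ltr_pdivlMr// => tM x.
have D0 := chord2_ge0 a x; have D4 := chord2_le4 a x.
set D := chord2 a x in D0 D4 *.
have Dt : 0 < D + t by lra.
rewrite subr0 ger0_norm; last by rewrite mulr_ge0 ?powR_ge0// divr_ge0// ltW.
have [Dd|dD] := ltP (D + t) d.
  have := Hd 0 (D + t); rewrite normr0 lexx sub0r normrN (gtr0_norm Dt) => /(_ isT Dd).
  rewrite powR0 ?gt_eqF// sub0r normrN ger0_norm ?powR_ge0// => /ltW H.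
  rewrite -[e]mulr1 ler_pM ?powR_ge0//; first by rewrite divr_ge0// ltW.
  by rewrite ler_pdivrMr// mul1r; lra.
have H1 : powR (D + t) c <= M.
  by apply: ge0_ler_powR; rewrite ?nnegrE; lra.
apply: (@le_trans _ _ (M * (t / d))).
  rewrite ler_pM ?powR_ge0//; first by rewrite divr_ge0// ltW.
  by rewrite ler_pM2l// lef_pV2.
by rewrite mulrA ler_pdivrMr// mulrC ltW.
Qed.

Lemma torus_bounded F : torus_class b F -> bounded_fun F.
Proof. by case=> [[]]. Qed.

(** The condition on [Q] covers the roots with [g a = 0]: their weight factor is constant and cannot
    compensate the ratio [chord2 / (chord2 + t)]. *)
Lemma reg_weight_limit (P : E -> R) (Q : E -> E -> R) : torus_class b P ->
  (forall a, a \in rs -> torus_class b (Q a)) ->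
  (forall a x, a \in rs -> g a = 0 -> Q a x = 0) ->
  (forall t, 0 < t -> tint b (fun x => reg_weight t x *
     (P x + \sum_(a <- rs) chord2 a x / (chord2 a x + t) * Q a x)) = 0) ->
  tint b (fun x => reg_weight 0 x * (P x + \sum_(a <- rs) Q a x)) = 0.
Proof.
move=> tP tQ Q0 It.
pose Ft t x := reg_weight t x *
     (P x + \sum_(a <- rs) chord2 a x / (chord2 a x + t) * Q a x).
pose F x := reg_weight 0 x * (P x + \sum_(a <- rs) Q a x).
have tF : torus_class b F.
  apply: torusM; first exact: torus_reg_weight.
  by apply: torusD => //; under eq_fun do rewrite big_seq; exact: torus_sum.
have tFt t : 0 < t -> torus_class b (Ft t).
  move=> t0; apply: torusM; first by apply: torus_reg_weight; exact: ltW.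
  apply: torusD => //; under eq_fun do rewrite big_seq; apply: torus_sum => a ars.
  apply: torusM; last exact: tQ.
  by apply: torusM; [exact: torus_chord2|exact: torus_chord2V].
have [rsu _ _ _ _] := rsP.
(* Extending [g] by zero makes all exponents nonnegative, since [ulim_prod] asks for bounded factors
   at every index and not only at the roots. *)
pose ga a := if a \in rs then g a else 0.
have ga0 a : 0 <= ga a / 2 by rewrite divr_ge0// /ga; case: ifP => // /g_ge0.
have wE t x : reg_weight t x = \prod_(a <- rs) powR (chord2 a x + t) (ga a / 2).
  rewrite /reg_weight big_seq [RHS]big_seq; apply: eq_bigr => a ars.
  by rewrite /ga ars.
have bw a : bounded_fun (fun x : E => powR (chord2 a x + 0) (ga a / 2)).
  by under eq_fun do rewrite addr0; exact: bounded_powR.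
have uw a : ulim (fun t x => powR (chord2 a x + t) (ga a / 2))
    (fun x : E => powR (chord2 a x + 0) (ga a / 2)).
  by under [X in ulim _ X]eq_fun do rewrite addr0; exact: ulim_powR.
have uF : ulim Ft F.
  apply: (@ulim_ext _ _ (fun t x => reg_weight t x * P x +
    \sum_(a <- rs) reg_weight t x * (chord2 a x / (chord2 a x + t) * Q a x)) _
    (fun x => reg_weight 0 x * P x + \sum_(a <- rs) reg_weight 0 x * Q a x)).
  - by move=> t x; rewrite /Ft mulrDr mulr_sumr.
  - by move=> x; rewrite /F mulrDr mulr_sumr.
  apply: ulimD.
    apply: ulimM (ulim_cst _); first exact: torus_bounded (torus_reg_weight (lexx 0)).
      exact: torus_bounded.
    have [_] := @ulim_prod _ _ _ rs xpredT _ _ bw (fun a _ => uw a).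
    by apply: ulim_ext => [t x|x]; rewrite wE.
  have sum_seq s : {subset s <= rs} -> ulim (fun t x => \sum_(a <- s)
      reg_weight t x * (chord2 a x / (chord2 a x + t) * Q a x))
      (fun x => \sum_(a <- s) reg_weight 0 x * Q a x).
    elim: s => [_|a s IH sub].
      by apply: ulim_ext (ulim_cst (fun=> 0)) => [t x|x]; rewrite big_nil.
    apply: (@ulim_ext _ _ (fun t x => reg_weight t x * (chord2 a x / (chord2 a x + t) * Q a x) +
       \sum_(a <- s) reg_weight t x * (chord2 a x / (chord2 a x + t) * Q a x)) _
       (fun x => reg_weight 0 x * Q a x + \sum_(a <- s) reg_weight 0 x * Q a x)).
    - by move=> t x; rewrite big_cons.
    - by move=> x; rewrite big_cons.
    have ars : a \in rs by apply: sub; rewrite mem_head.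
    apply: ulimD; last by apply: IH => v vs; apply: sub; rewrite in_cons vs orbT.
    have [ga_eq0|ga_neq0] := eqVneq (g a) 0.
      by apply: ulim_ext (ulim_cst (fun=> 0)) => [t x|x]; rewrite Q0// !mulr0.
    have ga_gt0 : 0 < ga a / 2 by rewrite divr_gt0// /ga ars lt_def ga_neq0 g_ge0.
    (* The factor of [a] is split off the product so that the ratio meets the power vanishing on the
       same wall. *)
    have [bp up] := @ulim_prod _ _ _ rs (fun v => v != a) _ _ bw (fun v _ => uw v).
    apply: (@ulim_ext _ _ (fun t x =>
      (powR (chord2 a x + t) (ga a / 2) * (chord2 a x / (chord2 a x + t))) *
      ((\prod_(v <- rs | v != a) powR (chord2 v x + t) (ga v / 2)) * Q a x)) _
      (fun x => powR (chord2 a x) (ga a / 2) *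
      ((\prod_(v <- rs | v != a) powR (chord2 v x + 0) (ga v / 2)) * Q a x))).
    - by move=> t x; rewrite wE (bigD1_seq a)//=; ring.
    - by move=> x; rewrite wE (bigD1_seq a)//= addr0; ring.
    have bQ := torus_bounded (tQ a ars).
    apply: ulimM; [exact: bounded_powR|exact: bounded_funM|exact: ulim_powR_ratio|].
    by apply: ulimM => //; exact: ulim_cst.
  exact: sum_seq.
apply/eqP; rewrite -normr_le0; apply/ler_addgt0Pr => e e0; rewrite add0r.
have [d d0 Hd] := uF e e0.
have t0 : 0 < d / 2 by rewrite divr_gt0.
have -> : tint b F = - tint b (fun x => Ft (d / 2) x - F x).
  by rewrite tintB ?It ?sub0r ?opprK//; exact: tFt.
rewrite normrN; apply: tint_bound.
  by apply: torusB => //; exact: tFt.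
by apply: Hd; rewrite t0; lra.
Qed.

End WeightFunction.

(** * The Laplacian and its Dirichlet form *)

Section SelfAdjoint.
Context {R : realType} {r : nat} (rs : seq 'rV[R]_r) (g : 'rV[R]_r -> R)
  (b : 'I_r -> 'rV[R]_r).
Local Notation E := 'rV[R]_r.
Local Notation C := R[i].
Local Notation "x %:C" := (real_complex R x).
Local Notation iC := (Complex 0 1 : C).
Implicit Types (a x y z mu nu lam : E).
Hypothesis rsP : root_system rs.
Hypothesis bP : zbasis_Qvee rs b.
Hypothesis g_ge0 : forall a, a \in rs -> 0 <= g a.
Local Notation L mu x := (laplacian rs g (fun v => ex v x) mu).
Local Notation m mu x := (\sum_(y <- oseq rs mu) ex y x).
Local Notation wt x := ((DeltaHO rs g x)%:C).

Let weight_ex y : weight rs y -> ctorus b (fun x => ex y x).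
Proof. exact: (ctorus_ex bP). Qed.

Let ctorus_wt : ctorus b (fun x => wt x).
Proof. by apply: ctorus_real; exact: torus_DeltaHO. Qed.

Let ctorus_scale (z0 : C) (f : E -> C) : ctorus b f -> ctorus b (fun x => z0 * f x).
Proof. by apply: ctorusM; exact: ctorus_cst. Qed.

Lemma ctorus_msym mu : weight rs mu -> ctorus b (fun x => m mu x).
Proof.
by move=> wmu; apply: ctorus_sum_seq => y yo; apply/weight_ex/weight_oseq/yo.
Qed.

Let ctorus_root_term mu a : weight rs mu -> a \in rs ->
  ctorus b (fun x => root_term rs (fun v => ex v x) mu a).
Proof.
move=> wmu ars; have wa := weight_root rsP ars.
apply: ctorus_sum_seq => y yo; apply: ctorus_scale; apply: ctorus_sum => l _.
have wy := weight_oseq rsP wmu yo.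
by apply: ctorusD; apply: weight_ex; apply: weightD => //; apply: weightN; exact: weightZn.
Qed.

Lemma ctorus_laplacian mu : weight rs mu -> ctorus b (fun x => L mu x).
Proof.
move=> wmu; apply: ctorusD; first by apply: ctorus_scale; exact: ctorus_msym.
apply: ctorus_scale; apply: ctorus_sum_seq => a ars; apply: ctorus_scale.
exact: ctorus_root_term.
Qed.

Section Form.
Variables (mu nu : E).
Hypotheses (wmu : weight rs mu) (wnu : weight rs nu).

Let A x : C := \sum_(y <- oseq rs mu) (dotp (y - nu) y)%:C * ex (y - nu) x.
Let B a x : C := 2^-1 * ((g a)%:C * root_term rs (fun v => ex v x) mu a) * conjc (ex nu x).

Let weight_diff y : y \in oseq rs mu -> weight rs (y - nu).
Proof. by move=> yo; apply: weightD; [exact: weight_oseq yo|exact: weightN]. Qed.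

Let ctorusA : ctorus b A.
Proof.
by apply: ctorus_sum_seq => y yo; apply: ctorus_scale; apply/weight_ex/weight_diff.
Qed.

Let ctorusB a : a \in rs -> ctorus b (B a).
Proof.
move=> ars; apply: ctorusM; last by apply: ctorus_conj; exact: weight_ex.
by do 2 apply: ctorus_scale; exact: ctorus_root_term.
Qed.

Let deriv_weight t y x : R := reg_weight rs g t x *
  \sum_(a <- rs) g a * sin (dotp a x) * dotp a y / (chord2 a x + t).

Let torus_deriv_weight t y : 0 < t -> torus_class b (deriv_weight t y).
Proof.
move=> t0; apply: torusM; first by apply: torus_reg_weight => //; exact: ltW.
under eq_fun do rewrite big_seq; apply: torus_sum => a ars.
apply: torusM; last exact: (torus_chord2V rsP).
apply: torusM; last exact: torus_cst.
by apply: torusZ; apply: (torus_sin bP); exact: weight_root.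
Qed.

(** For each [y] of the orbit, [e^(y - nu)] times the weight is differentiated in the direction [y]
    itself. The derivatives of the exponentials sum to [A]; those of the weight contain the sine sum
    of [root_term_ex], which turns them into the terms [B a], as [1 - cos] is half of [chord2]. *)
Let integrandE t x : 0 < t ->
  \sum_(y <- oseq rs mu) (Complex 0 (dotp (y - nu) y) * ex (y - nu) x * (reg_weight rs g t x)%:C +
     ex (y - nu) x * (deriv_weight t y x)%:C) =
  iC * ((reg_weight rs g t x)%:C *
     (A x + \sum_(a <- rs) (chord2 a x / (chord2 a x + t))%:C * B a x)).
Proof.
move=> t0; set G := reg_weight rs g t x.
rewrite big_split /= mulrDr mulrDr; congr (_ + _).
  rewrite /A mulr_sumr mulr_sumr; apply: eq_bigr => y _.
  have -> : Complex 0 (dotp (y - nu) y) = iC * (dotp (y - nu) y)%:C.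
    by apply/eqP; rewrite eq_complex /=; apply/andP; split; apply/eqP; ring.
  by ring.
rewrite /B; set cn := conjc (ex nu x).
have -> : \sum_(y <- oseq rs mu) ex (y - nu) x * (deriv_weight t y x)%:C =
    G%:C * (\sum_(a <- rs) (g a / (chord2 a x + t))%:C * cn *
      ((sin (dotp a x))%:C * \sum_(y <- oseq rs mu) (dotp y a)%:C * ex y x)).
  under [in RHS]eq_bigr do rewrite mulr_sumr mulr_sumr.
  rewrite exchange_big /= mulr_sumr; apply: eq_bigr => y _.
  rewrite /deriv_weight rmorphM -/G rmorph_sum mulrCA mulr_sumr; congr (_ * _).
  apply: eq_bigr => a _; rewrite exD exN -/cn (dotpC y a) !rmorphM; ring.
rewrite mulrCA; congr (_ * _); rewrite mulr_sumr big_seq [RHS]big_seq.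
apply: eq_bigr => a ars; rewrite (root_term_ex rsP)//.
have -> : (1 - cos (dotp a x))%:C = (chord2 a x)%:C / 2.
  have -> : 1 - cos (dotp a x) = chord2 a x / 2 by rewrite /chord2; field.
  by rewrite rmorphM fmorphV rmorph_nat.
rewrite !rmorphM; ring.
Qed.

Let form_reg t : 0 < t -> torus_int b (fun x => (reg_weight rs g t x)%:C *
     (A x + \sum_(a <- rs) (chord2 a x / (chord2 a x + t))%:C * B a x)) = 0.
Proof.
move=> t0; have i0 : iC != 0 by rewrite eq_complex /= oner_eq0 andbF.
have tG := torus_reg_weight rsP bP g_ge0 (ltW t0).
apply: (mulfI i0); rewrite mulr0 -torus_intZ; last first.
  apply: ctorusM; first exact: ctorus_real.
  apply: ctorusD => //; apply: ctorus_sum_seq => a ars; apply: ctorusM; last exact: ctorusB.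
  have tr : torus_class b (fun x => chord2 a x / (chord2 a x + t)).
    by apply: torusM; [exact: (torus_chord2 rsP)|exact: (torus_chord2V rsP)].
  exact: (ctorus_real tr).
under eq_fun do rewrite -integrandE//.
rewrite torus_int_sum; last first.
  move=> y yo; apply: ctorusD; apply: ctorusM.
  - by apply: ctorus_scale; apply/weight_ex/weight_diff.
  - exact: ctorus_real.
  - by apply/weight_ex/weight_diff.
  - by apply: ctorus_real; exact: torus_deriv_weight.
rewrite big_seq big1// => y yo.
apply: (torus_int_derivative rsP bP (weight_diff yo) tG (torus_deriv_weight y t0)).
by move=> x; exact: is_derive_reg_weight.
Qed.

Let form_limit : torus_int b (fun x => (reg_weight rs g 0 x)%:C *
     (A x + \sum_(a <- rs) B a x)) = 0.
Proof.
have B0 a x : a \in rs -> g a = 0 -> B a x = 0.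
  by move=> _ ga0; rewrite /B ga0 rmorph0 mul0r mulr0 mul0r.
have ReS (f : E -> C) s : complex.Re (\sum_(a <- s) f a) = \sum_(a <- s) complex.Re (f a).
  by elim: s => [|a s IH]; rewrite ?big_nil// !big_cons -IH; case: (f a); case: (\sum_(_ <- _) _).
have ImS (f : E -> C) s : complex.Im (\sum_(a <- s) f a) = \sum_(a <- s) complex.Im (f a).
  by elim: s => [|a s IH]; rewrite ?big_nil// !big_cons -IH; case: (f a); case: (\sum_(_ <- _) _).
have ReC (u : R) (w : C) : complex.Re (u%:C * w) = u * complex.Re w.
  by case: w => v w /=; rewrite mul0r subr0.
have ImC (u : R) (w : C) : complex.Im (u%:C * w) = u * complex.Im w.
  by case: w => v w /=; rewrite mul0r addr0.
have ReD (u w : C) : complex.Re (u + w) = complex.Re u + complex.Re w by case: u; case: w.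
have ImD (u w : C) : complex.Im (u + w) = complex.Im u + complex.Im w by case: u; case: w.
pose F x := (reg_weight rs g 0 x)%:C * (A x + \sum_(a <- rs) B a x).
have E1 : tint b (fun x => complex.Re (F x)) = 0.
  rewrite -[RHS](@reg_weight_limit _ _ rs g b rsP bP g_ge0 (fun x => complex.Re (A x))
    (fun a x => complex.Re (B a x))).
  - by congr (tint b); apply/funext => x; rewrite ReC ReD; congr (_ * (_ + _)); exact: ReS.
  - exact: ctorusA.1.
  - by move=> a ars; exact: (ctorusB ars).1.
  - by move=> a x ars ga0; rewrite B0.
  move=> t t0.
  have E0 : tint b (fun x => complex.Re ((reg_weight rs g t x)%:C *
      (A x + \sum_(a <- rs) (chord2 a x / (chord2 a x + t))%:C * B a x))) = 0.
    by have /(congr1 (@complex.Re R)) := form_reg t0.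
  rewrite -[RHS]E0; congr (tint b); apply/funext => x.
  rewrite ReC ReD; congr (_ * (_ + _)); rewrite ReS.
  by apply: eq_bigr => a _; rewrite ReC.
have E2 : tint b (fun x => complex.Im (F x)) = 0.
  rewrite -[RHS](@reg_weight_limit _ _ rs g b rsP bP g_ge0 (fun x => complex.Im (A x))
    (fun a x => complex.Im (B a x))).
  - by congr (tint b); apply/funext => x; rewrite ImC ImD; congr (_ * (_ + _)); exact: ImS.
  - exact: ctorusA.2.
  - by move=> a ars; exact: (ctorusB ars).2.
  - by move=> a x ars ga0; rewrite B0.
  move=> t t0.
  have E0 : tint b (fun x => complex.Im ((reg_weight rs g t x)%:C *
      (A x + \sum_(a <- rs) (chord2 a x / (chord2 a x + t))%:C * B a x))) = 0.
    by have /(congr1 (@complex.Im R)) := form_reg t0.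
  rewrite -[RHS]E0; congr (tint b); apply/funext => x.
  rewrite ImC ImD; congr (_ * (_ + _)); rewrite ImS.
  by apply: eq_bigr => a _; rewrite ImC.
have -> : torus_int b F = Complex (tint b (fun x => complex.Re (F x)))
    (tint b (fun x => complex.Im (F x))) by [].
by rewrite E1 E2.
Qed.

(** The right-hand side is the weighted integral of the product of the gradients of the orbit sum
    and of [e^nu]: a Dirichlet form, whose symmetry is visible. *)
Lemma laplacian_form :
  torus_int b (fun x => L mu x * conjc (ex nu x) * wt x) =
  \sum_(y <- oseq rs mu) (dotp y nu)%:C *
     torus_int b (fun x => ex y x * conjc (ex nu x) * wt x).
Proof.
have cD y : y \in oseq rs mu -> ctorus b (fun x => ex y x * conjc (ex nu x) * wt x).
  move=> yo; apply: ctorusM => //; apply: ctorusM.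
    by apply/weight_ex/weight_oseq/yo.
  by apply: ctorus_conj; exact: weight_ex.
have -> : \sum_(y <- oseq rs mu) (dotp y nu)%:C *
     torus_int b (fun x => ex y x * conjc (ex nu x) * wt x) =
   torus_int b (fun x => \sum_(y <- oseq rs mu) (dotp y nu)%:C *
     (ex y x * conjc (ex nu x) * wt x)).
  rewrite torus_int_sum => [|y yo]; last by apply: ctorus_scale; exact: cD.
  by apply: eq_big_seq => y yo; exact/esym/torus_intZ/cD.
have cS : ctorus b (fun x => \sum_(y <- oseq rs mu) (dotp y nu)%:C *
    (ex y x * conjc (ex nu x) * wt x)).
  by apply: ctorus_sum_seq => y yo; apply: ctorus_scale; exact: cD.
have cL : ctorus b (fun x => L mu x * conjc (ex nu x) * wt x).
  apply: ctorusM => //; apply: ctorusM; first exact: ctorus_laplacian.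
  by apply: ctorus_conj; exact: weight_ex.
apply: subr0_eq; rewrite -(torus_intB cL cS) -[RHS]form_limit.
congr torus_int; apply/funext => x.
rewrite -DeltaHO_reg.
have -> : A x = (dotp mu mu)%:C * m mu x * conjc (ex nu x) -
    \sum_(y <- oseq rs mu) (dotp y nu)%:C * (ex y x * conjc (ex nu x)).
  rewrite /A mulr_sumr mulr_suml -sumrB big_seq [RHS]big_seq; apply: eq_bigr => y yo.
  have -> : dotp (y - nu) y = dotp mu mu - dotp y nu.
    move/(mem_oseqP rsP): yo => [w Ww ->].
    by rewrite dotpBl (dotp_weyl rsP)// (dotpC nu).
  by rewrite exD exN rmorphB; ring.
have -> : \sum_(a <- rs) B a x = 2^-1 * (\sum_(a <- rs) (g a)%:C *
     root_term rs (fun v => ex v x) mu a) * conjc (ex nu x).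
  by rewrite mulr_sumr mulr_suml.
rewrite /laplacian.
have -> : \sum_(y <- oseq rs mu) (dotp y nu)%:C * (ex y x * conjc (ex nu x) * wt x) =
    (\sum_(y <- oseq rs mu) (dotp y nu)%:C * (ex y x * conjc (ex nu x))) * wt x.
  by rewrite mulr_suml; apply: eq_bigr => y _; rewrite !mulrA.
by ring.
Qed.

End Form.
End SelfAdjoint.

(** * The eigenvalue equation *)

Section Positivity.
Context {R : realType} {r : nat} (rs : seq 'rV[R]_r) (h : 'rV[R]_r) (g : 'rV[R]_r -> R)
  (b : 'I_r -> 'rV[R]_r).
Local Notation E := 'rV[R]_r.
Local Notation C := R[i].
Local Notation "x %:C" := (real_complex R x).
Implicit Types (a x y z mu nu lam : E) (q : E -> C).
Hypothesis rsP : root_system rs.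
Hypothesis regh : regular rs h.
Hypothesis bP : zbasis_Qvee rs b.
Hypothesis g_ge0 : forall a, a \in rs -> 0 <= g a.
Hypothesis g_weyl : forall w a, weyl rs w -> a \in rs -> g (a *m w) = g a.
Local Notation L mu x := (laplacian rs g (fun v => ex v x) mu).
Local Notation m mu x := (\sum_(y <- oseq rs mu) ex y x).
Local Notation wt x := ((DeltaHO rs g x)%:C).

Let weight_ex y : weight rs y -> ctorus b (fun x => ex y x).
Proof. exact: (ctorus_ex bP). Qed.

Let ctorus_wt : ctorus b (fun x => wt x).
Proof. by apply: ctorus_real; exact: torus_DeltaHO. Qed.

Let cform q1 q2 : ctorus b q1 -> ctorus b q2 ->
  ctorus b (fun x => q1 x * conjc (q2 x) * wt x).
Proof. by move=> c1 c2; apply: ctorusM => //; apply: ctorusM => //; exact: ctorus_conj. Qed.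

Let conjM (u v : C) : conjc (u * v) = conjc u * conjc v.
Proof. exact: (rmorphM (@conjc R)). Qed.

Let conjS (I : Type) (s : seq I) (k : I -> C) :
  conjc (\sum_(i <- s) k i) = \sum_(i <- s) conjc (k i).
Proof. exact: (rmorph_sum (@conjc R)). Qed.

(** This is [HOinner] without the factor [1 / |W|]. *)
Definition wform q1 q2 : C := torus_int b (fun x => q1 x * conjc (q2 x) * wt x).

Lemma form_sum_l (I : eqType) (s : seq I) (e : I -> C) (k : I -> E -> C) q :
  (forall i, i \in s -> ctorus b (k i)) -> ctorus b q ->
  wform (fun x => \sum_(i <- s) e i * k i x) q = \sum_(i <- s) e i * wform (k i) q.
Proof.
move=> ck cq; rewrite /wform.
have -> : (fun x => (\sum_(i <- s) e i * k i x) * conjc (q x) * wt x) =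
    (fun x => \sum_(i <- s) e i * (k i x * conjc (q x) * wt x)).
  by apply/funext => x; rewrite !mulr_suml; apply: eq_bigr => i _; rewrite !mulrA.
rewrite torus_int_sum => [|i si].
  by apply: eq_big_seq => i si; apply/torus_intZ/cform => //; exact: ck.
by apply: ctorusM; [exact: ctorus_cst|apply: cform => //; exact: ck].
Qed.

Lemma form_conj q1 q2 : ctorus b q1 -> ctorus b q2 -> wform q2 q1 = conjc (wform q1 q2).
Proof.
move=> c1 c2; rewrite /wform -torus_int_conj; last exact: cform.
congr torus_int; apply/funext => x.
by rewrite !conjM conjcK conjc_real; ring.
Qed.

Lemma form_sum_r (I : eqType) (s : seq I) (e : I -> C) (k : I -> E -> C) q :
  (forall i, i \in s -> ctorus b (k i)) -> ctorus b q ->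
  wform q (fun x => \sum_(i <- s) e i * k i x) = \sum_(i <- s) conjc (e i) * wform q (k i).
Proof.
move=> ck cq; rewrite form_conj//; last first.
  by apply: ctorus_sum_seq => i si; apply: ctorusM; [exact: ctorus_cst|exact: ck].
rewrite form_sum_l// conjS; apply: eq_big_seq => i si.
by rewrite conjM -form_conj//; exact: ck.
Qed.

Let m_scale mu x : m mu x = \sum_(y <- oseq rs mu) 1 * ex y x.
Proof. by under [RHS]eq_bigr do rewrite mul1r. Qed.

Let form_laplacian_m mu nu : weight rs mu -> weight rs nu ->
  wform (fun x => L mu x) (fun x => m nu x) =
  \sum_(z <- oseq rs nu) \sum_(y <- oseq rs mu) (dotp y z)%:C * wform (fun x => ex y x) (fun x => ex z x).
Proof.
move=> wmu wnu; have -> : (fun x => m nu x) = (fun x => \sum_(z <- oseq rs nu) 1 * ex z x).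
  by apply/funext => x; exact: m_scale.
rewrite form_sum_r; last exact: ctorus_laplacian.
  apply: eq_big_seq => z zo; rewrite conjc1 mul1r.
  by apply: (laplacian_form rsP bP g_ge0 wmu); exact: (weight_oseq rsP wnu).
by move=> z zo; apply/weight_ex/(weight_oseq rsP wnu).
Qed.

(** Both sides expand by [laplacian_form] into the same double sum over the two orbits, whose
    coefficients [dotp y z] are real and symmetric. *)
Lemma laplacian_selfadjoint mu nu : weight rs mu -> weight rs nu ->
  wform (fun x => L mu x) (fun x => m nu x) = wform (fun x => m mu x) (fun x => L nu x).
Proof.
move=> wmu wnu; rewrite [RHS]form_conj; last 2 first.
- exact: ctorus_laplacian.
- exact: ctorus_msym.
rewrite !form_laplacian_m// conjS exchange_big /=.
apply: eq_big_seq => y yo; rewrite conjS; apply: eq_big_seq => z zo.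
have wy := weight_oseq rsP wmu yo; have wz := weight_oseq rsP wnu zo.
rewrite conjM -form_conj; try exact: weight_ex.
by rewrite dotpC conjc_real.
Qed.

(** The weight may vanish on the walls, where nothing is learnt about [q]; the product of the
    [1 - ex a x] records that exception. *)
Lemma form_definite q : ctorus b q -> wform q q = 0 ->
  forall x, q x * \prod_(a <- rs) (1 - ex a x) = 0.
Proof.
move=> cq fq x; pose F x := (complex.Re (q x) ^+ 2 + complex.Im (q x) ^+ 2) * DeltaHO rs g x.
have tF : torus_class b F.
  apply: torusM; last exact: torus_DeltaHO.
  by apply: torusD; [exact: (torusM cq.1 cq.1)|exact: (torusM cq.2 cq.2)].
have F0 y : 0 <= F y by rewrite mulr_ge0 ?addr_ge0 ?sqr_ge0// DeltaHO_ge0.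
have IF : tint b F = 0.
  have E0 : tint b (fun y => complex.Re (q y * conjc (q y) * wt y)) = 0.
    by have /(congr1 (@complex.Re R)) := fq.
  rewrite -[RHS]E0; congr (tint b); apply/funext => y.
  by rewrite /F; case: (q y) => u v /=; ring.
have := tint_eq0 (coroot_basis_spans rsP bP) tF F0 IF x.
move=> /eqP; rewrite mulf_eq0 => /orP[|/eqP/DeltaHO_eq0 ->]; last by rewrite mulr0.
rewrite paddr_eq0 ?sqr_ge0// !sqrf_eq0 => H.
suff -> : q x = 0 by rewrite mul0r.
by apply/eqP; rewrite eq_complex.
Qed.

(** The zero set of [1 - e^a] has empty interior. If [q] were nonzero at [x], it would be so at
    [x + s *: a] for small [s], and [e^a] would be [1] at both points; but its argument grows by
    [s * dotp a a], which lies in []0, pi]]. *)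
Lemma ctorus_chord_eq0 q a : a \in rs -> ctorus b q ->
  (forall x, q x * (1 - ex a x) = 0) -> forall x, q x = 0.
Proof.
move=> ars [tq1 tq2] qa x; have a0 := root_neq0 rsP ars.
have aa : 0 < dotp a a by rewrite dotp_gt0.
have part (F : E -> R) : torus_class b F -> (forall y, F y != 0 -> q y != 0) -> F x = 0.
  move=> [[_ uF] _] Fq; apply/eqP; apply: contraT => Fx.
  have Fx_gt0 : 0 < `|F x| by rewrite normr_gt0.
  have [d d0 Hd] := uF _ Fx_gt0.
  have exa y : F y != 0 -> ex a y = 1.
    move=> /Fq qy; have /eqP := qa y; rewrite mulf_eq0 (negbTE qy) subr_eq0.
    by move=> /eqP.
  pose K := \sum_j `|a 0 j|; have K0 : 0 <= K by apply: sumr_ge0.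
  have K1 : 0 < K + 1 by lra.
  pose s := Num.min (d / (K + 1)) (pi / dotp a a).
  have s0 : 0 < s by rewrite lt_min !divr_gt0// pi_gt0.
  have sK : s <= d / (K + 1) by rewrite ge_min lexx.
  have sa : s * dotp a a <= pi by rewrite -ler_pdivlMr// ge_min lexx orbT.
  have near_x : near_rv d x (x + s *: a).
    move=> j; rewrite !mxE opprD addrA subrr add0r normrN normrM gtr0_norm//.
    apply: (@le_lt_trans _ _ (d / (K + 1) * K)).
      apply: ler_pM => //; first exact: ltW.
      by rewrite /K (bigD1 j)//= lerDl sumr_ge0.
    by rewrite mulrAC ltr_pdivrMr// ltr_pM2l//; lra.
  have Fy : F (x + s *: a) != 0.
    by apply: contraTneq (Hd _ _ near_x) => ->; rewrite subr0 ltxx.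
  have := exa _ Fy; rewrite exDr (exa _ Fx) mul1r => /(congr1 (@complex.Re R)) /=.
  rewrite dotpZr -cos0 => /cos_inj; rewrite !in_itv/= pi_ge0 lexx sa mulr_ge0 ?ltW//.
  by move=> /(_ isT isT) /eqP; rewrite gt_eqF// mulr_gt0.
apply/eqP; rewrite eq_complex; apply/andP; split; apply/eqP.
  by apply: (part _ tq1) => y; apply: contraNneq => ->.
by apply: (part _ tq2) => y; apply: contraNneq => ->.
Qed.

Lemma ctorus_prod_chord_eq0 q : ctorus b q ->
  (forall x, q x * \prod_(a <- rs) (1 - ex a x) = 0) -> forall x, q x = 0.
Proof.
have H s : {subset s <= rs} -> forall q, ctorus b q ->
    (forall x, q x * \prod_(a <- s) (1 - ex a x) = 0) -> forall x, q x = 0.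
  elim: s => [_ q' _ H x|a s IH sub q' cq H].
    by have := H x; rewrite big_nil mulr1.
  have ars : a \in rs by apply: sub; rewrite mem_head.
  apply: (ctorus_chord_eq0 ars cq); apply: IH.
  - by move=> v vs; apply: sub; rewrite in_cons vs orbT.
  - apply: ctorusM => //; apply: ctorusB; first exact: ctorus_cst.
    by apply: weight_ex; exact: weight_root.
  - by move=> x; have := H x; rewrite big_cons mulrA.
by apply: H.
Qed.

Lemma torus_int_ex_conj y z : weight rs y -> weight rs z ->
  torus_int b (fun x => ex y x * conjc (ex z x)) = (y == z)%:R.
Proof.
move=> wy wz; under eq_fun do rewrite -exN -exD.
have [->|yz] := eqVneq y z.
  by under eq_fun do rewrite subrr ex0; exact: torus_int_cst.
apply: (torus_int_ex rsP bP); last by rewrite subr_eq0.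
by apply: weightD => //; exact: weightN.
Qed.

(** Integrate against the conjugate of [e^nu0] without weight: distinct dominant weights have
    disjoint orbits, so only the coefficient at [nu0] survives. *)
Lemma msym_independent (bs : seq E) (e : E -> C) : uniq bs ->
  (forall nu, nu \in bs -> dominant rs h nu) ->
  (forall x, \sum_(nu <- bs) e nu * m nu x = 0) -> forall nu, nu \in bs -> e nu = 0.
Proof.
move=> bsu bsd q0 nu0 nb; have w0 := (bsd _ nb).1.
have cm nu : nu \in bs -> ctorus b (fun x => m nu x * conjc (ex nu0 x)).
  move=> nubs; apply: ctorusM; last by apply: ctorus_conj; exact: weight_ex.
  by apply: ctorus_msym => //; exact: (bsd _ nubs).1.
have E nu : nu \in bs -> torus_int b (fun x => m nu x * conjc (ex nu0 x)) = (nu == nu0)%:R.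
  move=> nubs; have wnu := (bsd _ nubs).1.
  under eq_fun do rewrite mulr_suml.
  rewrite torus_int_sum => [|y yo]; last first.
    apply: ctorusM; first by apply/weight_ex/(weight_oseq rsP wnu).
    by apply: ctorus_conj; exact: weight_ex.
  rewrite (eq_big_seq (fun y => (y == nu0)%:R)) => [|y yo]; last first.
    by apply: torus_int_ex_conj => //; exact: (weight_oseq rsP wnu).
  have [<-|nn] := eqVneq nu nu0.
    rewrite (bigD1_seq nu) ?oseq_uniq//=; last first.
      by apply/(mem_oseqP rsP); exists 1%:M; [exact: weyl1|rewrite mulmx1].
    by rewrite eqxx big1 ?addr0// => y /negbTE ->.
  rewrite big_seq big1// => y /(mem_oseqP rsP)[w Ww ->].
  have [nuw|//] := eqVneq (nu *m w) nu0.
  case/eqP: nn; apply/esym.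
  exact: (dominant_orbit_uniq rsP regh (bsd _ nubs) (bsd _ nb) Ww (esym nuw)).
have : torus_int b (fun x => \sum_(nu <- bs) e nu * (m nu x * conjc (ex nu0 x))) = 0.
  rewrite -[RHS](torus_int_cst b 0); congr torus_int; apply/funext => x.
  under eq_bigr do rewrite mulrA; by rewrite -mulr_suml q0 mul0r.
rewrite torus_int_sum => [|nu nubs]; last first.
  by apply: ctorusM; [exact: ctorus_cst|exact: cm].
rewrite (eq_big_seq (fun nu => e nu * (nu == nu0)%:R)) => [|nu nubs]; last first.
  by rewrite torus_intZ ?E//; exact: cm.
rewrite (bigD1_seq nu0)//= eqxx mulr1 big1 ?addr0// => nu /negbTE ->.
by rewrite mulr0.
Qed.

Theorem eigen_recurrence lam (bs : seq E) (c : E -> C) : uniq bs ->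
  (forall nu, nu \in bs <-> belowe rs h lam nu) -> lam \in bs -> c lam = 1 ->
  (forall mu, mu \in bs -> mu != lam ->
     wform (fun x => \sum_(nu <- bs) c nu * m nu x) (fun x => m mu x) = 0) ->
  forall nu, nu \in bs ->
   (eps rs h g nu)%:C * c nu + \sum_(mu <- bs) c mu * (dmunu rs h g mu nu)%:C =
   (eps rs h g lam)%:C * c nu.
Proof.
move=> bsu bsP lambs clam orth.
have bsd nu : nu \in bs -> dominant rs h nu by move=> /bsP[].
have bsw nu : nu \in bs -> weight rs nu by move=> /bsd[].
pose p x := \sum_(nu <- bs) c nu * m nu x.
have cm nu : nu \in bs -> ctorus b (fun x => m nu x).
  by move=> nb; apply: ctorus_msym => //; exact: bsw.
have cL nu : nu \in bs -> ctorus b (fun x => L nu x).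
  by move=> nb; apply: ctorus_laplacian => //; exact: bsw.
have cp : ctorus b p.
  by apply: ctorus_sum_seq => nu nb; apply: ctorusM; [exact: ctorus_cst|exact: cm].
pose epsC nu := (eps rs h g nu)%:C; pose d mu nu := (dmunu rs h g mu nu)%:C.
pose e nu := epsC nu * c nu + \sum_(mu <- bs) c mu * d mu nu - epsC lam * c nu.
have LE mu x : mu \in bs -> L mu x = epsC mu * m mu x + \sum_(nu <- bs) d mu nu * m nu x.
  move=> mubs; apply: (laplacian_triangular rsP regh g_weyl) => //; first exact: bsd.
  move=> nu dnu [numu _]; apply/bsP; split => //.
  by apply: wle_trans numu _; have /bsP[] := mubs.
have qE x : \sum_(nu <- bs) e nu * m nu x = \sum_(mu <- bs) c mu * L mu x - epsC lam * p x.
  rewrite (eq_big_seq (fun nu => epsC nu * c nu * m nu x +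
      (\sum_(mu <- bs) c mu * d mu nu) * m nu x - epsC lam * (c nu * m nu x))); last first.
    by move=> nu _; rewrite /e mulrBl mulrDl mulrA.
  rewrite sumrB -mulr_sumr -/(p x); congr (_ - _).
  rewrite [RHS](eq_big_seq (fun mu => epsC mu * c mu * m mu x +
      \sum_(nu <- bs) c mu * d mu nu * m nu x)); last first.
    move=> mu mubs; rewrite (LE mu x mubs) mulrDr mulr_sumr; congr (_ + _); first by ring.
    by apply: eq_bigr => nu _; rewrite mulrA.
  rewrite !big_split /=; congr (_ + _).
  under eq_bigr do rewrite mulr_suml.
  by rewrite exchange_big.
pose q x := \sum_(nu <- bs) e nu * m nu x.
have cq : ctorus b q.
  by apply: ctorus_sum_seq => nu nb; apply: ctorusM; [exact: ctorus_cst|exact: cm].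
have d0 mu nu : mu \in bs -> nu \in bs -> ~ wlt rs h nu mu -> d mu nu = 0.
  by move=> mb nb H; rewrite /d (dmunu_eq0 g rsP regh) ?rmorph0//; exact: bsd.
have nlam mu : mu \in bs -> ~ wlt rs h lam mu.
  move=> /bsP[_ mulam] [lammu ne]; apply: ne.
  exact: (wle_anti lammu mulam).
(* No element of [bs] has [lam] strictly below it, so the [d] terms vanish and the leading
   coefficients of [L p] and [eps_lam p] cancel. *)
have elam : e lam = 0.
  rewrite /e clam big_seq big1; first by ring.
  by move=> mu mb; rewrite d0 ?mulr0//; exact: nlam.
(* Self-adjointness moves [L] onto [m nu]. For [nu] other than [lam] the expansion of [L] there has
   no component along [m lam], so orthogonality of [p] kills every term. *)
have qm nu : nu \in bs -> nu != lam -> wform q (fun x => m nu x) = 0.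
  move=> nb nn.
  have -> : wform q (fun x => m nu x) = wform p (fun x => L nu x) - epsC lam * wform p (fun x => m nu x).
    have cpm := cform cp (cm _ nb).
    have cpL : ctorus b (fun x => (\sum_(mu <- bs) c mu * L mu x) * conjc (m nu x) * wt x).
      apply: cform; last exact: cm.
      by apply: ctorus_sum_seq => mu mb; apply: ctorusM; [exact: ctorus_cst|exact: cL].
    rewrite {1}/wform (_ : (fun x => q x * _ * _) = fun x =>
       (\sum_(mu <- bs) c mu * L mu x) * conjc (m nu x) * wt x -
       epsC lam * (p x * conjc (m nu x) * wt x)); last first.
      by apply/funext => x; rewrite /q qE !mulrBl !mulrA.
    have cpe := ctorusM (ctorus_cst b (epsC lam)) cpm.
    rewrite (torus_intB cpL cpe) (torus_intZ (epsC lam) cpm); congr (_ - _).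
    have -> : torus_int b (fun x => (\sum_(mu <- bs) c mu * L mu x) * conjc (m nu x) * wt x) =
       wform (fun x => \sum_(mu <- bs) c mu * L mu x) (fun x => m nu x) by [].
    rewrite (form_sum_l c cL (cm _ nb)) (form_sum_l c cm (cL _ nb)).
    by apply: eq_big_seq => mu mb; rewrite laplacian_selfadjoint//; exact: bsw.
  rewrite (orth _ nb nn) mulr0 subr0.
  pose e' ka := epsC nu * (ka == nu)%:R + d nu ka.
  have -> : (fun x => L nu x) = (fun x => \sum_(ka <- bs) e' ka * m ka x).
    apply/funext => x; rewrite (LE _ _ nb) /e'.
    under [RHS]eq_bigr do rewrite mulrDl.
    rewrite big_split /=; congr (_ + _); rewrite [RHS](bigD1_seq nu)//= eqxx mulr1.
    by rewrite [X in _ = _ + X]big1 ?addr0// => ka /negbTE ->; rewrite mulr0 mul0r.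
  rewrite (form_sum_r e' cm cp) big_seq big1// => ka kb.
  have [kl|kl] := eqVneq ka lam; last by rewrite (orth _ kb kl) mulr0.
  rewrite /e' kl eq_sym (negbTE nn) mulr0 add0r d0 ?conjc0 ?mul0r//.
  exact: nlam.
have fqq : wform q q = 0.
  rewrite {2}/q (form_sum_r e cm cq) big_seq big1// => nu nb.
  have [->|nn] := eqVneq nu lam; first by rewrite elam conjc0 mul0r.
  by rewrite (qm _ nb nn) mulr0.
have q0 := ctorus_prod_chord_eq0 cq (form_definite cq fqq).
move=> nu nb; apply: subr0_eq; exact: (msym_independent bsu bsd q0 nb).
Qed.

End Positivity.

(** * Path sums and determinant *)

Section PathSums.
Context {F : fieldType} (n : nat) (d : nat -> nat -> F) (v : nat -> F).

(** A path with [t.+1] edges has [t.+2] vertices, so the length [r] of the formula is [t.+1]. *)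
Definition descending t (l : nat) (j : {ffun 'I_t.+2 -> 'I_n.+1}) : bool :=
  [&& (j ord0 == n :> nat), (j ord_max == l :> nat) &
      [forall s : 'I_t.+1, (j (inord s.+1) < j (inord s))%N]].

Definition path_weight t (j : {ffun 'I_t.+2 -> 'I_n.+1}) : F :=
  (\prod_(s < t.+1) d (j (inord s)) (j (inord s.+1))) /
  (\prod_(s < t.+1) v (j (inord s.+1))).

Definition path_sum t l : F := \sum_(j | @descending t l j) path_weight j.

Lemma descending_bound t l j : @descending t l j -> (l + t < n)%N.
Proof.
move=> /and3P[/eqP j0 /eqP jl /forallP H].
have B (s : nat) : (s <= t.+1)%N -> (j (inord s) + s <= n)%N.
  elim: s => [_|s IH st].
    by rewrite (_ : inord 0 = ord0) ?j0 ?addn0//; apply: val_inj; rewrite /= inordK.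
  have := H (Ordinal st); rewrite /= => Hs.
  by have := IH (ltnW st); lia.
have := B t.+1 (leqnn _); rewrite (_ : inord t.+1 = ord_max) ?jl; last first.
  by apply: val_inj; rewrite /= inordK.
lia.
Qed.

(** Each edge lowers the vertex by at least one. This allows sums over path lengths to be extended
    to a common range. *)
Lemma path_sum_eq0 t l : (n <= l + t)%N -> path_sum t l = 0.
Proof.
move=> nlt; rewrite /path_sum big_pred0// => j; apply/negP => /descending_bound.
lia.
Qed.

Lemma path_sum0 l : (l < n)%N -> path_sum 0 l = d n l / v l.
Proof.
move=> ln; have ln1 : (l < n.+1)%N by exact: ltnW.
pose j0 : {ffun 'I_2 -> 'I_n.+1} := [ffun s => if s == ord0 then ord_max else Ordinal ln1].
have i0 : (inord 0 : 'I_2) = ord0 by apply: val_inj; rewrite /= inordK.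
have i1 : (inord 1 : 'I_2) = ord_max by apply: val_inj; rewrite /= inordK.
rewrite /path_sum (big_pred1 j0) => [|j].
  by rewrite /path_weight !big_ord_recl !big_ord0 !mulr1 /= i0 i1 !ffunE /=.
apply/and3P/eqP => [[/eqP a /eqP c _]|->].
  apply/ffunP => s; rewrite ffunE; case: eqP => [->|/eqP s0]; apply: val_inj => //=.
  rewrite -c; congr (nat_of_ord (j _)); apply: val_inj => /=.
  by case: s s0 => [[|[|]]].
rewrite !ffunE /= !eqxx; split => //; apply/forallP => s.
have -> : s = ord0 by apply: val_inj; case: s => [[|]].
by rewrite /= i0 i1 !ffunE.
Qed.

(* [k] is the last vertex of the path before [l]. *)
Lemma path_sumS t l : (l < n)%N ->
  path_sum t.+1 l = \sum_(k < n.+1 | (l < k)%N) path_sum t k * (d k l / v l).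
Proof.
move=> ln; have ln1 : (l < n.+1)%N by exact: ltnW.
pose ext (j : {ffun 'I_t.+2 -> 'I_n.+1}) : {ffun 'I_t.+3 -> 'I_n.+1} :=
  [ffun s : 'I_t.+3 => if (s < t.+2)%N then j (inord s) else Ordinal ln1].
pose res (j : {ffun 'I_t.+3 -> 'I_n.+1}) : {ffun 'I_t.+2 -> 'I_n.+1} :=
  [ffun s : 'I_t.+2 => j (inord s)].
have extE (j : {ffun 'I_t.+2 -> 'I_n.+1}) (s : nat) : (s < t.+2)%N ->
    ext j (inord s) = j (inord s).
  by move=> st; rewrite ffunE inordK ?st//; exact: ltnW.
have extM (j : {ffun 'I_t.+2 -> 'I_n.+1}) (s : 'I_t.+3) : (s : nat) = t.+2 ->
    ext j s = Ordinal ln1.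
  by move=> st; rewrite ffunE st ltnn.
have mx (u : nat) : (inord u.+1 : 'I_u.+2) = ord_max.
  by apply: val_inj; rewrite /= inordK.
have z0 (u : nat) : (inord 0 : 'I_u.+1) = ord0.
  by apply: val_inj; rewrite /= inordK.
rewrite /path_sum (reindex_onto ext res) => [|j /and3P[_ /eqP jl _]]; last first.
  apply/ffunP => s; rewrite ffunE; case: ifP => [st|/negbT st].
    by rewrite ffunE; congr (j _); apply: val_inj; rewrite /= inordK ?inordK//; exact: ltnW.
  have -> : s = ord_max by apply: val_inj => /=; have := ltn_ord s; lia.
  by apply: val_inj; rewrite /= jl.
rewrite (eq_bigl (fun j : {ffun 'I_t.+2 -> 'I_n.+1} => [&& (j ord0 == n :> nat), (l < j ord_max)%N &
    [forall s : 'I_t.+1, (j (inord s.+1) < j (inord s))%N]])) => [|j]; last first.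
  have -> : res (ext j) == j.
    apply/eqP/ffunP => s; rewrite ffunE extE//; congr (j _).
    by apply: val_inj; rewrite /= inordK.
  rewrite andbT /descending -{1}z0 extE// z0 extM// eqxx /=; congr (_ && _).
  apply/forallP/andP => [H|[lj /forallP H] s].
    split.
      have := H ord_max; rewrite /= mx extM// -(mx t) => H'.
      by move: H'; rewrite extE.
    apply/forallP => s; have st := ltn_ord s; have := H (widen_ord (leqnSn _) s).
    by rewrite /= !extE//; lia.
  have [st|st] := ltnP s t.+1.
    by rewrite !extE//; exact: (H (Ordinal st)).
  have -> : (s : nat) = t.+1 by have := ltn_ord s; lia.
  by rewrite mx extM// extE// mx.
rewrite (partition_big (fun j : {ffun 'I_t.+2 -> 'I_n.+1} => j ord_max)
   (fun k : 'I_n.+1 => (l < k)%N)) => [|j /and3P[]//].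
apply: eq_bigr => k lk; rewrite mulr_suml; apply: eq_big => [j|j].
  rewrite /descending -val_eqE /=; case: (j ord0 == n :> nat) => //=.
  rewrite andbC; case: eqP => //= ->; by rewrite lk.
move=> /andP[_ /eqP jk]; rewrite /path_weight.
have P (f : nat -> F) : \prod_(s < t.+2) f s = (\prod_(s < t.+1) f s) * f t.+1.
  exact: big_ord_recr.
rewrite (P (fun s => d (ext j (inord s)) (ext j (inord s.+1)))) (P (fun s => v (ext j (inord s.+1)))).
rewrite (mx t.+1) (extM j ord_max (erefl _)) (extE j t.+1 (ltnSn _)) (mx t) jk /= invfM mulrACA; congr (_ * _ * _).
  by apply: eq_bigr => s _; have st := ltn_ord s; rewrite !extE//; lia.
by congr (_^-1); apply: eq_bigr => s _; have st := ltn_ord s; rewrite !extE//; lia.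
Qed.

Definition path_total l : F := if l == n then 1 else \sum_(t < n - l) path_sum t l.

(** Paths are sorted by the vertex [k] preceding [l]; removing the last edge leaves a path ending at
    [k]. *)
Lemma path_total_rec l : (l < n)%N ->
  path_total l = \sum_(l.+1 <= k < n.+1) path_total k * (d k l / v l).
Proof.
move=> ln; rewrite /path_total ltn_eqF//.
(* Padding with zero sums gives all end vertices the same range of lengths, so the two summations
   can be exchanged. *)
have W k N : (n - k <= N)%N -> \sum_(t < n - k) path_sum t k = \sum_(t < N) path_sum t k.
  move=> kN; rewrite (big_ord_widen _ (path_sum^~ k) kN) big_mkcond; apply: eq_bigr => t _.
  by case: ltnP => // kt; rewrite path_sum_eq0//; lia.
rewrite (W l n.+1); last lia.
rewrite big_ord_recl path_sum0//= big_nat_recr//= eqxx mul1r addrC; congr (_ + _).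
under eq_bigr => t _ do rewrite /bump /= add1n path_sumS//.
rewrite exchange_big /=.
pose G k := (\sum_(t < n) path_sum t k) * (d k l / v l).
rewrite (eq_bigr (fun k : 'I_n.+1 => G k)) => [|k _]; last by rewrite /G mulr_suml.
rewrite -(big_mkord (fun k => (l < k)%N) G) big_mkcond big_nat_recr//= ln.
(* No path with an edge ends at its start [n]. The term [k = n] of the recurrence is the single-edge
   path, already split off. *)
have -> : G n = 0 by rewrite /G big1 ?mul0r// => t _; rewrite path_sum_eq0// leq_addr.
rewrite addr0 -big_mkcond (big_cat_nat _ (n := l.+1))//= big_nat_cond big1 ?add0r; last first.
  by move=> k /andP[/andP[_ kl] lk]; move: kl lk; lia.
rewrite big_nat_cond [RHS]big_nat; apply: eq_big => [k|k]; first lia.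
move=> /andP[/andP[lk kn] _]; rewrite ltn_eqF// /G (W k n)//; exact: leq_subr.
Qed.

End PathSums.

(* The hypotheses say that the row vector [c] times the matrix is [(P, 0, .., 0)]
   with [P] the last sum; multiplying by the adjugate leaves a single cofactor,
   whose minor is triangular. *)
Lemma det_recurrence (F : fieldType) (N : nat) (c m e : nat -> F) (d : nat -> nat -> F) :
  c N.+1 = 1 ->
  (forall k, (1 <= k <= N)%N ->
     c k * (e k - e N.+1) + \sum_(k.+1 <= j < N.+2) c j * d j k = 0) ->
  \det (\matrix_(i < N.+1, j < N.+1)
     (if j == 0%N :> nat then m i.+1
      else if (i.+1 < j)%N then 0
      else if i.+1 == j then e j - e N.+1 else d i.+1 j)) =
  (\prod_(i < N) (e N.+1 - e i.+1)) * \sum_(j < N.+1) c j.+1 * m j.+1.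
Proof.
move=> cN H; set M := \matrix_(i, j) _.
pose cv := \row_(i < N.+1) c i.+1.
pose P := \sum_(j < N.+1) c j.+1 * m j.+1.
have cM : cv *m M = P *: delta_mx 0 ord0.
  apply/rowP => j; rewrite !mxE eqxx /= -val_eqE /=.
  have [j0|j0] := eqVneq (val j) 0%N.
    rewrite mulr1 /P; apply: eq_bigr => i _.
    by rewrite !mxE j0.
  rewrite mulr0; have jN : (0 < j <= N)%N by have := ltn_ord j; move: j0 => /=; lia.
  rewrite -[RHS](H _ jN).
  pose G i := if (i < j)%N then 0 else if i == j then c j * (e j - e N.+1) else c i * d i j.
  rewrite (eq_bigr (fun i : 'I_N.+1 => G i.+1)) => [|i _]; last first.
    rewrite !mxE (negbTE j0) /G; case: ifP => _; first by rewrite mulr0.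
    by case: eqP => [<-|].
  rewrite -(big_mkord xpredT (fun i => G i.+1)) -(big_add1 _ _ 0 N.+2 xpredT G).
  rewrite (big_cat_nat _ (n := j))//=; [|lia|lia].
  rewrite big_nat_cond big1 ?add0r => [|i /andP[/andP[_ ij] _]]; last by rewrite /G ij.
  rewrite big_ltn; last lia.
  rewrite {1}/G ltnn eqxx; congr (_ + _); apply: eq_big_nat => i /andP[ji _].
  by rewrite /G ltnNge (ltnW ji) /= gtn_eqF.
have := congr1 (fun u : 'rV_N.+1 => (u *m \adj M) 0 ord_max) cM.
rewrite /= -mulmxA mul_mx_adj mul_mx_scalar -scalemxAl -rowE !mxE cN mulr1 => ->.
rewrite mulrC; congr (_ * _); rewrite /cofactor /= addn0.
have iN (i : 'I_N) : (N <= i)%N = false by have := ltn_ord i; lia.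
have tr : is_trig_mx (row' ord_max (col' ord0 M)).
  by apply/is_trig_mxP => i j ij; rewrite !mxE /= /bump /= iN add0n add1n ltnS ij.
(* The cofactor sign [(-1)^N] is distributed over the [N] diagonal entries, turning [e i - e N.+1]
   into its opposite. *)
rewrite det_trig// -[N in (-1) ^+ N]card_ord -prodr_const -big_split /=.
apply: eq_bigr => i _; rewrite !mxE /= /bump /= iN add0n add1n ltnn eqxx.
by ring.
Qed.

(** * From the eigenvalue equation to the three formulas *)

Theorem mainTheorem7 (R : realType) (r : nat) (rs : seq 'rV[R]_r) (h : 'rV[R]_r)
  (g : 'rV[R]_r -> R) (b : 'I_r -> 'rV[R]_r) (lam : 'rV[R]_r)
  (c : 'rV[R]_r -> R[i]) (n : nat) (lamseq : nat -> 'rV[R]_r) :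
  (0 < r)%N -> root_system rs -> irreducible_rs rs -> regular rs h ->
  (forall a, a \in rs -> 0 <= g a) ->
  (forall w a, weyl rs w -> a \in rs -> g (a *m w) = g a) ->
  zbasis_Qvee rs b ->
  dominant rs h lam ->
  (* p_lambda = m_lambda + sum_{mu in P^+, mu < lambda} c_{lambda mu} m_mu,
     orthogonal to all m_mu, mu in P^+, mu < lambda; convention c_{lambda lambda} = 1 *)
  let p := fun x => msym rs lam x +
             \sum_(mu <- fset_set (below rs h lam)) c mu * msym rs mu x in
  c lam = 1 ->
  (forall mu, dominant rs h mu -> wlt rs h mu lam ->
     HOinner rs g b p (msym rs mu) = 0) ->
  (* lamseq 1, ..., lamseq n : an enumeration of {mu in P^+ | mu <= lambda}
     compatible with the order, with lamseq n = lambda *)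
  (forall i, (1 <= i <= n)%N -> belowe rs h lam (lamseq i)) ->
  (forall mu, belowe rs h lam mu -> exists2 i, (1 <= i <= n)%N & lamseq i = mu) ->
  (forall i j, (1 <= i <= n)%N -> (1 <= j <= n)%N -> lamseq i = lamseq j -> i = j) ->
  lamseq n = lam ->
  (forall i j, (1 <= i <= n)%N -> (1 <= j <= n)%N ->
     wlt rs h (lamseq i) (lamseq j) -> (i < j)%N) ->
  let eps' := eps rs h g in
  let d := dmunu rs h g in
  (* (i) *)
  (forall x, p x = ((Elam rs h g lam)^-1)%:C%C *
     \det (\matrix_(i < n, j < n)
             (if j == 0%N :> nat then msym rs (lamseq i.+1) x
              else if (i.+1 < j)%N then 0
              else if i.+1 == j then ((eps' (lamseq j) - eps' lam)%:C)%C
              else ((d (lamseq i.+1) (lamseq j))%:C)%C))) /\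
  (* (ii) *)
  (c lam = 1 /\
   forall l, (1 < l <= n)%N ->
     c (lamseq l.-1) =
       (((eps' lam - eps' (lamseq l.-1))^-1)%:C)%C *
       \sum_(l <= k < n.+1) c (lamseq k) * ((d (lamseq k) (lamseq l.-1))%:C)%C) /\
  (* (iii) *)
  (forall l, (1 <= l <= n)%N ->
     c (lamseq l) =
       if l == n then 1
       else \sum_(t < n - l)
              \sum_(j : {ffun 'I_t.+2 -> 'I_n.+1} |
                      [&& (j ord0 == n :> nat), (j ord_max == l :> nat) &
                          [forall s : 'I_t.+1, (j (inord s.+1) < j (inord s))%N]])
                (((\prod_(s < t.+1) d (lamseq (j (inord s))) (lamseq (j (inord s.+1))))
                  / (\prod_(s < t.+1) (eps' lam - eps' (lamseq (j (inord s.+1))))))%:C)%C).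
Proof.
move=> r0 rsP _ regh g0 gW bP dlam p clam orth lb lc li lamn lo eps' d.
have lam_le : belowe rs h lam lam by split => //; exact: wle_refl.
case: n lb lc li lamn lo => [|N] lb lc li lamn lo.
  by have [k hk _] := lc _ lam_le; move: hk; lia.
pose bs' := [seq lamseq i | i <- iota 1 N].
pose bs := [seq lamseq i | i <- iota 1 N.+1].
have bsE : bs = rcons bs' lam.
  by rewrite /bs /bs' -[X in rcons _ X]lamn -[in LHS](addn1 N) iotaD map_cat /= cats1 add1n.
have bsu : uniq bs.
  rewrite map_inj_in_uniq ?iota_uniq// => i j; rewrite !mem_iota => hi hj.
  by apply: li; lia.
have bsP nu : nu \in bs <-> belowe rs h lam nu.
  split=> [/mapP[k]|/lc[k hk <-]]; last by apply: map_f; rewrite mem_iota; lia.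
  by rewrite mem_iota => hk ->; apply: lb; lia.
have bs'P nu : nu \in bs' <-> below rs h lam nu.
  have lamN : lam \notin bs' by move: bsu; rewrite bsE rcons_uniq => /andP[].
  split=> [nb|[dnu [nul ne]]].
    have /bsP[dnu nul] : nu \in bs by rewrite bsE mem_rcons in_cons nb orbT.
    by split => //; split => // E; move: lamN; rewrite -E nb.
  have /bsP : belowe rs h lam nu by [].
  by rewrite bsE mem_rcons in_cons => /orP[/eqP|].
have below_perm : perm_eq (fset_set (below rs h lam)) bs'.
  (* Finiteness comes from the given enumeration; it matters because [fset_set] of an infinite set
     is empty. *)
  have fin : finite_set (below rs h lam).
    apply: (@sub_finite_set _ _ [set` bs']) => [nu /bs'P//|].
    exact: finite_seq.
  apply: uniq_perm; first exact: fset_uniq.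
    by move: bsu; rewrite bsE rcons_uniq => /andP[].
  move=> nu; rewrite in_fset_set//; apply/idP/idP; first by move=> /set_mem/bs'P.
  by move=> /bs'P/mem_set.
have sum_bs (V : nmodType) (G : 'rV[R]_r -> V) :
    \sum_(nu <- bs) G nu = \sum_(1 <= i < N.+2) G (lamseq i).
  by rewrite big_map /index_iota subn1.
have pE x : p x = \sum_(nu <- bs) c nu * msym rs nu x.
  by rewrite /p (perm_big _ below_perm) bsE big_rcons /= clam mul1r addrC.
have lambs : lam \in bs by apply/bsP.
have orth' mu : mu \in bs -> mu != lam ->
    wform rs g b (fun x => \sum_(nu <- bs) c nu * msym rs nu x) (fun x => msym rs mu x) = 0.
  move=> /bsP[dmu mul] ne.
  have /eqP := orth mu dmu (conj mul (fun E => negP ne (introT eqP E))).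
  rewrite /HOinner mulf_eq0 => /orP[|/eqP H].
    rewrite fmorph_eq0 invr_eq0 pnatr_eq0 cardfs_eq0 => /eqP W0.
    by have /(mem_wseq rsP) := weyl1 rs; rewrite /wseq W0 inE.
  by rewrite -[RHS]H /wform; congr torus_int; apply/funext => x; rewrite -pE.
have rec := eigen_recurrence rsP regh bP g0 gW bsu bsP lambs clam orth'.
pose e k := eps' (lamseq k); pose dd j k := d (lamseq j) (lamseq k).
(* In the eigenvalue equation at [lamseq k], a nonzero [d] coefficient from [lamseq j] forces
   [lamseq k] strictly below [lamseq j], hence [k < j] by compatibility of the enumeration. *)
have recN k : (1 <= k <= N.+1)%N ->
    ((e N.+1 - e k)%:C)%C * c (lamseq k) =
    \sum_(k.+1 <= j < N.+2) c (lamseq j) * ((dd j k)%:C)%C.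
  move=> hk; have kbs : lamseq k \in bs by apply/bsP/lb.
  have := rec _ kbs; rewrite sum_bs (big_cat_nat _ (n := k.+1))//=; [|lia].
  rewrite [X in _ + (X + _) = _]big_nat_cond big1 ?add0r => [E|j /andP[hj _]]; last first.
    rewrite (dmunu_eq0 g rsP regh) ?rmorph0 ?mulr0//; try by (apply: (lb _ _).1; lia).
    by move=> /(lo k j); move: hj hk; lia.
  rewrite rmorphB mulrBl /e lamn -[X in X - _]E addrC addrA addNr add0r.
  by [].
have e_lt k : (1 <= k <= N)%N -> e k < e N.+1.
  move=> hk; have hk' : (1 <= k <= N.+1)%N by lia.
  have [dk lk] := lb k hk'; rewrite /e lamn; apply: eps_lt => //.
  split=> // E; have : k = N.+1 by apply: li => //; [lia|rewrite lamn].
  by lia.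
have ElamE : Elam rs h g lam = \prod_(i < N) (e N.+1 - e i.+1).
  rewrite /Elam (perm_big _ below_perm) big_map /=.
  rewrite -(big_mkord xpredT (fun i => e N.+1 - e i.+1)).
  rewrite -(big_add1 _ _ 0 N.+1 xpredT (fun i => e N.+1 - e i)) /index_iota subn1.
  by rewrite /e lamn.
have Elam0 : Elam rs h g lam != 0.
  rewrite ElamE; apply/prodf_neq0 => i _; rewrite subr_eq0 gt_eqF//.
  by apply: e_lt; exact: ltn_ord.
split; last split; last first.
- pose v k := e N.+1 - e k.
  (* Descending induction from the top index, where both sides are [1]: coefficients and path sums
     satisfy the same recurrence. *)
  have ptE l : (1 <= l <= N.+1)%N -> c (lamseq l) = ((path_total N.+1 dd v l)%:C)%C.
    have [k] := ubnP (N.+1 - l); elim: k l => // k IH l lk hl.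
    have [lN|lN] := eqVneq l N.+1; first by rewrite lN /path_total eqxx lamn.
    have hl' : (1 <= l <= N)%N by lia.
    rewrite path_total_rec; last lia.
    have v0 : v l != 0 by rewrite /v subr_eq0 gt_eqF// e_lt.
    apply: (mulfI (_ : ((v l)%:C)%C != 0)); first by rewrite fmorph_eq0.
    rewrite recN// -rmorphM mulr_sumr rmorph_sum; apply: eq_big_nat => j hj.
    rewrite IH; [|lia|lia].
    by rewrite -rmorphM; congr (_%:C)%C; field.
  move=> l hl; rewrite ptE// /path_total; case: eqP => // _.
  rewrite rmorph_sum; apply: eq_bigr => t _; rewrite rmorph_sum; apply: eq_bigr => j _.
  by rewrite /path_weight /v /e lamn.
- split=> // -[//|l] hl /=.
  have hl' : (1 <= l <= N)%N by lia.
  have E0 : ((eps' lam - eps' (lamseq l))%:C)%C != 0 :> R[i].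
    by rewrite fmorph_eq0 subr_eq0 gt_eqF//; have := e_lt _ hl'; rewrite /e lamn.
  apply: (mulfI E0); have hl2 : (1 <= l <= N.+1)%N by lia.
  have := recN l hl2; rewrite /e lamn => ->.
  by rewrite mulrA -rmorphM divff ?mul1r//; move: E0; rewrite fmorph_eq0.
move=> x; pose eC k := ((e k)%:C)%C : R[i].
have := @det_recurrence _ N (fun k => c (lamseq k)) (fun k => msym rs (lamseq k) x) eC
  (fun j k => ((dd j k)%:C)%C).
rewrite lamn clam => /(_ erefl) H.
rewrite (_ : \det _ = \det (\matrix_(i < N.+1, j < N.+1)
     (if j == 0%N :> nat then msym rs (lamseq i.+1) x
      else if (i.+1 < j)%N then 0
      else if i.+1 == j then eC j - eC N.+1 else ((dd i.+1 j)%:C)%C))); last first.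
  congr (\det _); apply/matrixP => i j; rewrite !mxE.
  by case: ifP => // _; case: ifP => // _; case: ifP => // _; rewrite rmorphB /eC /e lamn.
rewrite H => [|k hk].
  have -> : \prod_(i < N) (eC N.+1 - eC i.+1) = ((Elam rs h g lam)%:C)%C.
    by rewrite ElamE rmorph_prod; apply: eq_bigr => i _; rewrite rmorphB.
  rewrite mulrA -rmorphM mulVf// mul1r pE sum_bs.
  by rewrite (big_add1 _ _ 0 N.+2 xpredT) big_mkord.
have hk' : (1 <= k <= N.+1)%N by lia.
by rewrite -recN// rmorphB /eC; ring.
Qed.
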